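(* Let $p>5$ be a prime, let $n,k\ge1$ be integers with $n\equiv k\pmod2$, let $f\in\mathscr{S}_{2k}({\rm SL}_2(\mathbb{Z}))$ be a normalized Hecke eigenform that is ordinary at $p$, and let $h\in\mathscr{S}^+_{k+1/2}(\Gamma_0(4))^{(1)}$ be a Hecke eigenform corresponding to $f$ via the Shimura correspondence. Let ${\rm Lift}^{(2n)}(f)\in\mathscr{S}_{k+n}({\rm Sp}_{4n}(\mathbb{Z}))$ be the Duke–Imamoğlu lifting of $f$ formed with $h$ and let ${\rm Lift}^{(2n)}(f)^*$ be its $p$-stabilization. If $0<T\in{\rm Sym}_{2n}^*(\mathbb{Z})$ satisfies $\mathfrak D_T=\mathfrak d_T\mathfrak f_T^2$, then $$A_T({\rm Lift}^{(2n)}(f)^* )=\left(1-\left(\frac{\mathfrak d_T}{p}\right)\beta_p(f)p^{-k}\right)c_{|\mathfrak d_T|}(h)\;\alpha_p(f)^{v_p(\mathfrak f_T)+n(n+1)}\prod_{l|\mathfrak f_T,\ l\ne p}\alpha_l(f)^{v_l(\mathfrak f_T)}F_l(T;\,l^{-k-n}\beta_l(f)).$$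
   Context: Embeddings. $\overline{\mathbb{Q}}\subset\mathbb{C}$ and an embedding $\overline{\mathbb{Q}}\hookrightarrow\overline{\mathbb{Q}}_p$ are fixed; $v_l$ is the $l$-adic valuation. Roots. For a normalized Hecke eigenform $f=\sum a_m(f)q^m\in\mathscr{S}_{2k}({\rm SL}_2(\mathbb{Z}))$ and a prime $l$, $(\alpha_l(f),\beta_l(f))$ is the ordered pair of roots of $X^2-a_l(f)X+l^{2k-1}$ with $v_l(\alpha_l(f))\le v_l(\beta_l(f))$. $f$ is ordinary at $p$ if $\alpha_p(f)$ is a $p$-adic unit. Half-integral weight. $\mathscr{S}^+_{k+1/2}(\Gamma_0(4))^{(1)}$ is Kohnen's plus space: cusp forms $h=\sum c_m(h)q^m$ of weight $k+1/2$ on $\Gamma_0(4)$ with $c_m(h)=0$ unless $(-1)^km\equiv0,1\pmod4$. $h$ corresponds to $f$ if $c_{|\mathfrak d|m^2}(h)=c_{|\mathfrak d|}(h)\sum_{d|m}\mu(d)\left(\frac{\mathfrak d}{d}\right)d^{k-1}a_{m/d}(f)$ for all fundamental discriminants $\mathfrak d$ ($1$ allowed) with $(-1)^k\mathfrak d>0$ and all $m\ge1$; such $h\neq 0$ is unique up to a scalar. Siegel forms. ${\rm Sym}_{2n}^*(\mathbb{Z})$ is the set of half-integral symmetric $2n\times2n$ matrices; $A_T(F)$ is the $T$-th Fourier coefficient of $F=\sum_TA_T(F)q^T$, $q^T=\exp(2\pi\sqrt{-1}\,{\rm trace}(TZ))$. For $T>0$, $\mathfrak D_T:=(-1)^n\det(2T)=\mathfrak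 d_T\mathfrak f_T^2$ with $\mathfrak d_T$ a fundamental discriminant ($1$ allowed) and $\mathfrak f_T\ge1$. $F_l(T;X)\in\mathbb{Z}[X]$ is the polynomial defined by $$\sum_{R\in{\rm Sym}_{2n}(\mathbb{Q}_l)/{\rm Sym}_{2n}(\mathbb{Z}_l)}e_l({\rm trace}(TR))X^{v_l(\nu_R)}=\frac{(1-X)\prod_{i=1}^n(1-l^{2i}X^2)}{1-\left(\frac{\mathfrak d_T}{l}\right)l^nX}F_l(T;X),$$ $\nu_R=[\mathbb{Z}_l^{2n}+\mathbb{Z}_l^{2n}R:\mathbb{Z}_l^{2n}]$, $e_l$ the standard additive character of $\mathbb{Q}_l$ (with $e_l(y)=e^{2\pi\sqrt{-1}y}$ for $y\in\mathbb{Z}[1/l]$). Lifting (Ikeda). ${\rm Lift}^{(2n)}(f)=\sum_{T>0}A_Tq^T$ with $A_T=c_{|\mathfrak d_T|}(h)\prod_{l|\mathfrak f_T}\alpha_l(f)^{v_l(\mathfrak f_T)}F_l(T;\beta_l(f)l^{-k-n})$; it is a Hecke eigenform in $\mathscr{S}_{k+n}({\rm Sp}_{4n}(\mathbb{Z}))$. $p$-stabilization. Put $\psi_0(p)=p^{nk-n(n+1)/2}$, $\psi_i(p)=\alpha_p(f)p^{-k+i}$ for $1\le i\le n$, $\psi_i(p)=\beta_p(f)p^{-k-n+i}$ for $n+1\le i\le2n$. Put $$\Phi_p^*(Y)=(Y-\alpha_p(f)^n)^{-1}\prod_{r=1}^{2n}\prod_{1\le i_1<\dots<i_r\le2n}(Y-\psi_0(p)\psi_{i_1}(p)\cdots\psi_{i_r}(p)),$$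 a polynomial since $\psi_0(p)\psi_1(p)\cdots\psi_n(p)=\alpha_p(f)^n$, and $$\Psi_p^*(Y)=(Y-\alpha_p(f)^{n-1}p^{k+n-1})\prod_{i=1}^n(Y-\alpha_p(f)^{n-1}\beta_p(f)p^{2i-2}).$$ $U_{p,0}$ acts on Fourier expansions by $F|_{k+n}U_{p,0}=\sum_{T}A_{pT}(F)q^T$. Then $${\rm Lift}^{(2n)}(f)^*:=\frac{\Psi_p^*(\alpha_p(f)^n)}{\Phi_p^*(\alpha_p(f)^n)}\cdot{\rm Lift}^{(2n)}(f)|_{k+n}\Phi_p^*(U_{p,0}).$$ *)

(* Defs.v *)
From HB Require Import structures.
From mathcomp Require Import all_boot all_order all_algebra all_field.
From mathcomp Require Import all_classical all_reals all_analysis.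
From mathcomp Require Import finmap complex.
Set Implicit Arguments.
Unset Strict Implicit.
Unset Printing Implicit Defensive.
Import Order.TTheory GRing.Theory Num.Theory.
Import numFieldNormedType.Exports.
Local Open Scope classical_set_scope.
Local Open Scope complex_scope.
Local Open Scope ring_scope.

(* Packing R[i] as a numClosedFieldType makes the library infer the usual
   topology on it. *)
Definition Cx (R : realType) : numClosedFieldType := R[i].

(* exp (2 pi i z) *)
Definition expi {R : realType} (z : Cx R) : Cx R :=
  (expR (- (2 * pi * complex.Im z)))%:C
  * (cos (2 * pi * complex.Re z) +i* sin (2 * pi * complex.Re z)).

(* Q-bar inside C *)
Definition algebraic {R : realType} (x : Cx R) : Prop :=
  algebraicOver (ratr : rat -> Cx R) x.

(* An embedding of Q-bar into the algebraic closure of Q_l enters only through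
   the valuation that it induces on Q-bar, which extends the l-adic valuation
   of Q; every such extension arises in this way.  The value of [v] at 0 and
   outside Q-bar is irrelevant. *)
Definition ladic_valuation {R : realType} (l : nat) (v : Cx R -> rat) : Prop :=
  [/\ forall m : nat, (0 < m)%N -> v m%:R = (logn l m)%:R,
      forall x y, algebraic x -> algebraic y -> x != 0 -> y != 0 ->
        v (x * y) = v x + v y
    & forall x y, algebraic x -> algebraic y -> x != 0 -> y != 0 ->
        x + y != 0 -> Num.min (v x) (v y) <= v (x + y)].

Definition squarefree (m : nat) : bool :=
  (0 < m)%N && all (fun q => logn q m <= 1)%N (primes m).

Definition moebius (m : nat) : int :=
  if squarefree m then (-1) ^+ size (primes m) else 0.

(* 1 is allowed *)
Definition fundamental_disc (d : int) : bool :=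
  ((d %% 4)%Z == 1) && squarefree `|d|%N
  || [&& (4 %| d)%Z, ((d %/ 4)%Z %% 4)%Z \in [:: 2; 3]
       & squarefree `|(d %/ 4)%Z|%N].

Definition kronecker_prime (d : int) (l : nat) : int :=
  if l == 2%N then
    if (2 %| d)%Z then 0 else if (d %% 8)%Z \in [:: 1; 7] then 1 else -1
  else if (l %| d)%Z then 0
  else if [exists x : 'I_l, (x%:Z ^+ 2 == d %[mod l])%Z] then 1 else -1.

(* the Kronecker symbol (d / m) for m >= 1 *)
Definition kronecker (d : int) (m : nat) : int :=
  \prod_(l <- primes m) kronecker_prime d l ^+ logn l m.

Definition upper {R : realType} (z : Cx R) : Prop := 0 < complex.Im z.

Definition SL2Z (g : 'M[int]_2) : Prop := \det g = 1.

Definition Gamma0_4 (g : 'M[int]_2) : Prop := SL2Z g /\ (4 %| (g 1 0)%R)%Z.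

Definition autfac {R : realType} (g : 'M[int]_2) (z : Cx R) : Cx R :=
  (g 1 0)%:~R * z + (g 1 1)%:~R.

Definition mobius {R : realType} (g : 'M[int]_2) (z : Cx R) : Cx R :=
  ((g 0 0)%:~R * z + (g 0 1)%:~R) / autfac g z.

Definition holomorphic_upper {R : realType} (f : Cx R -> Cx R) : Prop :=
  forall z, upper z -> derivable f z 1.

(* f(z) = sum_(m >= 0) a_m q^m on the upper half plane *)
Definition qexpansion {R : realType} (f : Cx R -> Cx R) (a : nat -> Cx R) :
    Prop :=
  forall z, upper z -> series (fun m => a m * expi (m%:R * z)) @ \oo --> f z.

(* f = sum a_m q^m lies in S_w(SL_2(Z)) *)
Definition cusp_form_SL2 {R : realType} (w : nat) (f : Cx R -> Cx R)
    (a : nat -> Cx R) : Prop :=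
  [/\ holomorphic_upper f,
      forall g z, SL2Z g -> upper z -> f (mobius g z) = autfac g z ^+ w * f z,
      qexpansion f a
    & a 0%N = 0].

(* f | T_m = m^(w-1) sum_(d | m) d^(-w) sum_(0 <= b < d) f(((m/d) z + b) / d) *)
Definition hecke_op {R : realType} (w m : nat) (f : Cx R -> Cx R) (z : Cx R) :
    Cx R :=
  m%:R ^+ w.-1 * \sum_(d <- divisors m)
    d%:R ^- w * \sum_(b < d) f (((m %/ d)%:R * z + b%:R) / d%:R).

Definition normalized_eigenform {R : realType} (w : nat) (f : Cx R -> Cx R)
    (a : nat -> Cx R) : Prop :=
  [/\ cusp_form_SL2 w f a, a 1%N = 1
    & forall m, (0 < m)%N -> exists lam : Cx R,
        forall z, upper z -> hecke_op w m f z = lam * f z].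

(* For every prime l, (alpha l, beta l) is the ordered pair of roots of
   X^2 - a_l X + l^(w-1).  The roots lie in Q-bar, the domain of v_l. *)
Definition hecke_roots {R : realType} (v : nat -> Cx R -> rat) (w : nat)
    (a alpha beta : nat -> Cx R) : Prop :=
  forall l, prime l ->
  [/\ 'X^2 - (a l)%:P * 'X + (l%:R ^+ w.-1)%:P
        = ('X - (alpha l)%:P) * ('X - (beta l)%:P),
      algebraic (alpha l), algebraic (beta l)
    & v l (alpha l) <= v l (beta l)].

(* theta(z) = sum_(n in Z) q^(n^2) *)
Definition theta {R : realType} (z : Cx R) : Cx R :=
  lim (series (fun m : nat =>
    (if m == 0%N then 1 else 2) * expi ((m ^ 2)%:R * z)) @ \oo).

(* k + 1/2 is the weight: the automorphy factor is j(g, z)^(2k+1) with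
   j(g, z) = theta(g z) / theta(z).  Vanishing at the cusp g(oo) is the
   vanishing of the limit at i oo of (c z + d)^(-k-1/2) h(g z), written with
   squared absolute values to avoid choosing a square root. *)
Definition cusp_form_half {R : realType} (k : nat) (h : Cx R -> Cx R)
    (c : nat -> Cx R) : Prop :=
  [/\ holomorphic_upper h,
      forall g z, Gamma0_4 g -> upper z ->
        h (mobius g z) = (theta (mobius g z) / theta z) ^+ (2 * k + 1) * h z,
      forall g, SL2Z g -> forall e : R, 0 < e -> exists Y : R, forall z : Cx R,
        upper z -> Y < complex.Im z ->
        `|h (mobius g z)| ^+ 2 <= e%:C * `|autfac g z| ^+ (2 * k + 1)
    & qexpansion h c].

(* (-1)^k m = 0, 1 mod 4 *)
Definition plus_index (k m : nat) : bool :=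
  (((-1) ^+ k * m%:Z) %% 4)%Z \in [:: 0; 1].

Definition kohnen_plus {R : realType} (k : nat) (h : Cx R -> Cx R)
    (c : nat -> Cx R) : Prop :=
  cusp_form_half k h c /\ forall m, ~~ plus_index k m -> c m = 0.

(* Kohnen's operator T(l^2) on the coefficients of a form in the plus space;
   for l = 2 the formula only describes the coefficients in the plus
   congruence classes. *)
Definition kohnen_hecke {R : realType} (k l : nat) (c : nat -> Cx R) (m : nat) :
    Cx R :=
  c (l ^ 2 * m)%N
  + (kronecker ((-1) ^+ k * m%:Z) l)%:~R * l%:R ^+ k.-1 * c m
  + (if (l ^ 2 %| m)%N then l%:R ^+ (2 * k - 1) * c (m %/ l ^ 2)%N else 0).

Definition kohnen_eigenform {R : realType} (k : nat) (h : Cx R -> Cx R)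
    (c : nat -> Cx R) : Prop :=
  [/\ kohnen_plus k h c, exists2 z, upper z & h z != 0
    & forall l, prime l -> exists lam : Cx R,
        forall m, plus_index k m -> kohnen_hecke k l c m = lam * c m].

(* h = sum c_m q^m corresponds to f = sum a_m q^m *)
Definition shimura_corr {R : realType} (k : nat) (a c : nat -> Cx R) : Prop :=
  forall (d : int) (m : nat),
    fundamental_disc d -> 0 < (-1) ^+ k * d -> (0 < m)%N ->
    c (`|d| * m ^ 2)%N =
      c `|d|%N * \sum_(e <- divisors m)
        (moebius e * kronecker d e)%:~R * e%:R ^+ k.-1 * a (m %/ e)%N.

(* Sym_N^*(Z) *)
Definition half_integral (N : nat) (T : 'M[rat]_N) : bool :=
  [&& T^T == T, [forall i, T i i \is a Num.int]
    & [forall i, forall j, 2 * T i j \is a Num.int]].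

Definition posdef (N : nat) (T : 'M[rat]_N) : Prop :=
  T^T = T /\ forall x : 'cV[rat]_N, x != 0 -> 0 < (x^T *m T *m x) 0 0.

(* (-1)^n det(2T), an integer for half-integral T *)
Definition discT (n : nat) (T : 'M[rat]_(2 * n)) : int :=
  numq ((-1) ^+ n * \det (2 *: T)).

(* the f >= 1 such that D / f^2 is a fundamental discriminant *)
Definition conductor (D : int) : nat :=
  head 1%N [seq f <- iota 1 `|D|%N |
    ((f ^ 2)%N %| D)%Z && fundamental_disc (D %/ (f ^ 2)%N)%Z].

Definition condT (n : nat) (T : 'M[rat]_(2 * n)) : nat := conductor (discT T).

Definition fundT (n : nat) (T : 'M[rat]_(2 * n)) : int :=
  (discT T %/ (condT T ^ 2)%N)%Z.

Definition frac_mx (m N : nat) (A : 'M[rat]_(m, N)) : 'M[rat]_(m, N) :=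
  map_mx (fun x : rat => x - (Num.floor x)%:~R) A.

(* As Q_l = Z[1/l] + Z_l and Z is the intersection of Z[1/l] and Z_l, each class of
   Sym_N(Q_l) / Sym_N(Z_l) has exactly one representative in this set. *)
Definition sym_mod (N l : nat) : set 'M[rat]_N :=
  [set S | S^T = S /\ forall i j, (0 <= S i j < 1) /\
     exists e : nat, l%:R ^+ e * S i j \is a Num.int].

(* [Z^N + Z^N S : Z^N], counted by representatives in [0, 1)^N of the rows
   x S modulo Z^N.  For S over Z[1/l] this index is a power of l, hence it
   equals [Z_l^N + Z_l^N S : Z_l^N]. *)
Definition nu (N : nat) (S : 'M[rat]_N) : nat :=
  #|` fset_set [set frac_mx (map_mx intr x *m S) | x in [set: 'rV[int]_N]] |.

(* The coefficient of X^m in sum_S e_l(trace(T S)) X^(v_l(nu_S)); the index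
   set is finite. *)
Definition siegel_series (R : realType) (N l : nat) (T : 'M[rat]_N) (m : nat) :
    Cx R :=
  \sum_(S \in [set S | sym_mod l S /\ logn l (nu S) = m])
    expi (ratr (\tr (T *m S)) : Cx R).

(* P = F_l(T; X): the identity
     (1 - (d_T / l) l^n X) * (Siegel series)
       = (1 - X) prod_(i = 1)^n (1 - l^(2i) X^2) * P
   of formal power series, coefficient by coefficient. *)
Definition is_siegel_poly (R : realType) (n l : nat) (T : 'M[rat]_(2 * n))
    (P : {poly int}) : Prop :=
  forall m : nat,
  \sum_(i < m.+1)
     (1 - ((kronecker (fundT T) l)%:~R * l%:R ^+ n) *: 'X : {poly Cx R})`_i
     * siegel_series R l T (m - i)
  = ((1 - 'X) * (\prod_(1 <= i < n.+1) (1 - l%:R ^+ (2 * i) *: 'X^2))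
     * map_poly intr P : {poly Cx R})`_m.

(* Formal Fourier expansions sum_T A_T q^T over half-integral T of degree 2n;
   the value is 0 when T is not half-integral. *)
Definition fourier_exp (R : realType) (n : nat) := 'M[rat]_(2 * n) -> Cx R.

(* alpha_l^(v_l(f)) F_l(T; beta_l l^(-k-n)) *)
Definition local_factor {R : realType} (n k : nat) (alpha beta : nat -> Cx R)
    (F : nat -> 'M[rat]_(2 * n) -> {poly int}) (f : nat) (T : 'M[rat]_(2 * n))
    (l : nat) : Cx R :=
  alpha l ^+ logn l f
  * (map_poly intr (F l T) : {poly Cx R}).[beta l * l%:R ^- (k + n)].

(* the Duke-Imamoglu lift Lift^(2n)(f) *)
Definition di_lift {R : realType} (n k : nat) (c alpha beta : nat -> Cx R)
    (F : nat -> 'M[rat]_(2 * n) -> {poly int}) : fourier_exp R n :=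
  fun T => if half_integral T && `[< posdef T >] then
      c `|fundT T|%N
      * \prod_(l <- primes (condT T)) local_factor k alpha beta F (condT T) T l
    else 0.

(* U_(p,0) *)
Definition Up {R : realType} (n p : nat) (A : fourier_exp R n) :
    fourier_exp R n :=
  fun T => if half_integral T then A (p%:R *: T) else 0.

(* A | P(U) for a polynomial P and an operator U *)
Definition poly_action {R : realType} (n : nat) (P : {poly Cx R})
    (U : fourier_exp R n -> fourier_exp R n) (A : fourier_exp R n) :
    fourier_exp R n :=
  fun T => \sum_(i < size P) P`_i * iter i U A T.

(* the exponents may be negative: ^ is the power with exponent in int *)
Definition psi0 (R : realType) (n k p : nat) : Cx R :=
  p%:R ^ ((n * k)%:Z - ((n * (n + 1)) %/ 2)%:Z).

Definition psi {R : realType} (n k p : nat) (al be : Cx R) (i : nat) : Cx R :=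
  if (i <= n)%N then al * p%:R ^ (- k%:Z + i%:Z)
  else be * p%:R ^ (- k%:Z - n%:Z + i%:Z).

(* the division by X - al^n is exact; 'I_(2n) numbers 1, ..., 2n from 0 *)
Definition Phi {R : realType} (n k p : nat) (al be : Cx R) : {poly Cx R} :=
  (\prod_(1 <= r < (2 * n).+1) \prod_(I : {set 'I_(2 * n)} | #|I| == r)
      ('X - (psi0 R n k p * \prod_(i in I) psi n k p al be i.+1)%:P))
  %/ ('X - (al ^+ n)%:P).

Definition Psi {R : realType} (n k p : nat) (al be : Cx R) : {poly Cx R} :=
  ('X - (al ^+ (n - 1) * p%:R ^+ (k + n - 1))%:P)
  * \prod_(1 <= i < n.+1)
      ('X - (al ^+ (n - 1) * be * p%:R ^+ (2 * i - 2))%:P).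

Definition stabilized_lift {R : realType} (n k p : nat)
    (c alpha beta : nat -> Cx R)
    (F : nat -> 'M[rat]_(2 * n) -> {poly int}) : fourier_exp R n :=
  let al := alpha p in let be := beta p in
  fun T =>
    (Psi n k p al be).[al ^+ n] / (Phi n k p al be).[al ^+ n]
    * poly_action (Phi n k p al be) (Up p) (di_lift k c alpha beta F) T.

(* Main.v *)
(* The Siegel series b(T; X) at p is a sum over symmetric matrices A modulo
   q = p^M of a character e(tr TA) times X^v(A).  Replacing T by pT replaces the
   character of A by that of pA, and the number of A with given pA and v(A) - v(pA)
   depends only on the rank of pA; hence the series b(p^i T) satisfy a linear
   recurrence in i whose roots lam_1, ..., lam_2n are explicit monomials in X,
   up to a term that does not depend on T.  That term is the sum with trivial
   character, which is computed by induction on the size of the matrices.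

   At X = beta p^(-k-n), the 2n numbers alpha^n lam_j are roots of Phi, so that
   Phi(U) annihilates all but the alpha^n-part of i |-> A_(p^i T), and Psi
   evaluated at alpha^n is the denominator of the trivial-character sum.  The
   factors at l <> p do not change with i because p is a unit at l; the factor
   at p is 1 when p does not divide the conductor because the character sums
   with v(A) large vanish.

   Division by Phi(alpha^n) requires that alpha is not a root of unity.  The
   Hecke eigenvalue satisfies |a_p| <= p^(k-1) (p + 1), since the Hecke operator
   acts on the bounded function |f| y^k, which excludes |alpha| = 1 for k > 1;
   for k = 1 there is no cusp form, because f(i) = 0 in weight 2 contradicts the
   resulting bound on the coefficients. *)
Require Import Defs.
From HB Require Import structures.
From mathcomp Require Import all_boot all_order all_algebra all_field.
From mathcomp Require Import all_classical all_reals all_analysis.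
From mathcomp Require Import finmap complex.
From mathcomp Require Import zify ring lra.
Set Implicit Arguments.
Unset Strict Implicit.
Unset Printing Implicit Defensive.
Import Order.TTheory GRing.Theory Num.Theory.
Local Open Scope ring_scope.

(** The sums are taken over the finite ring Z/p^M and compared modulo powers of X. A matrix S with
    v(S) >= M need not be of the form pA, but such S are invisible modulo X^M; as M is arbitrary,
    the congruences become identities of polynomials. On weights that depend on the rank alone,
    passing from A to pA is a triangular operator. Removing its eigenvalues for the ranks 2n, ..., 1
    leaves only the matrix 0, where every character equals 1; this is why the remaining term ignores
    T. The eigenvalue of rank 0 is 1 and matches the root alpha^n that is divided out of Phi. The
    numerator of the trivial-character sum is the very product in the definition of F_p, so it
    cancels and only the denominator meets Psi.

    Ordinarity makes alpha^n a simple root: a second subset with that value would give alpha^d p^i =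
    p^j with d > 0, the valuation forces i = j, and alpha would be a root of unity. The value F_p =
    1 away from the conductor is needed because the recurrence starts at i = 0, where the product
    defining A_T may contain no factor at p. *)

Section FiniteAdditive.

Lemma card_additive_image (V W : finZmodType) (H : {set V}) (f : {additive V -> W}) :
  (forall x y, x \in H -> y \in H -> x - y \in H) ->
  #|H| = (#|f @: H| * #|[set x in H | f x == 0%R]|)%N.
Proof.
move=> subH.
have [->|/set0Pn[h0 Hh0]] := eqVneq H (finset.set0).
  by rewrite imset0 !cards0.
have H0 : 0 \in H by rewrite -(subrr h0) subH.
have addH x y : x \in H -> y \in H -> x + y \in H.
  by move=> Hx Hy; rewrite -[y]opprK subH // -sub0r subH.
rewrite -sum1_card (partition_big_imset f) /=.
rewrite -[in RHS]sum_nat_const; apply: eq_bigr => y /imsetP[x0 Hx0 ->].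
rewrite sum1dep_card -[RHS](card_imset _ (addrI x0)).
apply: eq_card => x; rewrite [LHS]inE; apply/idP/imsetP.
- case/andP=> Hx /eqP fx; exists (x - x0); last by rewrite addrC subrK.
  by rewrite inE subH //= raddfB fx subrr.
- case=> z; rewrite inE => /andP[Hz /eqP fz] ->.
  by rewrite addH //= raddfD fz addr0.
Qed.

End FiniteAdditive.

(** * Arithmetic of Z/p^M and of matrices over it *)

Section PrimePowerRing.
Variables (p M : nat) (p_pr : prime p) (M_gt0 : (0 < M)%N).
Local Notation q := (p ^ M)%N.
Local Notation Zq := 'Z_(p ^ M).

Let q_gt1 : (1 < q)%N.
Proof. by rewrite -(exp1n M) ltn_exp2r // prime_gt1. Qed.

Lemma Zq_natr_eq0 (x : nat) : (x%:R == 0 :> Zq) = (q %| x)%N.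
Proof. by rewrite -val_eqE /= val_Zp_nat // /dvdn. Qed.

Lemma Zq_pM : (p ^ M)%:R = 0 :> Zq.
Proof. by apply/eqP; rewrite Zq_natr_eq0. Qed.

Lemma card_Zq : #|{: Zq}| = q.
Proof. by rewrite card_ord Zp_cast. Qed.

Lemma Zq_torsion (i : nat) (x : Zq) : (i <= M)%N ->
  (p ^ i)%:R * x = 0 -> exists y : Zq, x = (p ^ (M - i))%:R * y.
Proof.
move=> leiM; rewrite -(natr_Zp x) -natrM => /eqP.
rewrite Zq_natr_eq0 -{1}(subnKC leiM) expnD dvdn_pmul2l ?expn_gt0 ?prime_gt0 //.
by case/dvdnP=> y ->; exists y%:R; rewrite -natrM mulnC.
Qed.

(** p^(M-1) generates the smallest nonzero ideal of Z/p^M, so it lies in the ideal of every nonzero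
    x. *)
Lemma Zq_dvd_socle (x : Zq) : x != 0 -> exists w, x * w = (p ^ M.-1)%:R.
Proof.
rewrite -{1}(natr_Zp x) Zq_natr_eq0 => ndv.
have x0 : (0 < x)%N by case: (posnP x) ndv => // ->; rewrite dvdn0.
set j := logn p x; have jM : (j < M)%N.
  by rewrite ltnNge; apply: contra ndv => ?; rewrite pfactor_dvdn.
have [m cm xE] := pfactor_coprime p_pr x0.
have um : (m%:R : Zq) \is a GRing.unit.
  by rewrite unitZpE // coprime_sym coprime_pexpr // coprime_sym.
exists ((m%:R)^-1 * (p ^ (M.-1 - j))%:R).
rewrite -(natr_Zp x) xE natrM mulrA [m%:R * _]mulrC mulrK // -natrM -expnD.
by rewrite subnKC // -ltnS prednK.
Qed.

Lemma Zq_unit_coprime (x : nat) : coprime p x -> (x%:R : Zq) \is a GRing.unit.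
Proof. by move=> cpx; rewrite unitZpE // coprime_pexpl. Qed.

Lemma card_Zq_torsion (i : nat) : (i <= M)%N ->
  #|[set x : Zq | (p ^ i)%:R * x == 0]| = (p ^ i)%N.
Proof.
move=> leiM.
have := @card_additive_image Zq Zq [set: Zq] ((p ^ i)%:R \*o idfun) (fun x y _ _ => finset.in_setT (x - y)).
rewrite finset.cardsT card_Zq.
set A := imset _ _; set B := [set x in _ | _].
have -> : B = [set x : Zq | (p ^ i)%:R * x == 0] by apply/setP=> x; rewrite !inE.
have -> : #|A| = (p ^ (M - i))%N.
  pose g (y : 'I_(p ^ (M - i))) : Zq := (p ^ i)%:R * y%:R.
  have injg : injective g.
    move=> y z; rewrite /g -!natrM => /(congr1 val); rewrite /= !val_Zp_nat //.
    have yq (t : 'I_(p ^ (M - i))) : (p ^ i * t < p ^ M)%N.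
      by rewrite -{2}(subnKC leiM) expnD ltn_pmul2l ?expn_gt0 ?prime_gt0.
    rewrite !modn_small // => /eqP; rewrite eqn_pmul2l ?expn_gt0 ?prime_gt0 //.
    by move/eqP/val_inj.
  rewrite -[RHS]card_ord -finset.cardsT -(card_imset _ injg); apply: eq_card => z.
  apply/imsetP/imsetP => -[x _ ->]; last by exists (x : nat)%:R.
  have h : (x %% p ^ (M - i) < p ^ (M - i))%N by rewrite ltn_mod expn_gt0 prime_gt0.
  exists (Ordinal h) => //; rewrite /g /= -{1}(natr_Zp x) -!natrM.
  apply/eqP; rewrite -subr_eq0 {1}(divn_eq x (p ^ (M - i))) mulnDr natrD.
  by rewrite addrK mulnCA -expnD subnKC // natrM Zq_pM mulr0.
rewrite -{1}(subnKC leiM) expnD mulnC => /eqP.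
by rewrite eqn_pmul2l ?expn_gt0 ?prime_gt0 // => /eqP.
Qed.

Lemma mx_torsion m n (i : nat) (A : 'M[Zq]_(m, n)) : (i <= M)%N ->
  (p ^ i)%:R *: A = 0 -> exists B, A = (p ^ (M - i))%:R *: B.
Proof.
move=> leiM A0.
have ex j k : exists y, A j k == (p ^ (M - i))%:R * y.
  have [|y ->] := @Zq_torsion i (A j k) leiM; last by exists y.
  by move/matrixP/(_ j k): A0; rewrite !mxE.
exists (\matrix_(j, k) xchoose (ex j k)); apply/matrixP=> j k; rewrite !mxE.
exact/eqP/(xchooseP (ex j k)).
Qed.

Lemma sym_mx_torsion n (i : nat) (A : 'M[Zq]_n) : (i <= M)%N -> A^T = A ->
  (p ^ i)%:R *: A = 0 -> exists2 B, B^T = B & A = (p ^ (M - i))%:R *: B.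
Proof.
move=> leiM symA A0.
(* The quotient is chosen as a function of the entry alone, so equal entries get equal quotients and
   symmetry survives. *)
have ex (x : Zq) : exists y, ((p ^ i)%:R * x == 0) ==> (x == (p ^ (M - i))%:R * y).
  case: eqP => [/(Zq_torsion leiM)[y ->]|_]; last by exists 0.
  by exists y; rewrite eqxx.
exists (map_mx (fun x => xchoose (ex x)) A); first by rewrite map_trmx symA.
apply/matrixP=> j k; rewrite !mxE.
have /implyP := xchooseP (ex (A j k)); have /matrixP/(_ j k) := A0.
by rewrite !mxE => /eqP h /(_ h) /eqP.
Qed.

(** pC is nilpotent because p^M = 0; the inverse is a finite geometric series. *)
Lemma unitmx_1Dp n (C : 'M[Zq]_n) : 1%:M + p%:R *: C \in unitmx.
Proof.
pose X := - (p%:R *: C).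
have XM : X ^+ M = 0.
  have -> : X = (- p%:R)%:M * C by rewrite /X -mulmxE mul_scalar_mx scaleNr.
  rewrite exprMn_comm; last by rewrite /GRing.comm -!mulmxE -scalar_mxC.
  by rewrite -rmorphXn /= exprNn -natrX Zq_pM mulr0 rmorph0 mul0r.
have : (1 - X) * (\sum_(i < M) X ^+ i) = 1.
  by rewrite -opprB mulNr -subrX1 XM sub0r opprK.
by rewrite opprK => /mulmx1_unit[].
Qed.

End PrimePowerRing.

(** * Cardinalities of row modules over Z/p^M *)

Section ImageCard.
Variables (p M : nat) (p_pr : prime p) (M_gt0 : (0 < M)%N).
Local Notation q := (p ^ M)%N.
Local Notation Zq := 'Z_(p ^ M).

Definition rowim m n (A : 'M[Zq]_(m, n)) : {set 'rV[Zq]_n} := [set x *m A | x : 'rV_m].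
Definition im_card m n (A : 'M[Zq]_(m, n)) : nat := #|rowim A|.
(* For A / q with A symmetric this is v_p(nu). *)
Definition vz m n (A : 'M[Zq]_(m, n)) : nat := logn p (im_card A).

Lemma mem_rowim m n (A : 'M[Zq]_(m, n)) x : x *m A \in rowim A.
Proof. exact: imset_f. Qed.

Lemma rowimB m n (A : 'M[Zq]_(m, n)) x y :
  x \in rowim A -> y \in rowim A -> x - y \in rowim A.
Proof.
by move=> /imsetP[x' _ ->] /imsetP[y' _ ->]; rewrite -mulmxBl mem_rowim.
Qed.

Lemma im_card_ker m n (A : 'M[Zq]_(m, n)) :
  (q ^ m = im_card A * #|[set x : 'rV_m | x *m A == 0%R]|)%N.
Proof.
rewrite /im_card /rowim -[in LHS](card_Zq p_pr M_gt0) -[m in LHS]mul1n -card_mx -finset.cardsT.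
rewrite (@card_additive_image _ _ _ (mulmxr A)); last by move=> *; rewrite finset.in_setT.
congr (_ * _)%N; first by apply: eq_card => y; apply/imsetP/imsetP => -[x _ ->]; exists x.
by apply: eq_card => x; rewrite !inE.
Qed.

Lemma im_cardE m n (A : 'M[Zq]_(m, n)) : im_card A = (p ^ vz A)%N.
Proof.
have : (im_card A %| p ^ (M * m))%N by rewrite expnM (im_card_ker A) dvdn_mulr.
case/(dvdn_pfactor _ _ p_pr) => e _ E.
by rewrite /vz E pfactorK.
Qed.

Lemma im_card_gt0 m n (A : 'M[Zq]_(m, n)) : (0 < im_card A)%N.
Proof. by rewrite im_cardE expn_gt0 prime_gt0. Qed.

Lemma eq_vz m n m' n' (A : 'M[Zq]_(m, n)) (B : 'M[Zq]_(m', n')) :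
  im_card A = im_card B -> vz A = vz B.
Proof. by rewrite /vz => ->. Qed.

Lemma im_cardMl m n (P : 'M[Zq]_m) (A : 'M[Zq]_(m, n)) : P \in unitmx ->
  im_card (P *m A) = im_card A.
Proof.
move=> uP; apply: eq_card => y; apply/imsetP/imsetP => -[x _ ->].
  by exists (x *m P); rewrite // mulmxA.
by exists (x *m invmx P); rewrite // !mulmxA mulmxKV.
Qed.

Lemma im_cardMr m n (A : 'M[Zq]_(m, n)) (Q : 'M[Zq]_n) : Q \in unitmx ->
  im_card (A *m Q) = im_card A.
Proof.
move=> uQ; rewrite /im_card -[RHS](card_imset _ (can_inj (mulmxK uQ))).
apply: eq_card => y; apply/imsetP/imsetP => [[x _ ->]|[_ /imsetP[x _ ->] ->]].
  by exists (x *m A); rewrite ?mem_rowim ?mulmxA.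
by exists x; rewrite ?mulmxA.
Qed.

Lemma vzMl m n (P : 'M[Zq]_m) (A : 'M[Zq]_(m, n)) : P \in unitmx -> vz (P *m A) = vz A.
Proof. by move=> uP; rewrite /vz im_cardMl. Qed.

Lemma vzMr m n (A : 'M[Zq]_(m, n)) (Q : 'M[Zq]_n) : Q \in unitmx -> vz (A *m Q) = vz A.
Proof. by move=> uQ; rewrite /vz im_cardMr. Qed.

Lemma vz_congr n (P A : 'M[Zq]_n) : P \in unitmx -> vz (P *m A *m P^T) = vz A.
Proof. by move=> uP; rewrite vzMr ?unitmx_tr // vzMl. Qed.

(** Reduction of the Smith form over the integers; the divisibility chain is kept in the form that
    nonzero entries come first. *)
Lemma smith_Zq n (A : 'M[Zq]_n) : exists L R : 'M[Zq]_n, exists d : nat -> Zq,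
  [/\ L \in unitmx, R \in unitmx,
      A = L *m \matrix_(i, j) (d i *+ (i == j)) *m R
    & forall i j, (i <= j)%N -> d i = 0 -> d j = 0].
Proof.
pose lift (x : Zq) : int := Posz x.
have [L uL [R uR [d sd E]]] := int_Smith_normal_form (map_mx lift A).
pose h : int -> Zq := intr.
have um (X : 'M[int]_n) : X \in unitmx -> map_mx (intr : int -> Zq) X \in unitmx.
  by rewrite !unitmxE det_map_mx => /(rmorph_unit (intr : int -> Zq)).
exists (map_mx intr L), (map_mx intr R), (fun i => (d`_i)%:~R); split; try exact: um.
- have -> : A = map_mx intr (map_mx lift A).
    by apply/matrixP=> i j; rewrite !mxE /lift -pmulrn natr_Zp.
  rewrite E !map_mxM; congr (_ *m _ *m _).
  by apply/matrixP=> i j; rewrite !mxE rmorphMn.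
- move=> i j leij di0.
  have dv : (d`_i %| d`_j)%Z.
    have [ltj|gej] := ltnP j (size d); last by rewrite (nth_default _ gej) dvdz0.
    rewrite (sorted_leq_nth dvdz_trans dvdzz 0 sd) // inE //.
    exact: leq_ltn_trans leij ltj.
  by case/dvdzP: dv => z ->; rewrite rmorphM /= di0 mulr0.
Qed.

Lemma im_card_tr n (A : 'M[Zq]_n) : im_card A^T = im_card A.
Proof.
have [L [R [d [uL uR -> _]]]] := smith_Zq A.
set D := \matrix_(i, j) _.
have -> : (L *m D *m R)^T = R^T *m (D *m L^T).
  rewrite !trmx_mul; congr (_ *m (_ *m _)); apply/matrixP=> i j; rewrite !mxE eq_sym.
  by case: eqP => [->|].
by rewrite im_cardMl ?unitmx_tr // im_cardMr ?unitmx_tr // -mulmxA im_cardMl ?im_cardMr.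
Qed.

Lemma im_card_diag_block m1 m2 n1 n2 (A : 'M[Zq]_(m1, n1)) (B : 'M[Zq]_(m2, n2)) :
  im_card (block_mx A 0 0 B) = (im_card A * im_card B)%N.
Proof.
rewrite /im_card -cardsX.
have inj : injective (fun u : 'rV[Zq]_n1 * 'rV[Zq]_n2 => row_mx u.1 u.2).
  by move=> [a b] [c d] /= /eq_row_mx[-> ->].
rewrite -(card_imset _ inj); apply: eq_card => y; apply/imsetP/imsetP.
  case=> x _ ->; exists (lsubmx x *m A, rsubmx x *m B).
    by rewrite inE !mem_rowim.
  by rewrite -{1}(hsubmxK x) mul_row_block !mulmx0 addr0 add0r.
case=> -[a b]; rewrite inE => /andP[/imsetP[x _ ->] /imsetP[z _ ->]] ->.
by exists (row_mx x z); rewrite // mul_row_block !mulmx0 addr0 add0r.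
Qed.

Lemma vz_diag_block m1 m2 n1 n2 (A : 'M[Zq]_(m1, n1)) (B : 'M[Zq]_(m2, n2)) :
  vz (block_mx A 0 0 B) = (vz A + vz B)%N.
Proof. by rewrite /vz im_card_diag_block lognM ?im_card_gt0. Qed.

(** Schur complement. Off-diagonal blocks that are multiples of A take the place of the
    invertibility of A, and the two outer factors are unipotent. *)
Lemma vz_block m n (A : 'M[Zq]_m) (Y : 'M[Zq]_(m, n)) (X : 'M[Zq]_(n, m)) (C : 'M[Zq]_n) :
  vz (block_mx A (A *m Y) (X *m A) C) = (vz A + vz (C - X *m A *m Y))%N.
Proof.
rewrite -vz_diag_block.
have -> : block_mx A (A *m Y) (X *m A) C = block_mx 1%:M 0 X 1%:M *m
    block_mx A 0 0 (C - X *m A *m Y) *m block_mx 1%:M Y 0 1%:M.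
  rewrite !mulmx_block !mulmx0 !mul0mx !mul1mx !mulmx1 !addr0 !add0r.
  by rewrite addrCA subrr addr0.
by rewrite vzMr ?vzMl // unitmxE ?det_lblock ?det_ublock !det1 mulr1 unitr1.
Qed.

Lemma vz_blockr m n (A : 'M[Zq]_m) (Y : 'M[Zq]_(m, n)) (X : 'M[Zq]_(n, m)) (D : 'M[Zq]_n) :
  vz (block_mx A (Y *m D) (D *m X) D) = (vz (A - Y *m D *m X) + vz D)%N.
Proof.
rewrite -vz_diag_block.
have -> : block_mx A (Y *m D) (D *m X) D = block_mx 1%:M Y 0 1%:M *m
    block_mx (A - Y *m D *m X) 0 0 D *m block_mx 1%:M 0 X 1%:M.
  rewrite !mulmx_block !mulmx0 !mul0mx !mul1mx !mulmx1 !addr0 !add0r.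
  by rewrite subrK.
by rewrite vzMr ?vzMl // unitmxE ?det_lblock ?det_ublock !det1 mulr1 unitr1.
Qed.

Lemma vz0 m n : vz (0 : 'M[Zq]_(m, n)) = 0%N.
Proof.
suff E : im_card (0 : 'M[Zq]_(m, n)) = 1%N by rewrite /vz E logn1.
apply/eqP; rewrite /im_card; apply/cards1P; exists 0.
apply/setP=> y; rewrite inE; apply/imsetP/eqP => [[x _ ->]|->]; first by rewrite mulmx0.
by exists 0; rewrite ?mulmx0.
Qed.

(** Multiplication by p maps the row module of A onto that of pA; the kernel, the p-torsion, counts
    the nonzero elementary divisors. *)
Lemma im_card_torsion m n (A : 'M[Zq]_(m, n)) :
  im_card A = (im_card (p%:R *: A) * #|[set y in rowim A | p%:R *: y == 0%R]|)%N.
Proof.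
rewrite {1}/im_card (@card_additive_image _ _ _ ( *:%R p%:R)); last exact: rowimB.
congr (_ * _)%N; apply: eq_card => y; apply/imsetP/imsetP.
  by move=> [z /imsetP[x _ ->] ->]; exists x; rewrite // -scalemxAr.
by move=> [x _ ->]; exists (x *m A); rewrite ?mem_rowim -?scalemxAr.
Qed.

Lemma card_mx_torsion_pow i m n : (i <= M)%N ->
  #|[set A : 'M[Zq]_(m, n) | (p ^ i)%:R *: A == 0]| = (p ^ (i * (m * n)))%N.
Proof.
move=> iM; pose T := [set x : Zq | (p ^ i)%:R * x == 0].
have cT : #|T| = (p ^ i)%N by rewrite card_Zq_torsion.
pose f (A : 'M['I_#|T|]_(m, n)) : 'M[Zq]_(m, n) := map_mx (fun i => enum_val i) A.
have injf : injective f.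
  by move=> A B /matrixP E; apply/matrixP=> j k; move: (E j k); rewrite !mxE => /enum_val_inj.
transitivity (#|{: 'M['I_#|T|]_(m, n)}|); last by rewrite card_mx card_ord cT -expnM.
rewrite -finset.cardsT -(card_imset _ injf); apply: eq_card => A; rewrite [LHS]inE.
apply/eqP/imsetP => [/matrixP A0|[B _ ->]].
  have mT j k : A j k \in T by move: (A0 j k); rewrite !mxE inE => ->.
  exists (\matrix_(j, k) enum_rank_in (mT j k) (A j k)) => //.
  by apply/matrixP=> j k; rewrite !mxE enum_rankK_in.
apply/matrixP=> j k; rewrite !mxE.
by have := enum_valP (B j k); rewrite inE => /eqP.
Qed.

Lemma card_mx_torsion m n :
  #|[set A : 'M[Zq]_(m, n) | p%:R *: A == 0]| = (p ^ (m * n))%N.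
Proof. by rewrite -[(m * n)%N]mul1n -card_mx_torsion_pow. Qed.

Lemma sum_sym_block (V : nmodType) m n (F : 'M[Zq]_(m + n) -> V) :
  \sum_(A | A^T == A) F A =
  \sum_(A | A^T == A) \sum_B \sum_(C | C^T == C) F (block_mx A B B^T C).
Proof.
pose h (u : 'M[Zq]_m * ('M[Zq]_(m, n) * 'M[Zq]_n)) := block_mx u.1 u.2.1 u.2.1^T u.2.2.
pose h' (A : 'M[Zq]_(m + n)) := (ulsubmx A, (ursubmx A, drsubmx A)).
under [RHS]eq_bigr do rewrite pair_big.
rewrite pair_big (reindex_omap h (fun A => Some (h' A))) /=; last first.
  move=> A /eqP symA; rewrite /h /h' /=; congr Some.
  by rewrite trmx_ursub symA submxK.
apply: eq_bigl => -[A [B C]] /=.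
rewrite /h /h' /= block_mxKul block_mxKur block_mxKdr eqxx andbT.
rewrite tr_block_mx trmxK; apply/eqP/andP => [/eq_block_mx[-> _ _ ->]|[/eqP-> /eqP->]] //.
Qed.

End ImageCard.

(** * Symmetric matrices A with a prescribed multiple pA *)

Section SymmetricLifts.
Variables (p M : nat) (p_pr : prime p) (M_gt1 : (1 < M)%N).
Local Notation Zq := 'Z_(p ^ M).

Let M_gt0 : (0 < M)%N. Proof. exact: ltnW. Qed.
Let pM0 : (p ^ M)%:R = 0 :> Zq. Proof. exact: Zq_pM. Qed.

Lemma Zq_pow0 i : (M <= i)%N -> (p ^ i)%:R = 0 :> Zq.
Proof. by move=> leMi; rewrite -(subnKC leMi) expnD natrM pM0 mul0r. Qed.

(** The relation with Z says that no elementary divisor of S1 vanishes. Writing S = L D R,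
    congruence by the inverse of L gives D E with E invertible; its last rows vanish, hence by
    symmetry its last columns. No diagonalization by congruence is involved, so the prime 2 needs no
    special treatment. *)
Lemma sym_split N (S : 'M[Zq]_N) : S^T = S ->
  exists r s (e : (N = r + s)%N) (P : 'M[Zq]_(r + s)) (S1 Z : 'M[Zq]_r),
  [/\ P \in unitmx, P *m castmx (e, e) S *m P^T = block_mx S1 0 0 0
    & S1 *m Z = (p ^ M.-1)%:R%:M].
Proof.
move=> symS.
have [L [R [d [uL uR SE dchain]]]] := smith_Zq S.
have [r [rN dr0 rd]] : exists r, [/\ (r <= N)%N, forall i, (i < r)%N -> d i != 0
    & forall i, (r <= i < N)%N -> d i = 0].
  have [/hasP[i0]|/hasPn alln] := boolP (has (fun i => d i == 0) (iota 0 N)).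
    rewrite mem_iota /= => i0N di0.
    have ex : exists i, d i == 0 by exists i0.
    exists (ex_minn ex); case: ex_minnP => m /eqP dm min; split.
    - exact: leq_trans (min _ di0) (ltnW i0N).
    - by move=> i im; apply/negP => /min; rewrite leqNgt im.
    - by move=> i /andP[mi _]; exact: dchain mi dm.
  exists N; split=> // i; first by move=> iN; apply: alln; rewrite mem_iota.
  by case/andP=> a b; rewrite ltnNge a in b.
have e : N = (r + (N - r))%N by rewrite subnKC.
exists r, (N - r)%N, e.
move: (N - r)%N e => s e; subst N.
pose P := invmx L; have uP : P \in unitmx by rewrite unitmx_inv.
pose E := R *m P^T; have uE : E \in unitmx by rewrite unitmx_mul uR unitmx_tr.
pose d1 : 'rV[Zq]_r := \row_i d i.
have PSE : P *m S *m P^T = block_mx (diag_mx d1) 0 0 0 *m E.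
  rewrite SE !mulmxA (mulVmx uL) mul1mx; congr (_ *m _ *m _).
  rewrite -[LHS]submxK; congr block_mx; apply/matrixP=> i j; rewrite !mxE.
  - by [].
  - by rewrite -val_eqE /= ltn_eqF ?mulr0n // (leq_trans (ltn_ord i)) ?leq_addr.
  - by rewrite -val_eqE /= gtn_eqF ?mulr0n // (leq_trans (ltn_ord j)) ?leq_addr.
  - by rewrite rd ?mul0rn //= leq_addr ltn_add2l /=.
have ex (i : 'I_r) : exists w, d1 0 i * w == (p ^ M.-1)%:R.
  have [w /eqP] := Zq_dvd_socle p_pr M_gt0 (dr0 i (ltn_ord i)).
  by exists w; rewrite mxE.
pose w : 'rV[Zq]_r := \row_i xchoose (ex i).
have d1w : diag_mx d1 *m diag_mx w = (p ^ M.-1)%:R%:M.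
  rewrite mulmx_diag -diag_const_mx; congr diag_mx; apply/rowP=> i.
  by rewrite mxE [RHS]mxE -(eqP (xchooseP (ex i))) [w 0 i]mxE.
pose E11 := ulsubmx E; pose E12 := ursubmx E.
have PSB : P *m S *m P^T = block_mx (diag_mx d1 *m E11) (diag_mx d1 *m E12) 0 0.
  by rewrite PSE -{1}(submxK E) mulmx_block !mul0mx !addr0.
have symPS : (P *m S *m P^T)^T = P *m S *m P^T.
  by rewrite !trmx_mul trmxK symS mulmxA.
move: symPS; rewrite PSB tr_block_mx !trmx0 => /eq_block_mx[sym11 D12 _ _].
exists P, (diag_mx d1 *m E11).
(* The block d1 E12 vanishes and every entry of d1 divides p^(M-1), so E12 is divisible by p. Modulo
   p the invertible E is then block triangular, which makes E11 invertible. *)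
have [E12' E12E] : exists B, E12 = (p ^ (M - M.-1))%:R *: B.
  apply: (mx_torsion p_pr M_gt0 (leq_pred M)).
  by rewrite -mul_scalar_mx -d1w diag_mxC -mulmxA -D12 mulmx0.
have u11 : E11 \in unitmx.
  pose G := invmx E.
  have := mulmxV uE; rewrite -{1}(submxK E) -{1}(submxK (invmx E)) mulmx_block.
  rewrite -[1%:M]submxK => /eq_block_mx[h _ _ _]; move: h.
  rewrite -/E11 -/E12 E12E -subn1 subKn // expn1 -scalemxAl.
  have -> : ulsubmx (1%:M : 'M[Zq]_(r + s)) = 1%:M.
    by rewrite (@scalar_mx_block _ r s 1) block_mxKul.
  set X := E12' *m _ => h.
  have : E11 *m ulsubmx (invmx E) = 1%:M + p%:R *: (- X).
    by rewrite scalerN -h addrK.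
  have := unitmx_1Dp p_pr M_gt0 (- X); set U := 1%:M + _ => uU h2.
  have h3 : E11 *m (ulsubmx (invmx E) *m invmx U) = 1%:M by rewrite mulmxA h2 mulmxV.
  clearbody E11; clear -h3.
  move: (ulsubmx (invmx E) *m invmx U) h3 => Y h3.
  exact: (proj1 (mulmx1_unit h3)).
exists (diag_mx w *m invmx E11^T); split=> //.
  by rewrite castmx_id PSB -D12.
by rewrite -sym11 trmx_mul tr_diag_mx -mulmxA (mulmxA (diag_mx d1)) d1w
   mul_scalar_mx -scalemxAr mulmxV ?unitmx_tr // scalemx1.
Qed.

(** Cancelling p^k determines A Z modulo p^(M-k) only, so A Z is p^(M-1-k) times some 1 + pC; this
    unit is absorbed into Z. *)
Lemma lift_socle r k (A Z : 'M[Zq]_r) : (k < M)%N ->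
  ((p ^ k)%:R *: A) *m Z = (p ^ M.-1)%:R%:M ->
  exists Z', A *m Z' = (p ^ (M.-1 - k))%:R%:M.
Proof.
move=> kM h.
have kM1 : (k <= M.-1)%N by rewrite -ltnS prednK.
have [C CE] : exists C, A *m Z - (p ^ (M.-1 - k))%:R%:M = (p ^ (M - k))%:R *: C.
  apply: (mx_torsion p_pr M_gt0 (ltnW kM)).
  rewrite scalerBr scalemxAl h scale_scalar_mx -natrM -expnD subnKC //.
  by rewrite subrr.
have uU := unitmx_1Dp p_pr M_gt0 C.
exists (Z *m invmx (1%:M + p%:R *: C)); rewrite mulmxA.
have -> : A *m Z = (p ^ (M.-1 - k))%:R *: (1%:M + p%:R *: C).
  rewrite -[LHS](subrK (p ^ (M.-1 - k))%:R%:M) CE addrC scalerDr scalemx1 scalerA.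
  by rewrite -natrM -expnSr -subSn ?prednK.
by rewrite -scalemxAl mulmxV // scalemx1.
Qed.

(** Since A Z = p^j with j < M, the row module of A contains all p^r vectors killed by p. *)
Lemma vz_socle r j (A Z : 'M[Zq]_r) : A^T = A -> (j < M)%N ->
  A *m Z = (p ^ j)%:R%:M -> vz A = (vz (p%:R *: A) + r)%N.
Proof.
move=> symA jM AZ.
have jM1 : (j <= M.-1)%N by rewrite -ltnS prednK.
rewrite {1}/vz im_card_torsion.
suff -> : #|[set y in rowim A | p%:R *: y == 0%R]| = (p ^ (1 * r))%N.
  by rewrite (lognM _ (im_card_gt0 p_pr M_gt0 _)) ?expn_gt0 ?prime_gt0 // pfactorK // mul1n.
rewrite -(card_mx_torsion p_pr M_gt0); apply: eq_card => y; rewrite !inE andbC.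
case: eqP => //= y0.
have [|w ->] := @mx_torsion p M p_pr M_gt0 _ _ 1 y M_gt0; first by rewrite expn1.
apply/imsetP; exists ((p ^ (M.-1 - j))%:R *: (w *m Z^T)) => //.
rewrite -scalemxAl -mulmxA.
have -> : Z^T *m A = (p ^ j)%:R%:M by rewrite -{1}symA -trmx_mul AZ tr_scalar_mx.
by rewrite mul_mx_scalar scalerA -natrM -expnD subnK // subn1.
Qed.

(** An off-diagonal block divisible by p^(j+1) is A times p Z B, so the Schur complement applies,
    with a correction divisible by p^(j+2). *)
Lemma vz_socle_block r s j (A Z : 'M[Zq]_r) (B : 'M[Zq]_(r, s)) (C : 'M[Zq]_s) :
  A^T = A -> A *m Z = (p ^ j)%:R%:M ->
  vz (block_mx A ((p ^ j.+1)%:R *: B) ((p ^ j.+1)%:R *: B)^T C)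
  = (vz A + vz (C - (p ^ j.+2)%:R *: (B^T *m Z^T *m B)))%N.
Proof.
move=> symA AZ.
have E : (p ^ j.+1)%:R *: B = A *m (p%:R *: (Z *m B)).
  by rewrite -scalemxAr mulmxA AZ mul_scalar_mx scalerA -natrM -expnS.
have ET : ((p ^ j.+1)%:R *: B)^T = (p%:R *: (Z *m B))^T *m A.
  by rewrite E trmx_mul symA.
rewrite ET {1}E (vz_block p_pr M_gt0) -mulmxA -E; congr (_ + vz (_ - _))%N.
rewrite [(_ *: (Z *m B))^T]linearZ /= trmx_mul -scalemxAl -scalemxAr scalerA.
by rewrite -natrM -expnS.
Qed.

Definition tors_sum (V : nmodType) s (g : nat -> V) : V :=
  \sum_(C : 'M[Zq]_s | (C^T == C) && (p%:R *: C == 0)) g (vz C).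

Lemma card_sym_torsion r :
  #|[set C : 'M[Zq]_r | (C^T == C) && (p%:R *: C == 0)]| = (p ^ 'C(r.+1, 2))%N.
Proof.
elim: r => [|r IH].
  apply/eqP/cards1P; exists 0; apply/setP=> C; rewrite !inE.
  by rewrite [C]flatmx0 trmx0 scaler0 !eqxx.
pose T1 := [set A : 'M[Zq]_1 | p%:R *: A == 0].
pose T2 := [set A : 'M[Zq]_(1, r) | p%:R *: A == 0].
pose h (u : 'M[Zq]_1 * ('M[Zq]_(1, r) * 'M[Zq]_r)) := block_mx u.1 u.2.1 u.2.1^T u.2.2.
have injh : injective h.
  by move=> [A [B C]] [A' [B' C']] /eq_block_mx /= [-> -> _ ->].
have -> : 'C(r.+2, 2) = (1 + r + 'C(r.+1, 2))%N by rewrite binS bin1 addnC.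
have -> : (p ^ (1 + r + 'C(r.+1, 2)) = p ^ (1 * 1) * p ^ (1 * r) * p ^ 'C(r.+1, 2))%N.
  by rewrite muln1 mul1n -!expnD.
rewrite -IH.
rewrite -(card_mx_torsion p_pr M_gt0 1 r) -(card_mx_torsion p_pr M_gt0 1 1).
rewrite -/T1 -/T2 -mulnA -!cardsX -(card_imset _ injh); apply: eq_card => C.
rewrite [LHS]inE; apply/andP/imsetP.
  case=> /eqP symC /eqP pC.
  exists (@ulsubmx _ 1 r 1 r C, (@ursubmx _ 1 r 1 r C, @drsubmx _ 1 r 1 r C)).
    rewrite !inE /= (@trmx_drsub _ 1 r 1 r) symC eqxx /=.
    have pCE i j : p%:R * C i j = 0 by move/matrixP: pC => /(_ i j); rewrite !mxE.
    by apply/and3P; split; apply/eqP/matrixP=> i j; rewrite !mxE pCE.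
  by rewrite /h /= (@trmx_ursub _ 1 r 1 r) symC (@submxK _ 1 r 1 r).
case=> -[A [B D]]; rewrite !inE /= => /andP[/eqP pA /andP[/eqP pB /andP[/eqP symD /eqP pD]]] ->.
have hT : (h (A, (B, D)) : 'M[Zq]_(1 + r))^T = h (A, (B, D)).
  rewrite /h /= tr_block_mx trmxK symD; congr block_mx.
  by apply/matrixP=> i j; rewrite !mxE !ord1.
have hp : p%:R *: (h (A, (B, D)) : 'M[Zq]_(1 + r)) = 0.
  by rewrite /h /= scale_block_mx pA pB pD -[_ *: B^T]linearZ /= pB trmx0 block_mx0.
by split; apply/eqP; [exact: hT|exact: hp].
Qed.

(** A lift of diag(S1, 0) has blocks with pA = S1, pB = 0 and pC = 0. Its v is v(S1) + r + v(C)
    whatever A and B are, and these can be chosen in p^(r(r+1)/2) and p^(rs) ways. *)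
Lemma sum_lifts_block (V : nmodType) r s (S1 S0 Z : 'M[Zq]_r) (g : nat -> V) :
  S0^T = S0 -> p%:R *: S0 = S1 -> S1 *m Z = (p ^ M.-1)%:R%:M ->
  \sum_(A : 'M[Zq]_(r + s) | (A^T == A) && (p%:R *: A == block_mx S1 0 0 0)) g (vz A)
  = tors_sum s (fun v => g (vz S1 + r + v)%N) *+ (p ^ ('C(r.+1, 2) + r * s)).
Proof.
move=> symS0 pS0 S1Z.
have cA : #|[set A : 'M[Zq]_r | (A^T == A) && (p%:R *: A == S1)]| = (p ^ 'C(r.+1, 2))%N.
  rewrite -card_sym_torsion -[RHS](card_imset _ (addrI S0)); apply: eq_card => A.
  rewrite [LHS]inE; apply/andP/imsetP.
    case=> /eqP symA /eqP pA; exists (A - S0); last by rewrite addrC subrK.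
    by rewrite inE linearB /= symA symS0 scalerBr pA pS0 subrr !eqxx.
  case=> C; rewrite inE => /andP[/eqP symC /eqP pC] ->.
  by rewrite linearD /= symS0 symC scalerDr pC pS0 addr0 !eqxx.
rewrite big_mkcondr sum_sym_block.
transitivity (\sum_(A in [set A : 'M[Zq]_r | (A^T == A) && (p%:R *: A == S1)])
  \sum_(B in [set B : 'M[Zq]_(r, s) | p%:R *: B == 0])
   tors_sum s (fun v => g (vz S1 + r + v)%N)); last first.
  by rewrite !sumr_const cA (card_mx_torsion p_pr M_gt0) -mulrnA -expnD (addnC (r * s)%N).
rewrite [RHS](eq_bigl (fun A => (A^T == A) && (p%:R *: A == S1))); last first.
  by move=> A; rewrite inE.
rewrite [RHS]big_mkcondr; apply: eq_bigr => A /eqP symA.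
case: eqP => [pA|npA]; last first.
  rewrite big1 // => B _; rewrite big1 // => C _; rewrite scale_block_mx.
  by case: eqP => // /eq_block_mx[].
rewrite [RHS](eq_bigl (fun B => p%:R *: B == 0)); last by move=> B; rewrite inE.
rewrite [RHS]big_mkcond; apply: eq_bigr => B _.
case: eqP => [pB|npB]; last first.
  rewrite big1 // => C _; rewrite scale_block_mx.
  by case: eqP => // /eq_block_mx[].
rewrite /tors_sum big_mkcondr; apply: eq_bigr => C _.
rewrite scale_block_mx pA pB -[_ *: B^T]linearZ /= pB trmx0.
have -> : (block_mx S1 0 0 (p%:R *: C) == block_mx S1 0 0 0) = (p%:R *: C == 0).
  by apply/eqP/eqP => [/eq_block_mx[]//|->].
case: eqP => // pC.
have [|Z' AZ] := @lift_socle r 1 A Z M_gt1; first by rewrite expn1 pA.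
have [|B' BE] := @mx_torsion p M p_pr M_gt0 _ _ 1 B M_gt0; first by rewrite expn1.
(* Here j = M - 2, so the Schur correction carries p^M = 0. *)
have M1 : (M - 1 = (M.-1 - 1).+1)%N by rewrite -subSn ?prednK //; case: (M) M_gt1 => [|[]].
rewrite BE M1 (vz_socle_block _ _ symA AZ) (vz_socle symA _ AZ) ?pA; last first.
  by rewrite subn1; case: (M) M_gt1 => [|[]].
by rewrite Zq_pow0 ?scale0r ?subr0 // -M1 subn1 prednK.
Qed.

(* The number of nonzero elementary divisors of S. *)
Definition rk N (S : 'M[Zq]_N) : nat := (vz S - vz (p%:R *: S))%N.

Lemma split_rk r s (P : 'M[Zq]_(r + s)) (S : 'M[Zq]_(r + s)) (S1 Z : 'M[Zq]_r) :
  P \in unitmx -> P *m S *m P^T = block_mx S1 0 0 0 -> S^T = S ->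
  S1 *m Z = (p ^ M.-1)%:R%:M -> vz S = vz S1 /\ rk S = r.
Proof.
move=> uP PSE symS S1Z.
have vS : vz S = vz S1 by rewrite -(vz_congr S uP) PSE vz_diag_block // vz0 addn0.
have vpS : vz (p%:R *: S) = vz (p%:R *: S1).
  rewrite -(vz_congr _ uP) -scalemxAr -scalemxAl PSE scale_block_mx !scaler0.
  by rewrite vz_diag_block // vz0 addn0.
have symS1 : S1^T = S1.
  have : (P *m S *m P^T)^T = P *m S *m P^T by rewrite !trmx_mul trmxK symS mulmxA.
  by rewrite PSE tr_block_mx => /eq_block_mx[].
split=> //; rewrite /rk vS vpS (vz_socle symS1 _ S1Z) ?addKn //.
by rewrite prednK.
Qed.

(** The congruence from [sym_split] carries the lifts of S to those of the block form and keeps v. A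
    lift S0 is assumed because there may be none. *)
Lemma sum_lifts (V : nmodType) N (S S0 : 'M[Zq]_N) (g : nat -> V) :
  S0^T = S0 -> p%:R *: S0 = S ->
  \sum_(A : 'M[Zq]_N | (A^T == A) && (p%:R *: A == S)) g (vz A)
  = tors_sum (N - rk S) (fun v => g (vz S + rk S + v)%N)
    *+ (p ^ ('C((rk S).+1, 2) + rk S * (N - rk S))).
Proof.
move=> symS0 pS0.
have symS : S^T = S by rewrite -pS0 linearZ /= symS0.
have [r [s [e [P [S1 [Z [uP PSE S1Z]]]]]]] := sym_split symS.
subst N; rewrite castmx_id in PSE.
have [vS rS] := split_rk uP PSE symS S1Z.
rewrite rS vS addKn.
pose Q := invmx P; have uQ : Q \in unitmx by rewrite unitmx_inv.
have QTP : Q^T *m P^T = 1%:M by rewrite -trmx_mul mulmxV // trmx1.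
have PTQ : P^T *m Q^T = 1%:M by rewrite -trmx_mul mulVmx // trmx1.
have QK : cancel (fun A => Q *m A *m Q^T) (fun A => P *m A *m P^T).
  by move=> A; rewrite !mulmxA mulmxV // mul1mx -mulmxA QTP mulmx1.
have PK : cancel (fun A => P *m A *m P^T) (fun A => Q *m A *m Q^T).
  by move=> A; rewrite !mulmxA mulVmx // mul1mx -mulmxA PTQ mulmx1.
pose S0' := P *m S0 *m P^T.
have symS0' : S0'^T = S0' by rewrite !trmx_mul trmxK symS0 mulmxA.
rewrite -(@sum_lifts_block V r s S1 (ulsubmx S0') Z g) //; last 2 first.
- by rewrite trmx_ulsub symS0'.
- have -> : p%:R *: ulsubmx S0' = ulsubmx (p%:R *: S0').
    by apply/matrixP=> i j; rewrite !mxE.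
  by rewrite scalemxAl scalemxAr pS0 PSE block_mxKul.
rewrite (reindex (fun A => Q *m A *m Q^T)) /=; last first.
  by apply: onW_bij; exists (fun A => P *m A *m P^T).
apply: eq_big => [A|A _]; last by rewrite vz_congr.
have -> : ((Q *m A *m Q^T)^T == Q *m A *m Q^T) = (A^T == A).
  by rewrite !trmx_mul trmxK mulmxA (inj_eq (can_inj QK)).
have -> : (p%:R *: (Q *m A *m Q^T) == S)
    = (P *m (p%:R *: (Q *m A *m Q^T)) *m P^T == P *m S *m P^T).
  by rewrite (inj_eq (can_inj PK)).
by rewrite -scalemxAr -scalemxAl QK PSE.
Qed.

End SymmetricLifts.

(** * Polynomials in the shift operator acting on sequences *)

Section RecurrenceAction.
Variable A : comNzRingType.
Implicit Types (P Q : {poly A}) (u : nat -> A).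

(* P(E) u at 0, for the shift operator E. *)
Definition recact P u : A := \sum_(i < size P) P`_i * u i.

Lemma recactE n P u : (size P <= n)%N -> recact P u = \sum_(i < n) P`_i * u i.
Proof.
move=> leP; rewrite /recact (big_ord_widen n (fun i => P`_i * u i) leP) big_mkcond.
by apply: eq_bigr => i _; case: ltnP => // h; rewrite nth_default ?mul0r.
Qed.

Lemma recactD P Q u : recact (P + Q) u = recact P u + recact Q u.
Proof.
pose n := maxn (size P) (size Q).
rewrite (@recactE n (P + Q)) ?size_polyD // (@recactE n P) ?leq_maxl //.
rewrite (@recactE n Q) ?leq_maxr // -big_split; apply: eq_bigr => i _.
by rewrite coefD mulrDl.
Qed.

Lemma recactZ c P u : recact (c *: P) u = c * recact P u.
Proof.
rewrite (@recactE (size P)) ?size_scale_leq // /recact mulr_sumr.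
by apply: eq_bigr => i _; rewrite coefZ mulrA.
Qed.

Lemma recactC c u : recact c%:P u = c * u 0%N.
Proof.
by rewrite (@recactE 1) ?size_polyC ?leq_b1 // big_ord1 coefC eqxx.
Qed.

Lemma recact_mulX P u : recact (P * 'X) u = recact P (fun i => u i.+1).
Proof.
rewrite (@recactE (size P).+1); last first.
  have [->|P0] := eqVneq P 0; first by rewrite mul0r size_poly0.
  by rewrite size_mulX.
rewrite big_ord_recl coefMX eqxx mul0r add0r; apply: eq_bigr => i _.
by rewrite coefMX.
Qed.

Lemma eq_recact P u u' : u =1 u' -> recact P u = recact P u'.
Proof. by move=> E; apply: eq_bigr => i _; rewrite E. Qed.

Lemma recactM P Q u : recact (P * Q) u = recact P (fun i => recact Q (fun j => u (i + j)%N)).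
Proof.
elim/poly_ind: P u => [|P c IH] u.
  by rewrite mul0r /recact size_poly0 !big_ord0.
rewrite mulrDl !recactD recactC mul_polyC recactZ; congr (_ + _).
rewrite recact_mulX -mulrA ['X * Q]mulrC mulrA recact_mulX IH.
by apply: eq_recact => i; apply: eq_recact => j; rewrite addSn.
Qed.

Lemma recact_cst P c : recact P (fun=> c) = P.[1] * c.
Proof.
by rewrite /recact -mulr_suml horner_coef; congr (_ * _); apply: eq_bigr => i _;
  rewrite expr1n mulr1.
Qed.

Lemma recact_geom P c : recact P (fun i => c ^+ i) = P.[c].
Proof. by rewrite /recact horner_coef. Qed.

End RecurrenceAction.

(** * Congruence of polynomials modulo X^M *)

Section TruncatedEquality.
Variables (K : fieldType) (M : nat).
Implicit Types a b c d : {poly K}.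

Definition eqX a b := 'X^M %| (a - b).

Lemma eqX_refl a : eqX a a. Proof. by rewrite /eqX subrr dvdp0. Qed.

Lemma eqX_eq a b : a = b -> eqX a b. Proof. by move=> ->; apply: eqX_refl. Qed.

Lemma eqX_sym a b : eqX a b -> eqX b a.
Proof. by rewrite /eqX -opprB dvdpNr. Qed.

Lemma eqX_trans b a c : eqX a b -> eqX b c -> eqX a c.
Proof. by move=> h1 h2; rewrite /eqX -(subrKA b); apply: dvdp_add. Qed.

Lemma eqXD a b c d : eqX a b -> eqX c d -> eqX (a + c) (b + d).
Proof. by move=> h1 h2; rewrite /eqX opprD addrACA; apply: dvdp_add. Qed.

Lemma eqXN a b : eqX a b -> eqX (- a) (- b).
Proof. by rewrite /eqX -opprD dvdpNr. Qed.

Lemma eqXMl c a b : eqX a b -> eqX (c * a) (c * b).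
Proof. by move=> h; rewrite /eqX -mulrBr dvdp_mull. Qed.

Lemma eqXM a b c d : eqX a b -> eqX c d -> eqX (a * c) (b * d).
Proof.
move=> h1 h2; apply: (@eqX_trans (a * d)); first exact: eqXMl.
by rewrite ![_ * d]mulrC; apply: eqXMl.
Qed.

Lemma eqX_sum (I : Type) (r : seq I) (P : pred I) (F G : I -> {poly K}) :
  (forall i, P i -> eqX (F i) (G i)) ->
  eqX (\sum_(i <- r | P i) F i) (\sum_(i <- r | P i) G i).
Proof.
move=> h; apply: (big_ind2 eqX); [exact: eqX_refl| |exact: h].
by move=> *; apply: eqXD.
Qed.

Lemma eqX0 a i : (M <= i)%N -> eqX ('X^i * a) 0.
Proof. by move=> Mi; rewrite /eqX subr0 dvdp_mulr // dvdp_exp2l. Qed.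

Lemma eqX_recact (P : {poly {poly K}}) u u' :
  (forall i, eqX (u i) (u' i)) -> eqX (recact P u) (recact P u').
Proof. by move=> h; apply: eqX_sum => i _; apply: eqXMl. Qed.

Lemma eqX_cancel c a b : c`_0 != 0 -> eqX (c * a) (c * b) -> eqX a b.
Proof.
move=> c0; rewrite /eqX -mulrBr Gauss_dvdpr // coprimep_expl // coprimep_sym.
by rewrite coprimepX /root horner_coef0.
Qed.

Lemma eqX_coef a b i : eqX a b -> (i < M)%N -> a`_i = b`_i.
Proof.
move=> /dvdpP[c E] iM; apply/eqP; rewrite -subr_eq0 -coefB E coefMXn.
by rewrite iM.
Qed.

Lemma coef_eqX a b : (forall i, (i < M)%N -> a`_i = b`_i) -> eqX a b.
Proof.
move=> h; rewrite /eqX; apply/dvdpP; exists (drop_poly M (a - b)).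
rewrite -[LHS](poly_take_drop M); apply/eqP; rewrite -subr_eq0 addrK; apply/eqP.
by apply/polyP=> i; rewrite coef_take_poly coef0; case: ltnP => // iM; rewrite coefB h ?subrr.
Qed.

End TruncatedEquality.

(** * Linear recurrence for sums over symmetric matrices *)

Section SymmetricSumRecurrence.
Variables (p M : nat) (p_pr : prime p) (M_gt1 : (1 < M)%N).
Local Notation Zq := 'Z_(p ^ M).
Let M_gt0 : (0 < M)%N. Proof. exact: ltnW. Qed.

Lemma rk_le N (S : 'M[Zq]_N) : S^T = S -> (rk S <= N)%N.
Proof.
move=> symS; have [r [s [e [P [S1 [Z [uP PSE S1Z]]]]]]] := sym_split p_pr M_gt1 symS.
subst N; rewrite castmx_id in PSE.
by have [_ ->] := split_rk p_pr M_gt1 uP PSE symS S1Z; rewrite leq_addr.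
Qed.

Lemma rk_eq0 N (S : 'M[Zq]_N) : S^T = S -> rk S = 0%N -> S = 0.
Proof.
move=> symS; have [r [s [e [P [S1 [Z [uP PSE S1Z]]]]]]] := sym_split p_pr M_gt1 symS.
subst N; rewrite castmx_id in PSE.
have [_ ->] := split_rk p_pr M_gt1 uP PSE symS S1Z => r0; subst r.
rewrite [S1]flatmx0 block_mx0 in PSE.
rewrite -[S](mulKmx uP) -[P *m S](mulmxK (_ : P^T \in unitmx)) ?unitmx_tr //.
by rewrite PSE mul0mx mulmx0.
Qed.

Lemma vz_eq0 N (S : 'M[Zq]_N) : S^T = S -> vz S = 0%N -> S = 0.
Proof. by move=> symS v0; apply: rk_eq0 => //; rewrite /rk v0. Qed.

Lemma sym_scale N (c : Zq) (S : 'M[Zq]_N) : S^T = S -> (c *: S)^T = c *: S.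
Proof. by move=> symS; rewrite linearZ /= symS. Qed.

Lemma vz_scalep N (S : 'M[Zq]_N) : S^T = S -> (vz (p%:R *: S) <= (vz S).-1)%N.
Proof.
move=> symS; have [r0|] := posnP (rk S).
  by rewrite (rk_eq0 symS r0) scaler0 !vz0.
by rewrite /rk subn_gt0 => h; rewrite -ltnS prednK // (leq_ltn_trans _ h).
Qed.

Lemma scale_pow_vz N (S : 'M[Zq]_N) : S^T = S -> (p ^ vz S)%:R *: S = 0.
Proof.
move=> symS; suff h i : (vz ((p ^ i)%:R *: S) <= vz S - i)%N.
  by apply: vz_eq0; rewrite ?sym_scale //; apply/eqP; have := h (vz S); rewrite subnn leqn0.
elim: i => [|i IH]; first by rewrite expn0 scale1r subn0.
rewrite expnS natrM -scalerA (leq_trans (vz_scalep _)) ?sym_scale //.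
by rewrite subnS -!subn1 leq_sub2r.
Qed.

(** Each multiplication by p lowers a nonzero v, so p^v(S) kills S and S is divisible by p^(M -
    v(S)). *)
Lemma vz_lt_divisible N (S : 'M[Zq]_N) i : S^T = S -> (vz S + i <= M)%N ->
  exists2 S0, S0^T = S0 & (p ^ i)%:R *: S0 = S.
Proof.
move=> symS h.
have [||S0 s0 ->] := @sym_mx_torsion p M p_pr M_gt0 _ (vz S) S _ symS.
- exact: leq_trans (leq_addr _ _) h.
- exact: scale_pow_vz.
exists ((p ^ (M - vz S - i))%:R *: S0); first exact: sym_scale.
by rewrite scalerA -natrM -expnD subnKC // leq_subRL // (leq_trans (leq_addr _ _) h).
Qed.

Variable K : fieldType.

(** Weights that are functions of the rank form a class that is stable under replacing e(A) by
    e(pA). *)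
Definition wsum N (e : 'M[Zq]_N -> K) (phi : nat -> {poly K}) : {poly K} :=
  \sum_(A : 'M[Zq]_N | A^T == A) e A *: ('X^(vz A) * phi (rk A)).

(* The sum over all A with p A = S depends only on the rank of S, so summing
   e(p A) amounts to applying this triangular operator to the weight phi; its
   diagonal entries are the lift_eigen N r. *)
Definition lift_op N (phi : nat -> {poly K}) (r : nat) : {poly K} :=
  tors_sum p M (N - r) (fun v => 'X^(r + v) * phi (r + v)%N)
    *+ (p ^ ('C(r.+1, 2) + r * (N - r))).

Lemma wsum_scalep N (e : 'M[Zq]_N -> K) phi :
  eqX M (wsum (fun A => e (p%:R *: A)) phi) (wsum e (lift_op N phi)).
Proof.
rewrite /wsum (partition_big (fun A => p%:R *: A) (fun S => S^T == S)) /=; last first.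
  by move=> A /eqP symA; rewrite sym_scale.
apply: eqX_sum => S /eqP symS.
rewrite (eq_bigr (fun A => e S *: ('X^(vz A) * phi (vz A - vz S)%N))); last first.
  by move=> A /andP[_ /eqP <-].
rewrite -scaler_sumr -!mul_polyC; apply: eqXMl.
have [vM|Mv] := ltnP (vz S) M.
  have [|S0 s0 pS0] := @vz_lt_divisible _ S 1 symS; first by rewrite addn1.
  rewrite expn1 in pS0; apply: eqX_eq.
  rewrite (sum_lifts p_pr M_gt1 (fun v => 'X^v * phi (v - vz S)%N) s0 pS0).
  rewrite /lift_op mulrnAr; congr (_ *+ _); rewrite /tors_sum mulr_sumr.
  apply: eq_bigr => C _; rewrite mulrA -exprD -addnA; congr (_ * phi _).
  by rewrite addKn.
(* A matrix S with v(S) >= M may have no lift, but then both sides are multiples of X^M. *)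
apply: (@eqX_trans _ _ 0); last exact/eqX_sym/eqX0.
apply: (big_ind (fun x => eqX M x 0)) => [|x y hx hy|A /andP[/eqP symA /eqP pA]].
- exact: eqX_refl.
- by rewrite -(addr0 0); apply: eqXD.
apply: eqX0.
by rewrite (leq_trans Mv) // -pA (leq_trans (vz_scalep symA)) // leq_pred.
Qed.

Definition lift_eigen N r : {poly K} := (p ^ ('C(r.+1, 2) + r * (N - r)))%:R *: 'X^r.

(** For pC = 0 the number v(C) is the rank of C. A nonzero C therefore evaluates phi at a rank in
    (r, N], where it vanishes, and only C = 0 contributes. *)
Lemma lift_op_eigen N phi r : (r <= N)%N ->
  (forall s, (r < s <= N)%N -> phi s = 0) ->
  lift_op N phi r = lift_eigen N r * phi r.
Proof.
move=> rN phi0; rewrite /lift_op /lift_eigen /tors_sum.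
rewrite (bigD1 (0 : 'M[Zq]_(N - r))) /=; last by rewrite trmx0 scaler0 !eqxx.
rewrite vz0 addn0 big1 ?addr0; first by rewrite -scalerAl scaler_nat.
move=> C /andP[/andP[/eqP symC /eqP pC] C0].
rewrite phi0 ?mulr0 //; apply/andP; split.
  rewrite -{1}(addn0 r) ltn_add2l lt0n; apply: contraNneq C0 => vC.
  by rewrite (vz_eq0 symC vC).
rewrite -leq_subRL //; have := rk_le symC.
by rewrite /rk pC vz0 subn0.
Qed.

(** Starting from the constant weight 1, the eigenvalues of rank N, N-1, ... are removed in turn;
    each step kills the highest rank still present. *)
Fixpoint lift_weights N j : nat -> {poly K} :=
  if j is i.+1 then
    fun r => lift_op N (lift_weights N i) r - lift_eigen N (N - i) * lift_weights N i r
  else fun=> 1.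

Lemma lift_weights_eq0 N j s : (j <= N)%N -> (N - j < s <= N)%N -> lift_weights N j s = 0.
Proof.
elim: j s => [|j IH] s jN /andP[h sN] /=; first by move: h; rewrite subn0 ltnNge sN.
have [<-|ne] := eqVneq (N - j)%N s.
  rewrite lift_op_eigen ?leq_subr ?subrr // => t /andP[t1 t2].
  by apply: IH; rewrite ?t1 // ltnW.
have js : (N - j < s)%N.
  by rewrite ltn_neqAle ne /= -(subnSK jN) .
rewrite lift_op_eigen // => [|t /andP[st tN]]; last first.
  by rewrite IH ?(ltnW jN) // tN (ltn_trans js).
by rewrite IH ?js ?(ltnW jN) // !mulr0 subr0.
Qed.

(** For j = N the ranks are N, ..., 1: the eigenvalue 1 of rank 0 is left out. *)
Definition lift_poly N j : {poly {poly K}} := \prod_(i < j) ('X - (lift_eigen N (N - i))%:P).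

Lemma wsumBl N (e : 'M[Zq]_N -> K) phi psi c :
  wsum e (fun r => phi r - c * psi r) = wsum e phi - c * wsum e psi.
Proof.
rewrite /wsum mulr_sumr -sumrB; apply: eq_bigr => A _.
by rewrite mulrBr scalerBr -scalerAr mulrCA.
Qed.

Lemma recact_lift_poly N j (e : 'M[Zq]_N -> K) : 
  eqX M (recact (lift_poly N j) (fun i => wsum (fun A => e ((p ^ i)%:R *: A)) (fun=> 1)))
    (wsum e (lift_weights N j)).
Proof.
elim: j e => [|j IH] e.
  rewrite /lift_poly big_ord0 -polyC1 recactC mul1r; apply: eqX_eq.
  by apply: eq_bigr => A _; rewrite expn0 scale1r.
rewrite /lift_poly big_ord_recr /= mulrBr recactD recact_mulX.
rewrite -mulrN -polyCN mulrC mul_polyC recactZ mulNr wsumBl.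
apply: eqXD; last by apply/eqXN/eqXMl/IH.
apply: (eqX_trans _ (wsum_scalep e (lift_weights N j))).
apply: (eqX_trans _ (IH (fun A => e (p%:R *: A)))).
apply/eqX_eq/eq_recact => i; apply: eq_bigr => A _.
by rewrite scalerA -natrM -expnS.
Qed.

Definition sym_zeta N : {poly K} := \sum_(A : 'M[Zq]_N | A^T == A) 'X^(vz A).

Lemma wsum1 N : wsum (fun _ : 'M[Zq]_N => 1 : K) (fun=> 1) = sym_zeta N.
Proof. by apply: eq_bigr => A _; rewrite scale1r mulr1. Qed.

Lemma wsum_lift_weightsN N (e : 'M[Zq]_N -> K) :
  wsum e (lift_weights N N) = e 0 *: lift_weights N N 0.
Proof.
rewrite /wsum (bigD1 0) /=; last by rewrite trmx0 eqxx.
have rk0 : rk (0 : 'M[Zq]_N) = 0%N by rewrite /rk vz0.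
rewrite vz0 rk0 mul1r big1 ?addr0 // => A /andP[/eqP symA A0].
rewrite lift_weights_eq0 ?mulr0 ?scaler0 // subnn rk_le // andbT lt0n.
by apply: contraNneq A0 => /(rk_eq0 symA)->.
Qed.

(** After N steps only A = 0 survives, with the same weight for every e having e(0) = 1. The choice
    e = 1, for which the sequence is constant, evaluates it. *)
Lemma sym_sum_recurrence N (e : 'M[Zq]_N -> K) : e 0 = 1 ->
  eqX M (recact (lift_poly N N) (fun i => wsum (fun A => e ((p ^ i)%:R *: A)) (fun=> 1)))
    ((lift_poly N N).[1] * sym_zeta N).
Proof.
move=> e0. refine (eqX_trans (recact_lift_poly N e) _).
rewrite wsum_lift_weightsN e0 -recact_cst -wsum1.
apply: eqX_sym; apply: (eqX_trans (recact_lift_poly N (fun=> 1))).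
by rewrite wsum_lift_weightsN; apply: eqX_refl.
Qed.

(** For e = 1 and weight 1, [wsum_scalep] becomes the equation zeta = 1 - X + pX zeta: rank 0
    contributes 1 + (p-1)X, and each matrix of rank 1 is multiplied by pX. *)
Lemma sym_zeta1 : eqX M ((1 - p%:R *: 'X) * sym_zeta 1) (1 - 'X).
Proof.
have := wsum_scalep (fun _ : 'M[Zq]_1 => 1 : K) (fun=> 1).
rewrite wsum1 => h.
have E : wsum (fun _ : 'M[Zq]_1 => 1 : K) (lift_op 1 (fun=> 1))
  = 1 - 'X + p%:R *: 'X * sym_zeta 1.
  have rk1 (A : 'M[Zq]_1) : A^T == A -> A != 0 -> rk A = 1%N.
    move=> /eqP symA A0; apply/eqP; rewrite eqn_leq rk_le //= lt0n.
    by apply: contraNneq A0 => /(rk_eq0 symA)->.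
  rewrite /wsum /sym_zeta (bigD1 0) /=; last by rewrite trmx0 eqxx.
  rewrite [in RHS](bigD1 0) /=; last by rewrite trmx0 eqxx.
  rewrite /rk !vz0 !scale1r mul1r expr0 mulrDr mulr1 addrA; congr (_ + _).
    rewrite /lift_op /tors_sum subn0 bin_small // mul0n addn0 expn0 mulr1n.
    rewrite (bigD1 0) /=; last by rewrite trmx0 scaler0 !eqxx.
    rewrite vz0 expr0 mulr1 (eq_bigr (fun=> 'X)) => [|C]; last first.
      case/andP=> /andP[symC /eqP pC] C0; have := rk1 _ symC C0.
      by rewrite /rk pC vz0 subn0 mulr1 => ->.
    have := card_sym_torsion p_pr M_gt1 1; rewrite -sum1dep_card.
    rewrite (bigD1 0) /=; last by rewrite trmx0 scaler0 !eqxx.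
    rewrite sum1_card sumr_const expn1 => /(congr1 (GRing.natmul ('X : {poly K}))).
    rewrite mulrnDr mulr1n => cE.
    rewrite -addrA; congr (_ + _); by rewrite scaler_nat -cE addKr.
  rewrite mulr_sumr; apply: eq_bigr => A /andP[symA A0].
  have -> : (vz A - vz (p%:R *: A))%N = 1%N by apply: rk1.
  rewrite lift_op_eigen //; last by move=> s; case: s => [|[]].
  by rewrite /lift_eigen scale1r mulr1 mulrC subnn muln0 addn0 expr1.
rewrite E in h; have := eqXD h (eqX_refl M (- (p%:R *: 'X * sym_zeta 1))).
by rewrite addrK -[X in X - _]mul1r -mulrBl.
Qed.

End SymmetricSumRecurrence.

(** * The trivial-character sum: recurrence in the size of the matrices *)

Section SymmetricZetaRecurrence.
Variables (p M : nat) (p_pr : prime p) (M_gt1 : (1 < M)%N).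
Local Notation Zq := 'Z_(p ^ M).
Let M_gt0 : (0 < M)%N. Proof. exact: ltnW. Qed.

Lemma unit_1Bp (x : Zq) : 1 - p%:R * x \is a GRing.unit.
Proof.
have := unitmx_1Dp p_pr M_gt0 (- x%:M : 'M[Zq]_1).
by rewrite unitmxE det_mx11 !mxE eqxx mulr1n mulrN.
Qed.

(** With L spanned by pw and U, the module spanned by w and U is the union of the cosets cw + L, 0
    <= c < p. They are disjoint: c - c' is a unit, so (c - c')w in L would put w in L. *)
Lemma vz_scale_row m n (w : 'rV[Zq]_n) (U : 'M[Zq]_(m, n)) :
  w \notin rowim (col_mx (p%:R *: w) U) ->
  vz (col_mx w U) = (vz (col_mx (p%:R *: w) U)).+1.
Proof.
set L := col_mx (p%:R *: w) U => wL.
suff E : im_card (col_mx w U) = (p * im_card L)%N.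
  by rewrite /vz E (lognM _ (prime_gt0 p_pr) (im_card_gt0 p_pr M_gt0 _)) logn_prime // eqxx.
pose h (u : 'I_p * 'rV[Zq]_n) := (u.1 : nat)%:R *: w + u.2.
transitivity (#|{: 'I_p}| * #|rowim L|)%N; last by rewrite card_ord.
rewrite -finset.cardsT -cardsX -(@card_in_imset _ _ h); last first.
  move=> [c y] [c' y']; rewrite !inE /= => yL y'L.
  wlog le : c c' y y' yL y'L / (c' <= c)%N.
    move=> W; case/orP: (leq_total c' c) => [|le] E; first exact: W.
    by apply/esym/W.
  rewrite /h /= => E.
  have E2 : (c - c')%:R *: w = y' - y.
    by rewrite natrB // scalerBl; apply/eqP; rewrite subr_eq addrAC eq_sym subr_eq E addrC.
  have [z|nz] := posnP (c - c').
    have cc : c = c' by apply/val_inj/eqP; rewrite eqn_leq le -subn_eq0 z.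
    by move: E; rewrite cc => /addrI ->.
  case/negP: wL; have u : ((c - c')%:R : Zq) \is a GRing.unit.
    apply: Zq_unit_coprime => //; rewrite prime_coprime // gtnNdvd //.
    exact: leq_ltn_trans (leq_subr _ _) (ltn_ord c).
  have /imsetP[x _ xE] : y' - y \in rowim L by apply: rowimB.
  have -> : w = (c - c')%:R^-1 *: (y' - y) by rewrite -E2 scalerA mulVr ?scale1r.
  by rewrite xE scalemxAl mem_rowim.
apply: eq_card => y; apply/imsetP/imsetP => [[x _ ->]|[[c z]]].
  rewrite -[x]hsubmxK mul_row_col.
  set a := lsubmx x; set b := rsubmx x.
  have aE : a *m w = a 0 0 *: w by rewrite [a]mx11_scalar mul_scalar_mx !mxE eqxx mulr1n.
  move: (a 0 0) aE => a0 aE.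
  have cp : (a0 %% p < p)%N by rewrite ltn_mod prime_gt0.
  exists (Ordinal cp, (a0 %/ p)%:R *: (p%:R *: w) + b *m U).
    rewrite !inE /=; apply/imsetP; exists (row_mx ((a0 %/ p)%:R)%:M b) => //.
    by rewrite mul_row_col mul_scalar_mx.
  rewrite /h /= addrA scalerA -scalerDl -natrM -natrD addnC -divn_eq natr_Zp.
  by rewrite aE.
rewrite !inE /= => /imsetP[x _ ->] ->; rewrite /h /=.
rewrite -[x]hsubmxK /L mul_row_col.
exists (row_mx (c%:R%:M + p%:R *: lsubmx x) (rsubmx x)) => //.
by rewrite mul_row_col mulmxDl mul_scalar_mx -addrA -scalemxAl scalemxAr.
Qed.

(** If the first row lay in the module after scaling, then (1 - pa)b would lie in the row module of
    A for some a, and 1 - pa is a unit. *)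
Lemma vz_block_scale_row N (d : 'M[Zq]_1) (b : 'rV[Zq]_N) e (A : 'M[Zq]_N) :
  b \notin rowim A ->
  vz (block_mx d b e A) = (vz (block_mx (p%:R *: d) (p%:R *: b) e A)).+1.
Proof.
move=> bA; rewrite !block_mxEv -scale_row_mx vz_scale_row //.
apply: contra bA => /imsetP[x _].
rewrite -[x]hsubmxK mul_row_col scale_row_mx !mul_mx_row add_row_mx.
case/eq_row_mx=> _; set a := lsubmx x; set c := rsubmx x => E.
have aE : a *m (p%:R *: b) = (p%:R * a 0 0) *: b.
  by rewrite [a]mx11_scalar mul_scalar_mx !mxE eqxx mulr1n scalerA mulrC.
have : (1 - p%:R * a 0 0) *: b = c *m A.
  by rewrite scalerBl scale1r {1}E aE addrC addKr.
move/(congr1 ( *:%R (1 - p%:R * a 0 0)^-1)); rewrite /= scalerA mulVr ?unit_1Bp // scale1r => ->.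
by rewrite scalemxAl mem_rowim.
Qed.

(** The row statement is applied once to the first row and once, through the transpose, to the first
    column; the corner is scaled by both. *)
Lemma vz_block_scale N (d : 'M[Zq]_1) (b : 'rV[Zq]_N) (A : 'M[Zq]_N) : A^T = A ->
  b \notin rowim A ->
  vz (block_mx d b b^T A)
  = (vz (block_mx ((p ^ 2)%:R *: d) (p%:R *: b) (p%:R *: b)^T A)).+2.
Proof.
move=> symA bA; rewrite (vz_block_scale_row _ _ bA); congr _.+1.
have dT (x : 'M[Zq]_1) : x^T = x by apply/matrixP=> i j; rewrite mxE !ord1.
rewrite (eq_vz (esym (im_card_tr _))) tr_block_mx trmxK symA dT.
rewrite (vz_block_scale_row _ _ bA); congr _.+1.
by rewrite scalerA -natrM mulnn.
Qed.

Variable K : fieldType.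

Lemma card_scale_fiber m n i (x0 : 'M[Zq]_(m, n)) : (i <= M)%N ->
  #|[set x : 'M[Zq]_(m, n) | (p ^ i)%:R *: x == (p ^ i)%:R *: x0]| = (p ^ (i * (m * n)))%N.
Proof.
move=> iM; rewrite -(card_mx_torsion_pow p_pr M_gt0 m n iM) -[RHS](card_imset _ (addrI x0)).
apply: eq_card => x; rewrite [LHS]inE; apply/eqP/imsetP.
  move=> E; exists (x - x0); last by rewrite addrC subrK.
  by rewrite inE scalerBr E subrr.
by case=> z; rewrite inE => /eqP z0 ->; rewrite scalerDr z0 addr0.
Qed.

Lemma sum_scale_pow m n i (G : 'M[Zq]_(m, n) -> {poly K}) k : (i <= M)%N ->
  (forall y, ~ (exists x, y = (p ^ i)%:R *: x) -> eqX k (G y) 0) ->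
  eqX k (\sum_x G ((p ^ i)%:R *: x)) ((\sum_y G y) *+ (p ^ (i * (m * n)))).
Proof.
move=> iM G0; rewrite (partition_big (fun x : 'M[Zq]_(m, n) => (p ^ i)%:R *: x) xpredT) //=.
rewrite -sumrMnl; apply: eqX_sum => y _.
rewrite (eq_bigr (fun=> G y)) => [|x /eqP-> //].
have [/existsP[x0 /eqP yE]|/existsPn h] := boolP [exists x : 'M[Zq]_(m, n), y == (p ^ i)%:R *: x].
  rewrite sumr_const -(card_scale_fiber x0 iM); apply: eqX_eq; congr (_ *+ _).
  by apply: eq_card => x; rewrite [RHS]inE -yE.
rewrite big1 => [|x /eqP xE]; last by have := h x; rewrite xE eqxx.
apply: eqX_sym; rewrite -mulr_natr -(mul0r (p ^ (i * (m * n)))%:R).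
apply: eqXM; last exact: eqX_refl.
by apply: G0 => -[x yE]; have := h x; rewrite yE eqxx.
Qed.

(* The (d, b, A) block matrices with b in the image of A reduce to diag(d', A);
   for the others, scaling b by p and d by p^2 lowers v by 2, which expresses
   the second part of the sum through the whole sum. *)
Lemma sym_zeta_recurrence N :
  eqX M.-1 ((1 - (p ^ (N + 2))%:R *: 'X^2) * sym_zeta p M K (1 + N))
    ((1 - (p ^ 2)%:R *: 'X^2) * sym_zeta p M K 1 * (sym_zeta p M K N \Po (p%:R *: 'X))).
Proof.
pose B (d : 'M[Zq]_1) (b : 'rV[Zq]_N) A := block_mx d b b^T A : 'M[Zq]_(1 + N).
pose Wp := \sum_(A : 'M[Zq]_N | A^T == A) (p ^ vz A)%:R *: 'X^(vz A) : {poly K}.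
have WpE : sym_zeta p M K N \Po (p%:R *: 'X) = Wp.
  rewrite /sym_zeta /Wp raddf_sum /=; apply: eq_bigr => A _.
  by rewrite rmorphXn /= comp_polyX exprZn natrX.
pose sumin (G : 'M[Zq]_1 -> 'rV[Zq]_N -> 'M[Zq]_N -> {poly K}) :=
  \sum_(A | A^T == A) \sum_(b in rowim A) \sum_d G d b A.
pose sumout (G : 'M[Zq]_1 -> 'rV[Zq]_N -> 'M[Zq]_N -> {poly K}) :=
  \sum_(A | A^T == A) \sum_(b | b \notin rowim A) \sum_d G d b A.
pose G1 d b A : {poly K} := 'X^(vz (B d b A)).
pose G2 d b A : {poly K} := 'X^(vz (B ((p ^ 2)%:R *: d) (p%:R *: b) A)).
have symd (d : 'M[Zq]_1) : d^T = d by apply/matrixP=> i j; rewrite mxE !ord1.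
have W1E : sym_zeta p M K 1 = \sum_(d : 'M[Zq]_1) 'X^(vz d).
  by apply: eq_bigl => d; rewrite symd eqxx.
have split_sum G : \sum_(A : 'M[Zq]_N | A^T == A) \sum_b \sum_d G d b A = sumin G + sumout G.
  by rewrite -big_split; apply: eq_bigr => A _; rewrite (bigID (mem (rowim A))).
have WE : sym_zeta p M K (1 + N) = sumin G1 + sumout G1.
  rewrite -split_sum /sym_zeta sum_sym_block.
  rewrite (eq_bigl xpredT) => [|d]; last by rewrite symd eqxx.
  under eq_bigr do rewrite exchange_big /=.
  rewrite exchange_big /=; apply: eq_bigr => A _.
  by rewrite exchange_big.
have outE : sumout G1 = 'X^2 * sumout G2.
  rewrite /sumout mulr_sumr; apply: eq_bigr => A /eqP symA.
  rewrite mulr_sumr; apply: eq_bigr => b bA; rewrite mulr_sumr; apply: eq_bigr => d _.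
  by rewrite /G1 /B (vz_block_scale d symA bA) -exprD.
(* For b = yA the Schur complement replaces d by d - yAy^T, a mere translation. There are p^v(A)
   such b, which turns X^v(A) into (pX)^v(A). *)
have in1 : sumin G1 = sym_zeta p M K 1 * Wp.
  rewrite /sumin W1E mulr_sumr; apply: eq_bigr => A /eqP symA.
  rewrite (eq_bigr (fun=> (\sum_(d : 'M[Zq]_1) 'X^(vz d)) * 'X^(vz A))) => [|b /imsetP[y _ ->]].
    by rewrite sumr_const -/(im_card A) (im_cardE p_pr M_gt0) -scalerAr scaler_nat.
  rewrite mulr_suml (reindex_inj (addIr (y *m A *m y^T))); apply: eq_bigr => d _.
  rewrite /G1 /B trmx_mul symA (vz_blockr p_pr M_gt0) addrK.
  by rewrite exprD.
have in2 : sumin G2 = (\sum_(d : 'M[Zq]_1) 'X^(vz ((p ^ 2)%:R *: d))) * Wp.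
  rewrite /sumin mulr_sumr; apply: eq_bigr => A /eqP symA.
  rewrite (eq_bigr (fun=> (\sum_(d : 'M[Zq]_1) 'X^(vz ((p ^ 2)%:R *: d))) * 'X^(vz A)))
    => [|b /imsetP[y _ ->]].
    by rewrite sumr_const -/(im_card A) (im_cardE p_pr M_gt0) -scalerAr scaler_nat.
  rewrite mulr_suml (reindex_inj (addIr (y *m A *m y^T))); apply: eq_bigr => d _.
  rewrite /G2 /B.
  have -> : p%:R *: (y *m A) = (p%:R *: y) *m A by rewrite scalemxAl.
  rewrite trmx_mul symA (vz_blockr p_pr M_gt0).
  rewrite linearZ /= -!scalemxAl -scalemxAr scalerA -natrM mulnn scalerDr addrK.
  by rewrite exprD.
(* A symmetric matrix that is not divisible by p^s has v > M - s. With s <= 2 this gives v >= M - 1,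
   whence the truncation at M - 1. *)
have small k s (y : 'M[Zq]_k) : y^T = y -> (s <= 2)%N ->
    ~ (exists2 x, x^T = x & y = (p ^ s)%:R *: x) -> (M.-1 <= vz y)%N.
  move=> symy s2 h; rewrite leqNgt; apply/negP => lt; case: h.
  have [|x symx xE] := @vz_lt_divisible p M p_pr M_gt1 k y s symy; last by exists x.
  by have := prednK M_gt0; lia.
have d2 : eqX M.-1 (\sum_(d : 'M[Zq]_1) 'X^(vz ((p ^ 2)%:R *: d)))
    (sym_zeta p M K 1 *+ (p ^ 2)).
  rewrite W1E; apply: (@sum_scale_pow 1 1 2 (fun d => 'X^(vz d))) => // y h.
  rewrite -['X^_]mulr1; apply: eqX0; apply: (small 1 2) => //.
  by case=> x _ xE; apply: h; exists x.
(* Summing over p^2 d instead of d costs a factor p^2, and over pb instead of b a factor p^N. *)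
have all2 : eqX M.-1 (sumin G2 + sumout G2) (sym_zeta p M K (1 + N) *+ (p ^ (N + 2))).
  rewrite WE -!split_sum addnC expnD mulrnA -!sumrMnl.
  apply: eqX_sum => A /eqP symA.
  pose H d : {poly K} := \sum_(b : 'rV[Zq]_N) 'X^(vz (B d (p%:R *: b) A)).
  rewrite exchange_big /=.
  have e1 : eqX M.-1 (\sum_(d : 'M[Zq]_1) H ((p ^ 2)%:R *: d)) ((\sum_d H d) *+ (p ^ 2)).
    apply: (@sum_scale_pow 1 1 2) => // y h.
    apply: (big_ind (fun x => eqX M.-1 x 0)) => [|a b ha hb|b _].
    - exact: eqX_refl.
    - by rewrite -(addr0 0); apply: eqXD.
    rewrite -['X^_]mulr1; apply: eqX0; apply: (small _ 2) => //.
      by rewrite /B tr_block_mx trmxK symA symd.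
    case=> x _; rewrite /B -[x]submxK scale_block_mx => /eq_block_mx[xE _ _ _].
    by apply: h; exists (ulsubmx x).
  apply: (eqX_trans e1).
  rewrite mulrnAC -[_ *+ (p ^ 2)]mulr_natr -[X in eqX _ _ X]mulr_natr.
  apply: eqXM; last exact: eqX_refl.
  rewrite [X in eqX _ _ (X *+ _)]exchange_big -sumrMnl; apply: eqX_sum => d _.
  have := @sum_scale_pow 1 N 1 (fun b => 'X^(vz (block_mx d b b^T A))) M.-1 M_gt0.
  rewrite !mul1n expn1; apply => y h.
  rewrite -['X^_]mulr1; apply: eqX0; apply: (small _ 1) => //.
    by rewrite /B tr_block_mx trmxK symA symd.
  case=> x _; rewrite /B -[x]submxK scale_block_mx => /eq_block_mx[_ xE _ _].
  by apply: h; exists (ursubmx x); rewrite xE.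
rewrite WpE mulrBl mul1r.
rewrite mulrBl mulrBl mul1r.
have -> : sym_zeta p M K (1 + N) - (p ^ (N + 2))%:R *: 'X^2 * sym_zeta p M K (1 + N)
  = sumin G1 + 'X^2 * ((sumin G2 + sumout G2) - sym_zeta p M K (1 + N) *+ (p ^ (N + 2)))
    - 'X^2 * sumin G2.
  rewrite {1}WE outE -(scaler_nat _ (sym_zeta p M K (1 + N))) -scalerAl mulrBr mulrDr -scalerAr.
  move: (_ *: _) ('X^2 * sumin G2) ('X^2 * sumout G2) (sumin G1) => x y z w.
  by ring.
rewrite in1 in2.
apply: (@eqX_trans _ _ (sym_zeta p M K 1 * Wp + 'X^2 * 0
   - 'X^2 * ((sym_zeta p M K 1 *+ (p ^ 2)) * Wp))).
  apply: eqXD; last by apply/eqXN/eqXMl/eqXM; [exact: d2|exact: eqX_refl].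
  apply: eqXD; first exact: eqX_refl.
  apply: eqXMl; rewrite -in2 -[X in eqX _ _ X](subrr (sym_zeta p M K (1 + N) *+ (p ^ (N + 2)))).
  by apply: eqXD => //; apply: eqX_refl.
apply: eqX_eq; rewrite mulr0 addr0 -scaler_nat -!scalerAl -scalerAr mulrA.
by [].
Qed.

End SymmetricZetaRecurrence.

(** * The trivial-character sum in even size *)

Section SymmetricZetaEven.
Variables (K : fieldType).

Lemma eqX_comp_scale k (c : K) (a b : {poly K}) :
  eqX k a b -> eqX k (a \Po (c *: 'X)) (b \Po (c *: 'X)).
Proof.
rewrite /eqX -rmorphB => /(dvdp_comp_poly (c *: 'X)); apply: dvdp_trans.
by rewrite rmorphXn /= comp_polyX exprZn -mul_polyC dvdp_mull.
Qed.

Lemma eqX_chain k (a b c d e D N u1 u2 u3 u4 v1 v2 v3 : {poly K}) :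
  eqX k (u1 * a) (v1 * b * c) -> eqX k (u2 * b) v2 -> eqX k (u3 * c) (v3 * d * e) ->
  eqX k (u4 * d) u2 -> eqX k (e * D) N ->
  eqX k (u2 * u3 * u4 * (a * (u1 * D))) (v1 * v2 * v3 * u2 * N).
Proof.
move=> h1 h2 h3 h4 h5.
have -> : u2 * u3 * u4 * (a * (u1 * D)) = (u2 * u3 * u4 * D) * (u1 * a) by ring.
apply: (eqX_trans (eqXMl _ h1)).
have -> : (u2 * u3 * u4 * D) * (v1 * b * c) = (u3 * u4 * D * v1 * c) * (u2 * b) by ring.
apply: (eqX_trans (eqXMl _ h2)).
have -> : (u3 * u4 * D * v1 * c) * v2 = (u4 * D * v1 * v2) * (u3 * c) by ring.
apply: (eqX_trans (eqXMl _ h3)).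
have -> : (u4 * D * v1 * v2) * (v3 * d * e) = (D * v1 * v2 * v3 * e) * (u4 * d) by ring.
apply: (eqX_trans (eqXMl _ h4)).
have -> : (D * v1 * v2 * v3 * e) * u2 = (v1 * v2 * v3 * u2) * (e * D) by ring.
exact: eqXMl.
Qed.

(** The product in the definition of F_l, and also the numerator of the trivial-character sum in
    size 2n, whose denominator is [siegel_den]. *)
Definition siegel_num n (l : K) : {poly K} :=
  (1 - 'X) * \prod_(1 <= i < n.+1) (1 - l ^+ (2 * i) *: 'X^2).

Definition siegel_den n (l : K) : {poly K} :=
  (1 - l ^+ (2 * n) *: 'X) * \prod_(1 <= i < n.+1) (1 - l ^+ (2 * n + 2 * i - 1) *: 'X^2).

Lemma one_sub_scaleX_coef0 (c : K) j : (1 - c *: 'X^(j.+1) : {poly K})`_0 = 1.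
Proof. by rewrite coefB coefC coefZ coefXn eqxx mulr0 subr0. Qed.

Lemma one_sub_scaleX_comp (c d : K) j :
  (1 - c *: 'X^j) \Po (d *: 'X) = 1 - (c * d ^+ j) *: 'X^j.
Proof.
rewrite rmorphB rmorph1 /= comp_polyZ rmorphXn /= comp_polyX exprZn scalerA.
by [].
Qed.

Lemma one_sub_scale_comp (c d : K) : (1 - c *: 'X) \Po (d *: 'X) = 1 - (c * d) *: 'X.
Proof. by rewrite rmorphB rmorph1 /= comp_polyZ comp_polyX scalerA. Qed.

Lemma one_subX_comp (d : K) : (1 - 'X) \Po (d *: 'X) = 1 - d *: 'X.
Proof. by rewrite rmorphB rmorph1 /= comp_polyX. Qed.

Variables (p M : nat) (p_pr : prime p) (M_gt1 : (1 < M)%N).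

Lemma sym_zeta_even n :
  eqX M.-1 (sym_zeta p M K (2 * n) * siegel_den n p%:R) (siegel_num n p%:R).
Proof.
elim: n => [|n IH].
  rewrite /siegel_den /siegel_num !big_nil !muln0 expr0 scale1r !mulr1.
  rewrite /sym_zeta (big_pred1 0) => [|A]; last first.
    have -> : A = 0 by apply/matrixP=> -[].
    by rewrite trmx0 /= !eqxx.
  by rewrite vz0 mul1r; apply: eqX_refl.
have e2 : (2 * n.+1 = 1 + (1 + 2 * n))%N by rewrite mulnS addnA.
have R1 := sym_zeta_recurrence p_pr M_gt1 K (1 + 2 * n).
have R2 := eqX_comp_scale p%:R (sym_zeta_recurrence p_pr M_gt1 K (2 * n)).
have leM : forall a b : {poly K}, eqX M a b -> eqX M.-1 a b.
  by move=> a b; apply: dvdp_trans; rewrite dvdp_exp2l // leq_pred.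
have Z1 := leM _ _ (sym_zeta1 p_pr M_gt1 K).
have Z2 := eqX_comp_scale p%:R Z1.
have I2 := eqX_comp_scale (p%:R ^+ 2) IH.
rewrite !rmorphM /= in R2 Z2; rewrite rmorphM /= in I2.
rewrite !(one_sub_scale_comp, one_sub_scaleX_comp, one_subX_comp) !natrX in R1 R2 Z1 Z2.
have EE : (sym_zeta p M K (2 * n) \Po (p%:R *: 'X)) \Po (p%:R *: 'X)
    = sym_zeta p M K (2 * n) \Po (p%:R ^+ 2 *: 'X).
  by rewrite -comp_polyA comp_polyZ comp_polyX scalerA expr2.
rewrite EE in R2.
have := eqX_chain R1 Z1 R2 Z2 I2.
pose f i : {poly K} := 1 - p%:R ^+ (2 * i) *: 'X^2.
have numE : siegel_num n p%:R \Po (p%:R ^+ 2 *: 'X)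
    = (1 - p%:R ^+ 2 *: 'X) * \prod_(1 <= i < n.+1) f (i + 2)%N.
  rewrite /siegel_num rmorphM /= rmorph_prod /= one_subX_comp; congr (_ * _); apply: eq_bigr => i _.
  rewrite one_sub_scaleX_comp /f -exprM -exprD; congr (1 - _ ^+ _ *: _); lia.
have denE : siegel_den n.+1 p%:R = (1 - p%:R ^+ (1 + 2 * n + 2) *: 'X^2) *
   (siegel_den n p%:R \Po (p%:R ^+ 2 *: 'X)).
  rewrite /siegel_den rmorphM /= rmorph_prod /= one_sub_scale_comp.
  rewrite big_nat_recl // mulrCA; congr (_ * _); first by congr (1 - _ ^+ _ *: _); lia.
  rewrite -exprD; congr (_ * _).
    by congr (1 - _ ^+ _ *: _); lia.
  apply: eq_big_nat => i /andP[i1 _]; rewrite one_sub_scaleX_comp -exprM -exprD.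
  by congr (1 - _ ^+ _ *: _); lia.
rewrite numE -denE -e2.
(* The substitution of p^2 X shifts the indices of the factors by 2: the recurrences supply the
   factors 1 and 2 and remove the factor n + 2. *)
have num1E : (1 - p%:R ^+ 2 *: 'X^2) * (1 - p%:R ^+ 2 * p%:R ^+ 2 *: 'X^2)
    * \prod_(1 <= i < n.+1) f (i + 2)%N
  = (1 - p%:R ^+ (2 * n + 2) * p%:R ^+ 2 *: 'X^2) * \prod_(1 <= i < n.+2) f i.
  have -> : 1 - p%:R ^+ (2 * n + 2) * p%:R ^+ 2 *: 'X^2 = f n.+2.
    by rewrite /f -exprD; congr (1 - _ ^+ _ *: _); lia.
  rewrite [RHS]mulrC -(big_nat_recr n.+2 1 f) // [RHS]big_nat_recl // [X in _ = _ * X]big_nat_recl //.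
  rewrite /= [RHS]mulrA; congr (_ * _ * _); first by rewrite /f -exprD.
  by apply: eq_bigr => i _; rewrite addn2.
move=> H.
apply: (@eqX_cancel _ _ ((1 - p%:R *: 'X) * (1 - (p%:R ^+ (2 * n + 2) * p%:R ^+ 2) *: 'X^2)
   * (1 - (p%:R * p%:R) *: 'X))).
  have c1 (c : K) : (1 - c *: 'X : {poly K})`_0 = 1 by have := one_sub_scaleX_coef0 c 0.
  by rewrite !coef0M !c1 (one_sub_scaleX_coef0 _ 1) !mulr1 oner_neq0.
apply: (eqX_trans H); apply: eqX_eq.
rewrite /siegel_num -/f.
move: num1E; rewrite -[p%:R ^+ 2]/(p%:R * p%:R).
move: (\prod_(1 <= i < n.+1) _) (\prod_(1 <= i < n.+2) _) (1 - _ *: 'X^2) (1 - _ *: 'X^2)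
  (1 - _ *: 'X^2) (1 - _ *: 'X) (1 - _ *: 'X) => a b v1 v3 u3 u2 u4 E.
transitivity ((u3 * v3 * a) * ((1 - 'X) * u2 * u4)); first by ring.
by rewrite E; ring.
Qed.

End SymmetricZetaEven.

(** * Vanishing of character sums over matrices with large v *)

Section CharacterSums.
Variables (p M : nat) (p_pr : prime p) (M_gt1 : (1 < M)%N).
Local Notation Zq := 'Z_(p ^ M).
Let M_gt0 : (0 < M)%N. Proof. exact: ltnW. Qed.

Lemma mxtrace_mul_delta (A : comNzRingType) m n (X : 'M[A]_(m, n)) i j :
  \tr (X *m delta_mx i j) = X j i.
Proof.
rewrite /mxtrace (bigD1 j) //= big1 ?addr0 => [|k kj].
  rewrite mxE (bigD1 i) //= big1 ?addr0 => [|l li]; first by rewrite mxE !eqxx mulr1.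
  by rewrite mxE (negPf li) mulr0.
by rewrite mxE big1 // => l _; rewrite mxE (negPf kj) andbF mulr0.
Qed.

(** The shifted corner is A U with U = 1 + p Z1 C1 invertible, so its v is unchanged, and the Schur
    correction changes only by multiples of p^M. *)
Lemma vz_shift r s k (A Z C1 : 'M[Zq]_r) (B C2 : 'M[Zq]_(r, s)) (C : 'M[Zq]_s) :
  (0 < k <= 2)%N -> (k < M)%N -> A^T = A -> C1^T = C1 ->
  ((p ^ k)%:R *: A) *m Z = (p ^ M.-1)%:R%:M -> (p ^ k)%:R *: B = 0 ->
  vz (block_mx (A + (p ^ (M - k))%:R *: C1) (B + (p ^ M.-1)%:R *: C2)
        (B + (p ^ M.-1)%:R *: C2)^T C)
  = vz (block_mx A B B^T C).
Proof.
move=> /andP[k0 k2] kM symA symC1 h pB.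
have [Z1 AZ1] := lift_socle p_pr M_gt1 kM h.
set j := (M.-1 - k)%N in AZ1.
have jS : (M - k = j.+1)%N by rewrite /j; lia.
have [B' BE] := mx_torsion p_pr M_gt0 (ltnW kM) pB.
have M1 : (M.-1 = j.+1 + k.-1)%N by rewrite /j; lia.
pose U := 1%:M + p%:R *: (Z1 *m C1); have uU : U \in unitmx by apply: unitmx_1Dp.
have AU : A + (p ^ (M - k))%:R *: C1 = A *m U.
  rewrite mulmxDr mulmx1 -scalemxAr mulmxA AZ1 mul_scalar_mx scalerA -natrM -expnS.
  by rewrite jS.
have symAU : (A + (p ^ (M - k))%:R *: C1)^T = A + (p ^ (M - k))%:R *: C1.
  by rewrite linearD /= linearZ /= symA symC1.
have AUZ : (A + (p ^ (M - k))%:R *: C1) *m (invmx U *m Z1) = (p ^ j)%:R%:M.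
  by rewrite AU mulmxA mulmxK.
have -> : B + (p ^ M.-1)%:R *: C2 = (p ^ j.+1)%:R *: (B' + (p ^ k.-1)%:R *: C2).
  by rewrite scalerDr scalerA -natrM -expnD -M1 BE jS.
rewrite (vz_socle_block p_pr M_gt1 _ _ symAU AUZ).
rewrite BE jS (vz_socle_block p_pr M_gt1 _ _ symA AZ1).
have vE : vz (A + (p ^ j.+1)%:R *: C1) = vz A by rewrite -jS AU (vzMr _ uU).
rewrite vE; congr (_ + vz (C - _))%N.
have p0 i : (M <= i)%N -> (p ^ i)%:R = 0 :> Zq by apply: Zq_pow0.
(* This uses k <= 2: then j + 3 >= M, so the factor U, congruent to 1 modulo p, has no effect. *)
have pZ : (p ^ j.+2)%:R *: (invmx U *m Z1) = (p ^ j.+2)%:R *: Z1.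
  rewrite -[in RHS](mulKmx uU Z1) [in RHS]mulmxDl mul1mx mulmxDr scalerDr.
  rewrite -scalemxAl -!scalemxAr !scalerA -natrM -expnSr (p0 j.+3) ?scale0r ?addr0 //.
  by rewrite /j; lia.
have pZT : (p ^ j.+2)%:R *: (invmx U *m Z1)^T = (p ^ j.+2)%:R *: Z1^T.
  by have := congr1 trmx pZ; rewrite ![(_ *: _)^T]linearZ.
have E (X Y : 'M[Zq]_(r, s)) W : (p ^ j.+2)%:R *: (X^T *m W *m Y)
   = X^T *m ((p ^ j.+2)%:R *: W) *m Y by rewrite -scalemxAr -scalemxAl.
rewrite !E pZT -!E.
rewrite [(_ + _)^T]linearD /= [(_ *: C2)^T]linearZ /= !mulmxDl !mulmxDr.
do ![rewrite -scalemxAl | rewrite -scalemxAr].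
rewrite !scalerDr !scalerA -!natrM -!expnD.
by rewrite !(p0 (j.+2 + k.-1)%N) ?(p0 (j.+2 + k.-1 + k.-1)%N) ?scale0r ?addr0 //; rewrite /j; lia.
Qed.

Variables (K : fieldType) (chi : Zq -> K).
Hypothesis chiD : forall x y, chi (x + y) = chi x * chi y.
Hypothesis chi1 : forall x, chi x = 1 -> x = 0.

Variables (h : Zq) (two_h : 2 * h = 1).

(** In the application T is twice the half-integral matrix, reduced modulo p^M, and h = 1/2
    compensates for the doubling. *)
Definition mxchar N (T A : 'M[Zq]_N) : K := chi (h * \tr (T *m A)).

Lemma mxcharD N (T A B : 'M[Zq]_N) : mxchar T (A + B) = mxchar T A * mxchar T B.
Proof. by rewrite /mxchar mulmxDr linearD /= mulrDr chiD. Qed.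

(** Testing on elementary matrices shows that the r x r corner of T is divisible by p^k and the
    block beside it by p. A factor diag(p, 1) then splits off on one side for k = 1, on both sides
    for k = 2. *)
Lemma mxchar_shift_divisible r s k (T : 'M[Zq]_(r + s)) : (0 < k <= 2)%N -> (k < M)%N ->
  T^T = T ->
  (forall C1 C2, C1^T = C1 -> mxchar T (block_mx ((p ^ (M - k))%:R *: C1)
      ((p ^ M.-1)%:R *: C2) ((p ^ M.-1)%:R *: C2)^T 0) = 1) ->
  exists y, \det T = (p ^ (k * r))%:R * y.
Proof.
move=> /andP[k0 k2] kM symT H.
have unit2 (x : Zq) : 2 * x = 0 -> x = 0.
  by move=> x0; rewrite -[x]mul1r -two_h mulrAC x0 mul0r.
have unith (x : Zq) : h * x = 0 -> x = 0.
  by move=> x0; rewrite -[x]mul1r -two_h -mulrA x0 mulr0.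
have tr0 C1 C2 : C1^T = C1 -> (p ^ (M - k))%:R * \tr (ulsubmx T *m C1)
    + 2 * ((p ^ M.-1)%:R * \tr (ursubmx T *m C2^T)) = 0.
  move=> symC1; have /chi1 := H C1 C2 symC1.
  rewrite -{1}[T]submxK mulmx_block mxtrace_block !mulmx0 addr0.
  rewrite mxtraceD -!scalemxAr [(_ *: C2)^T]linearZ /= -scalemxAr !linearZ /=.
  have -> : \tr (dlsubmx T *m C2) = \tr (ursubmx T *m C2^T).
    by rewrite -[in LHS]mxtrace_tr trmx_mul trmx_dlsub symT mxtrace_mulC.
  rewrite -addrA -mulr2n -[_ *+ 2]mulr_natl => E.
  exact: unith.
have [U12 E12] : exists U, ursubmx T = (p ^ (M - M.-1))%:R *: U.
  apply: (mx_torsion p_pr M_gt0 (leq_pred M)); apply/matrixP=> i j; rewrite !mxE.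
  apply: unit2; have := tr0 0 (delta_mx i j) (trmx0 _ _ _).
  by rewrite mulmx0 mxtrace0 mulr0 add0r trmx_delta mxtrace_mul_delta !mxE.
have [U11 E11] : exists U, ulsubmx T = (p ^ (M - (M - k)))%:R *: U.
  apply: (mx_torsion p_pr M_gt0 (leq_subr _ _)); apply/matrixP=> i j.
  rewrite [LHS]mxE [RHS]mxE.
  have sD : (delta_mx i j + delta_mx j i : 'M[Zq]_r)^T = delta_mx i j + delta_mx j i.
    by rewrite linearD /= !trmx_delta addrC.
  apply: unit2; have := tr0 _ 0 sD; rewrite trmx0 mulmx0 mxtrace0 !mulr0 addr0.
  rewrite mulmxDr mxtraceD !mxtrace_mul_delta.
  have -> : ulsubmx T j i = ulsubmx T i j.
    by rewrite -{1}symT -trmx_ulsub mxE.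
  rewrite -mulr2n -[_ *+ 2]mulr_natl mulrCA => E.
  exact: E.
have E21 : dlsubmx T = p%:R *: U12^T.
  by rewrite -[LHS]trmxK trmx_dlsub symT E12 -subn1 subKn // expn1 linearZ.
rewrite -subn1 subKn // expn1 in E12; rewrite subKn // in E11; last exact: ltnW.
pose Dp : 'M[Zq]_(r + s) := block_mx p%:R%:M 0 0 1%:M.
have dDp : \det Dp = (p ^ r)%:R by rewrite det_lblock det1 mulr1 det_scalar natrX.
have [k1|k1] := eqVneq k 1%N.
  have TE : T = Dp *m block_mx U11 U12 (p%:R *: U12^T) (drsubmx T).
    rewrite /Dp mulmx_block !mul0mx !mul1mx !addr0 !add0r !mul_scalar_mx.
    by rewrite -E12 -E21 -{1}(submxK T) E11 k1 expn1.
  by rewrite TE det_mulmx dDp k1 mul1n; eexists.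
have k2E : k = 2 by lia.
have TE : T = Dp *m block_mx U11 U12 U12^T (drsubmx T) *m Dp.
  rewrite /Dp !mulmx_block !mul0mx !mul1mx !mulmx0 !mulmx1 !addr0 !add0r.
  rewrite !mul_scalar_mx !mul_mx_scalar scalerA -natrM mulnn.
  by rewrite -E12 -E21 -{1}(submxK T) E11 k2E.
rewrite TE !det_mulmx dDp k2E; exists (\det (block_mx U11 U12 U12^T (drsubmx T))).
by rewrite mulrAC -natrM -expnD addnn mul2n.
Qed.

(* Some shift A + X0 within the fibre leaves v unchanged and multiplies the
   character by a constant other than 1. *)
Lemma mxchar_fiber_eq0 N k m (T R : 'M[Zq]_N) : (0 < k <= 2)%N -> (k < M)%N ->
  T^T = T -> R^T = R -> ~ (exists y, \det T = (p ^ (k * rk R))%:R * y) ->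
  \sum_(A | (A^T == A) && (((p ^ k)%:R *: A == R) && (vz A == m))) mxchar T A = 0.
Proof.
move=> k02 kM symT symR nd.
have [r [s [e [P [S1 [Z [uP PRE S1Z]]]]]]] := sym_split p_pr M_gt1 symR.
subst N; rewrite castmx_id in PRE.
have [_ rR] := split_rk p_pr M_gt1 uP PRE symR S1Z.
rewrite rR in nd.
pose Q := invmx P.
have uQ : Q \in unitmx by rewrite unitmx_inv.
pose Tt := Q^T *m T *m Q.
have symTt : Tt^T = Tt by rewrite !trmx_mul trmxK symT mulmxA.
have [C1 [C2 [symC1 ne1]]] : exists C1 C2, C1^T = C1 /\
    mxchar Tt (block_mx ((p ^ (M - k))%:R *: C1)
      ((p ^ M.-1)%:R *: C2) ((p ^ M.-1)%:R *: C2)^T 0) <> 1.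
  apply: contrapT => all1; apply: nd.
  have [|y yE] := @mxchar_shift_divisible r s k Tt k02 kM symTt.
    move=> C1 C2 s1; apply: contrapT => ne; apply: all1.
    by exists C1, C2.
  exists (y * \det P * \det P).
  have -> : T = P^T *m Tt *m P.
    rewrite /Tt !mulmxA -trmx_mul mulVmx // trmx1 mul1mx -mulmxA mulVmx //.
    by rewrite mulmx1.
  rewrite 2!det_mulmx det_tr yE; ring.
set X' := block_mx _ _ _ _ in ne1.
pose X0 := Q *m X' *m Q^T.
have symX' : X'^T = X'.
  by rewrite /X' tr_block_mx trmxK trmx0 [(_ *: C1)^T]linearZ /= symC1.
have symX0 : X0^T = X0 by rewrite !trmx_mul trmxK symX' mulmxA.
have eX0 : mxchar T X0 <> 1.
  suff -> : mxchar T X0 = mxchar Tt X' by [].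
  rewrite /mxchar /X0 /Tt; congr (chi (h * _)).
  by rewrite mulmxA mxtrace_mulC !mulmxA.
have PX0 : P *m X0 *m P^T = X'.
  rewrite /X0 !mulmxA mulmxV // mul1mx -mulmxA -trmx_mul mulmxV // trmx1.
  by rewrite mulmx1.
have pX0 : (p ^ k)%:R *: X0 = 0.
  rewrite /X0 scalemxAl scalemxAr /X' scale_block_mx scaler0.
  rewrite -[_ *: (_ *: C2)^T]linearZ /= !scalerA -!natrM -!expnD.
  have [k0 k2] := andP k02.
  rewrite !(Zq_pow0 p_pr) ?scale0r ?trmx0 ?block_mx0 ?mulmx0 ?mul0mx //; lia.
have vX0 A : A^T = A -> (p ^ k)%:R *: A = R -> vz (A + X0) = vz A.
  move=> symA pA; rewrite -(vz_congr _ uP) -[RHS](vz_congr _ uP).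
  rewrite mulmxDr mulmxDl PX0; set A' := P *m A *m P^T.
  have symA' : A'^T = A' by rewrite !trmx_mul trmxK symA mulmxA.
  have pA' : (p ^ k)%:R *: A' = block_mx S1 0 0 0.
    by rewrite /A' scalemxAl scalemxAr pA PRE.
  have A'E : A' = block_mx (ulsubmx A') (ursubmx A') (ursubmx A')^T (drsubmx A').
    by rewrite trmx_ursub symA' submxK.
  move: pA'; rewrite A'E scale_block_mx => /eq_block_mx[p11 p12 _ _].
  rewrite /X' add_block_mx addr0 -linearD /=.
  apply: (@vz_shift r s k _ Z) => //; first by rewrite trmx_ulsub symA'.
  by rewrite p11.
set Sm := \sum_(A | _) _.
have E : Sm = mxchar T X0 * Sm.
  rewrite {1}/Sm (reindex_inj (addIr X0)) /= /Sm mulr_sumr.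
  apply: eq_big => [A|A _]; last by rewrite mxcharD mulrC.
  rewrite linearD /= symX0 (inj_eq (addIr _)).
  case: eqP => //= symA; rewrite scalerDr pX0 addr0.
  by case: eqP => //= pA; rewrite vX0.
apply/eqP; have : (1 - mxchar T X0) * Sm == 0 by rewrite mulrBl mul1r -E subrr.
by rewrite mulf_eq0 subr_eq0 => /orP[/eqP e1|//]; case: eX0.
Qed.

(** A fibre over R = p^k A contributes 0 once k rk(R) > w. With k = w + 1 this disposes of all A
    with p^k A nonzero. If p^(w+1) A = 0, then w = 0 would give v(A) <= N, and for w = 1 the rank of
    pA is v(pA) >= v(A) - N > 1, so k = 1 works. *)
Lemma mxchar_coef_eq0 N w m (T : 'M[Zq]_N) : (w <= 1)%N -> (2 < M)%N -> T^T = T ->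
  ~ (exists y, \det T = (p ^ w.+1)%:R * y) -> (N + w < m)%N ->
  \sum_(A | (A^T == A) && (vz A == m)) mxchar T A = 0.
Proof.
move=> w1 M2 symT nd mN.
have ndvd i : (w < i)%N -> ~ (exists y, \det T = (p ^ i)%:R * y).
  move=> wi [y yE]; apply: nd; exists ((p ^ (i - w.+1))%:R * y).
  by rewrite mulrA -natrM -expnD subnKC.
have fib k (P : pred 'M[Zq]_N) : (0 < k <= 2)%N ->
   (forall A, A^T = A -> P ((p ^ k)%:R *: A) -> vz A = m -> (w < k * rk ((p ^ k)%:R *: A))%N) ->
   \sum_(A | (A^T == A) && (P ((p ^ k)%:R *: A) && (vz A == m))) mxchar T A = 0.
  move=> k02 HP.
  rewrite (partition_big (fun A => (p ^ k)%:R *: A) (fun R => (R^T == R) && P R)) /=; last first.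
    by move=> A /andP[/eqP symA /andP[-> _]]; rewrite sym_scale // eqxx.
  apply: big1 => R /andP[/eqP symR PR].
  have [/existsP[A /andP[/eqP symA /andP[/eqP AR /eqP vA]]]|/existsPn noA] :=
    boolP [exists A : 'M[Zq]_N, (A^T == A) && (((p ^ k)%:R *: A == R) && (vz A == m))].
    rewrite -[RHS](@mxchar_fiber_eq0 N k m T R k02) //.
    - apply: eq_bigl => B; case: eqP => //= symB.
      by case: ((p ^ k)%:R *: B =P R) => [->|_]; rewrite ?PR ?andbT ?andbF.
    - by case/andP: k02 => _ k2; apply: leq_ltn_trans k2 _.
    - by apply: ndvd; rewrite -AR; apply: HP; rewrite // AR.
  apply: big_pred0 => A; have := noA A.
  case: eqP => //= symA; case: (vz A == m); rewrite ?andbF //= !andbT.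
  by case: eqP => //; rewrite andbF.
have rkvz (A : 'M[Zq]_N) : A^T = A -> (vz A <= N + vz (p%:R *: A))%N.
  by move=> symA; have := rk_le p_pr M_gt1 symA; rewrite /rk leq_subLR addnC.
pose k := w.+1.
rewrite (bigID (fun A : 'M[Zq]_N => (p ^ k)%:R *: A != 0)) /=.
rewrite [X in X + _](_ : _ = 0) ?add0r; last first.
  rewrite -[RHS](fib k (fun R => R != 0)); first by apply: eq_bigl => A; rewrite andbAC andbA.
  - by rewrite /k; lia.
  - move=> A symA pA0 _; rewrite (leq_trans (ltnSn w)) // leq_pmulr // lt0n.
    by apply: contraNneq pA0 => /(rk_eq0 p_pr M_gt1 (sym_scale _ symA)) ->.
have [w0|w0] := eqVneq w 0%N.
  apply: big_pred0 => A; apply/negP => /andP[/andP[/eqP symA /eqP vA]].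
  rewrite negbK /k w0 expn1 => /eqP pA; have := rkvz A symA.
  by rewrite pA vz0 vA; lia.
have w1E : w = 1%N by lia.
rewrite /k w1E.
rewrite -[RHS](fib 1%N (fun R => p%:R *: R == 0)) //.
  by apply: eq_bigl => A; rewrite negbK scalerA -natrM expn1 mulnn andbAC andbA.
move=> A symA; rewrite expn1 => /eqP ppA vA; rewrite mul1n w1E.
rewrite ltnNge; apply/negP => rk1; have := rkvz A symA.
move: rk1; rewrite /rk ppA vz0 subn0 vA; lia.
Qed.

End CharacterSums.

(** * Matrices over Z/l^M as rational matrices modulo integral ones *)

Section RationalRepresentatives.
Variables (l M : nat) (l_pr : prime l) (M_gt0 : (0 < M)%N).
Local Notation q := (l ^ M)%N.
Local Notation Zq := 'Z_(l ^ M).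

Let q_gt1 : (1 < q)%N.
Proof. by rewrite -(exp1n M) ltn_exp2r // prime_gt1. Qed.

Let q_neq0 : (q%:R : rat) != 0.
Proof. by rewrite pnatr_eq0 -lt0n ltnW. Qed.

Let q_gt0 : 0 < (q%:R : rat).
Proof. by rewrite ltr0n ltnW. Qed.

Definition Zq_rat m n (A : 'M[Zq]_(m, n)) : 'M[rat]_(m, n) :=
  map_mx (fun x : Zq => (x : nat)%:R / q%:R) A.

Definition Zq_lift m n (A : 'M[Zq]_(m, n)) : 'M[int]_(m, n) :=
  map_mx (fun x : Zq => Posz x) A.

Lemma ltn_Zq (x : Zq) : (x < q)%N.
Proof. by have := ltn_ord x; rewrite [X in (_ < X)%N -> _](Zp_cast q_gt1). Qed.

Lemma val_Zq_int (z : int) : Posz (z%:~R : Zq) = (z %% q)%Z.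
Proof.
have q0 : (q%:R : Zq) = 0 by apply: Zq_pM.
have z0 : (0 <= z %% q)%Z by rewrite modz_ge0 // eqz_nat -lt0n ltnW.
have -> : (z%:~R : Zq) = (z %% q)%Z%:~R.
  rewrite {1}(divz_eq z q) rmorphD rmorphM /=.
  have -> : ((Posz q)%:~R : Zq) = 0 by rewrite -pmulrn.
  by rewrite mulr0 add0r.
rewrite -{1}(gez0_abs z0) -pmulrn val_Zp_nat // modn_small ?gez0_abs //.
by rewrite -ltz_nat gez0_abs // ltz_pmod // ltz_nat ltnW.
Qed.

Lemma Zq_lift_K m n (A : 'M[Zq]_(m, n)) : map_mx intr (Zq_lift A) = A.
Proof. by apply/matrixP=> i j; rewrite !mxE -pmulrn natr_Zp. Qed.

Lemma Zq_rat_inj m n : injective (@Zq_rat m n).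
Proof.
move=> A B /matrixP E; apply/matrixP=> i j; have := E i j; rewrite !mxE.
by move/(mulIf (invr_neq0 q_neq0))/eqP; rewrite eqr_nat => /eqP/val_inj.
Qed.

Lemma Zq_rat_trmx m n (A : 'M[Zq]_(m, n)) : (Zq_rat A)^T = Zq_rat A^T.
Proof. by apply/matrixP=> i j; rewrite !mxE. Qed.

Lemma Zq_rat_lift m n (A : 'M[Zq]_(m, n)) :
  Zq_rat A = q%:R^-1 *: map_mx intr (Zq_lift A).
Proof. by apply/matrixP=> i j; rewrite !mxE mulrC. Qed.

Lemma frac_mx_div m n (B : 'M[int]_(m, n)) :
  frac_mx (q%:R^-1 *: map_mx intr B) = Zq_rat (map_mx intr B).
Proof.
apply/matrixP=> i j; rewrite !mxE; set z := B i j.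
have fl : Num.floor (q%:R^-1 * z%:~R : rat) = (z %/ q)%Z.
  apply: floor_def; rewrite ler_pdivlMl // ltr_pdivrMl // mulrC [q%:R * _]mulrC.
  rewrite -!(intrM _ _ (Posz q)) ler_int ltr_int -lez_divRL ?ltz_nat ?(ltnW q_gt1) //.
  by rewrite lexx -ltz_divLR ?ltz_nat ?(ltnW q_gt1) // ltzD1 lexx.
rewrite fl; have -> : (((z%:~R : Zq) : nat)%:R : rat) = (z %% q)%Z%:~R.
  by rewrite -val_Zq_int.
apply: (mulfI q_neq0); rewrite mulrBr mulrA mulfV // mul1r mulrCA mulfV // mulr1.
by rewrite {1}(divz_eq z q) rmorphD rmorphM /= mulrC addrAC subrr add0r.
Qed.

Lemma nu_Zq_rat N (A : 'M[Zq]_N) : nu (Zq_rat A) = im_card A.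
Proof.
pose X := [fset Zq_rat y | y in rowim A]%fset.
have actE (x : 'rV[int]_N) :
    frac_mx (map_mx intr x *m Zq_rat A) = Zq_rat (map_mx intr x *m A).
  rewrite Zq_rat_lift -scalemxAr -map_mxM frac_mx_div map_mxM Zq_lift_K.
  by [].
have XE : [set frac_mx (map_mx intr x *m Zq_rat A) | x in [set: 'rV[int]_N]]%classic
    = [set` X]%classic.
  apply/seteqP; split=> [_ [x _ <-]|y] /=.
    by rewrite actE; apply/imfsetP; exists (map_mx intr x *m A); rewrite //= mem_rowim.
  case/imfsetP=> _ /= /imsetP[x _ ->] ->; exists (Zq_lift x) => //.
  by rewrite actE Zq_lift_K.
rewrite /nu XE set_fsetK card_imfset /=; last exact: (@Zq_rat_inj 1 N).
by rewrite /im_card cardE.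
Qed.

Lemma Zq_rat_rep N (S : 'M[rat]_N) : S^T = S ->
  (forall i j, 0 <= S i j < 1 /\ q%:R * S i j \is a Num.int) ->
  exists2 A : 'M[Zq]_N, A^T = A & S = Zq_rat A.
Proof.
move=> symS intS; pose f (s : rat) : Zq := (Num.floor (q%:R * s))%:~R.
exists (map_mx f S); first by rewrite map_trmx symS.
apply/matrixP=> i j; rewrite !mxE.
have [/andP[s0 s1] /intrP[z zE]] := intS i j.
rewrite /f zE intrKfloor.
have z0 : 0 <= z by rewrite -(ler_int rat) -zE mulr_ge0 // ltW.
have zq : z < q by rewrite -(ltr_int rat) -zE gtr_pMr.
have -> : (((z%:~R : Zq) : nat)%:R : rat) = z%:~R.
  by rewrite -[LHS]/((Posz _)%:~R) val_Zq_int modz_small ?z0.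
by rewrite -zE mulrC mulKf.
Qed.

End RationalRepresentatives.

(** * Coefficients of the Siegel series as sums over Z/l^M *)

Section SiegelSeriesCoefficients.
Variables (R : realType) (l M : nat) (l_pr : prime l) (M_gt1 : (1 < M)%N).
Local Notation q := (l ^ M)%N.
Local Notation Zq := 'Z_(l ^ M).
Let M_gt0 : (0 < M)%N. Proof. exact: ltnW. Qed.

(** The index l^m bounds the denominators of S by l^m. To see this, S is first represented at a
    level M' large enough for its own denominators, where [scale_pow_vz] applies. *)
Lemma sym_mod_rep N (S : 'M[rat]_N) m : (m <= M)%N ->
  sym_mod l S -> logn l (nu S) = m ->
  exists2 A : 'M[Zq]_N, A^T = A & S = Zq_rat A /\ vz A = m.
Proof.
move=> mM [symS locS] vS.
have l0 : (l%:R : rat) != 0 by rewrite pnatr_eq0 -lt0n prime_gt0.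
have ex i j : exists e, l%:R ^+ e * S i j \is a Num.int by have [_] := locS i j.
pose e i j := xchoose (ex i j).
pose M' := (M + \sum_i \sum_j e i j)%N.
have M'1 : (1 < M')%N by apply: leq_trans M_gt1 (leq_addr _ _).
have M'0 : (0 < M')%N by apply: ltnW.
have eM' i j : (e i j <= M')%N.
  apply: leq_trans (leq_addl _ _); rewrite (bigD1 i) //= (bigD1 j) //= -addnA.
  exact: leq_addr.
have int' i j : 0 <= S i j < 1 /\ (l ^ M')%:R * S i j \is a Num.int.
  have [s01 _] := locS i j; split=> //.
  rewrite natrX -(subnK (eM' i j)) exprD -mulrA rpredM ?rpredX ?rpred_nat //.
  exact: (xchooseP (ex i j)).
have [A' symA' SE'] := Zq_rat_rep l_pr M'0 symS int'.
have vA' : vz A' = m by rewrite -vS SE' (nu_Zq_rat l_pr M'0).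
have := scale_pow_vz l_pr M'1 symA'; rewrite vA' => /matrixP A'0.
have int i j : 0 <= S i j < 1 /\ (l ^ M)%:R * S i j \is a Num.int.
  have [s01 _] := locS i j; split=> //.
  have := A'0 i j; rewrite !mxE -{1}(natr_Zp (A' i j)) -natrM => /eqP.
  rewrite (Zq_natr_eq0 l_pr M'0) => /dvdnP[t tE].
  rewrite -(subnK mM) expnD natrM -mulrA rpredM ?rpred_nat //.
  rewrite SE' mxE mulrA -natrM tE natrM mulfK ?rpred_nat //.
  by rewrite natrX expf_neq0.
have [A symA SE] := Zq_rat_rep l_pr M_gt0 symS int.
by exists A => //; split=> //; rewrite -vS SE (nu_Zq_rat l_pr M_gt0).
Qed.

Lemma Zq_rat_sym_mod N (A : 'M[Zq]_N) : A^T = A -> sym_mod l (Zq_rat A).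
Proof.
move=> symA; have q0 : 0 < (q%:R : rat) by rewrite ltr0n expn_gt0 prime_gt0.
split; first by rewrite Zq_rat_trmx symA.
move=> i j; rewrite mxE divr_ge0 ?ler0n // ltr_pdivrMr // mul1r ltr_nat ltn_Zq //.
by split=> //; exists M; rewrite -natrX mulrC mulfVK ?gt_eqF // rpred_nat.
Qed.

Definition siegel_char N (T : 'M[rat]_N) (A : 'M[Zq]_N) : Cx R :=
  expi (ratr (\tr (T *m Zq_rat A))).

Lemma siegel_series_coef N (T : 'M[rat]_N) m : (m <= M)%N ->
  siegel_series R l T m = \sum_(A : 'M[Zq]_N | (A^T == A) && (vz A == m)) siegel_char T A.
Proof.
move=> mM; rewrite /siegel_series.
pose P := [pred A : 'M[Zq]_N | (A^T == A) && (vz A == m)].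
pose r := [seq Zq_rat A | A <- enum P].
have uq : uniq r by rewrite map_inj_uniq ?enum_uniq //; apply: Zq_rat_inj.
have setE : [set S | sym_mod l S /\ logn l (nu S) = m]%classic = [set` r]%classic.
  apply/seteqP; split=> [S /= [symS vS]|S /= /mapP[A]].
    have [A symA [SE vA]] := sym_mod_rep mM symS vS.
    by apply/mapP; exists A => //; rewrite mem_enum inE symA vA !eqxx.
  rewrite mem_enum inE => /andP[/eqP symA /eqP vA] ->; split.
    exact: Zq_rat_sym_mod.
  by rewrite (nu_Zq_rat l_pr M_gt0).
by rewrite setE -fsbig_seq // big_map big_enum; apply: eq_bigl => A; rewrite inE.
Qed.

Lemma siegel_series_wsum N (T : 'M[rat]_N) m : (m <= M)%N ->
  siegel_series R l T m = (wsum (siegel_char T) (fun=> 1))`_m.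
Proof.
move=> mM; rewrite siegel_series_coef // /wsum coef_sum big_mkcondr.
apply: eq_bigr => A _; rewrite mulr1 coefZ coefXn eq_sym.
by case: eqP => _; rewrite ?mulr1 ?mulr0.
Qed.

Lemma trace_half_integral_int N (T : 'M[rat]_N) (S : 'M[int]_N) :
  half_integral T -> S^T = S -> \tr (T *m map_mx intr S) \is a Num.int.
Proof.
case/and3P=> /eqP symT /forallP diagT /forallP offT symS.
have -> : \tr (T *m map_mx intr S) = \sum_i \sum_j T i j * (S i j)%:~R.
  by rewrite /mxtrace; apply: eq_bigr => i _; rewrite mxE; apply: eq_bigr => j _;
    rewrite mxE -{1}symS mxE.
have -> : \sum_i \sum_j T i j * (S i j)%:~R = \sum_i T i i * (S i i)%:~R
   + \sum_(i < N) \sum_(j < N | (i < j)%N) (2 * T i j) * (S i j)%:~R.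
  have E : \sum_(i < N) \sum_(j < N | (j < i)%N) T i j * (S i j)%:~R
      = \sum_(i < N) \sum_(j < N | (i < j)%N) T i j * (S i j)%:~R.
    rewrite (exchange_big_dep xpredT) //=; apply: eq_bigr => i _; apply: eq_bigr => j _.
    by rewrite -{1}symT -{1}symS !mxE.
  transitivity (\sum_(i < N) (T i i * (S i i)%:~R + (\sum_(j < N | (j < i)%N) T i j * (S i j)%:~R
      + \sum_(j < N | (i < j)%N) T i j * (S i j)%:~R))).
    apply: eq_bigr => i _; rewrite (bigD1 i) //=; congr (_ + _).
    rewrite (bigID (fun j : 'I_N => (j < i)%N)) /=; congr (_ + _); apply: eq_bigl => j.
      by case: ltngtP => [|_|/val_inj->]; rewrite ?andbT ?andbF // => h;
        rewrite -val_eqE neq_ltn h.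
    by rewrite -leqNgt leq_eqVlt -val_eqE /= neq_ltn; case: ltngtP.
  rewrite !big_split /= E; congr (_ + _); rewrite -big_split; apply: eq_bigr => i _.
  by rewrite -big_split; apply: eq_bigr => j _ /=; rewrite mulr2n !mulrDl mul1r.
rewrite rpredD // rpred_sum // => i _; first by rewrite rpredM ?intr_int.
rewrite rpred_sum // => j _; rewrite rpredM ?intr_int //.
exact: (forallP (offT i)).
Qed.

End SiegelSeriesCoefficients.

(** * The exponential as a faithful character of Q/Z *)

Section ExponentialCharacter.
Variable R : realType.
Implicit Types z w : Cx R.

Lemma ratr_realC (x : rat) : (ratr x : Cx R) = (ratr x : R)%:C%C.
Proof.
by rewrite -(fmorph_eq_rat ((real_complex R) \o (ratr : rat -> R))).
Qed.

Lemma expiD z w : expi (z + w) = expi z * expi w.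
Proof.
case: z w => [a b] [c d]; rewrite /expi /=.
rewrite !mulrDr opprD expRD cosD sinD.
set x := cos _; set y := sin _; set x' := cos _; set y' := sin _.
set u := expR _; set v := expR _.
apply/eqP; rewrite eq_complex /=.
by apply/andP; split; apply/eqP; ring.
Qed.

Lemma expi0 : expi (0 : Cx R) = 1.
Proof. by rewrite /expi /= !mulr0 oppr0 expR0 cos0 sin0 mul1r. Qed.

Lemma expi1 : expi (1 : Cx R) = 1.
Proof.
rewrite /expi /= !mulr0 oppr0 expR0 mul1r mulr1 mulr_natl mulr2n.
by rewrite cosDpi sinDpi cospi sinpi opprK oppr0.
Qed.

Lemma expi_natmul z n : expi (n%:R * z) = expi z ^+ n.
Proof.
elim: n => [|n IH]; first by rewrite mul0r expi0.
by rewrite -natr1 mulrDl mul1r expiD IH exprSr.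
Qed.

Lemma expiN z : expi (- z) * expi z = 1.
Proof. by rewrite -expiD addNr expi0. Qed.

Lemma expi_int (m : int) : expi (m%:~R : Cx R) = 1.
Proof.
have nat1 (n : nat) : expi (n%:R : Cx R) = 1.
  by rewrite -[n%:R]mulr1 expi_natmul expi1 expr1n.
case: m => n; first exact: nat1.
by rewrite NegzE rmorphN /= -[LHS]mulr1 -{2}(nat1 n.+1) expiN.
Qed.

Lemma expi_ratr_int (x : rat) : x \is a Num.int -> expi (ratr x : Cx R) = 1.
Proof. by case/intrP=> m ->; rewrite ratr_int expi_int. Qed.

(** If the fractional part y were nonzero, sin(pi y) would be positive, whereas cos(2 pi y) = 1
    forces its square to vanish. *)
Lemma expi_ratr_eq1 (x : rat) : expi (ratr x : Cx R) = 1 -> x \is a Num.int.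
Proof.
set y := x - (Num.floor x)%:~R => e1.
have ey : expi (ratr y : Cx R) = 1.
  rewrite -[LHS]mulr1 -[X in _ * X](expi_ratr_int (intr_int _ (Num.floor x))) -expiD.
  by rewrite -rmorphD subrK.
have /andP[y0 y1] : 0 <= y < 1.
  have /andP[a b] := floor_itv x; rewrite intrD in b.
  by rewrite subr_ge0 a ltrBlDl.
have [y00|yn0] := eqVneq y 0.
  by have /eqP := y00; rewrite subr_eq0 => /eqP ->; apply: intr_int.
have yp : 0 < (ratr y : R) by rewrite ltr0q lt0r yn0.
have yl : (ratr y : R) < 1 by rewrite -[ltRHS](rmorph1 (ratr : rat -> R)) ltr_rat.
move: ey; rewrite ratr_realC /expi /= !mulr0 oppr0 expR0 mul1r.
move=> /(congr1 (@complex.Re R)) /= c1.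
have sp : 0 < sin (pi * (ratr y : R)).
  by apply: sin_gt0_pi; rewrite mulr_gt0 ?pi_gt0 //= gtr_pMr ?pi_gt0.
move: c1; rewrite -mulrA mulr_natl cos_mulr2n => c1.
have := cos2Dsin2 (pi * (ratr y : R)).
move: sp c1; move: (sin _) (cos _) => s c sp; rewrite mulr2n.
move=> c1 cs; have : s ^+ 2 = 0 by lra.
by move/eqP; rewrite expf_eq0 /= => /eqP s0; rewrite s0 ltxx in sp.
Qed.

End ExponentialCharacter.

(** * The characters of the Siegel series on Z/l^M *)

Section SiegelCharacters.
Variables (R : realType) (l M : nat) (l_pr : prime l) (M_gt1 : (1 < M)%N).
Local Notation q := (l ^ M)%N.
Local Notation Zq := 'Z_(l ^ M).
Let M_gt0 : (0 < M)%N. Proof. exact: ltnW. Qed.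
Let q_neq0 : (q%:R : rat) != 0.
Proof. by rewrite pnatr_eq0 -lt0n expn_gt0 prime_gt0. Qed.

Lemma Zq_intr_eq0 (z : int) : (z%:~R == 0 :> Zq) = (q %| z)%Z.
Proof.
rewrite -val_eqE /= -eqz_nat (val_Zq_int l_pr M_gt0).
by apply/eqP/dvdz_mod0P.
Qed.

(** Two symmetric lifts differ by q D with D integral and symmetric, and tr(TD) is an integer.
    Symmetry of the lift matters because T is only half-integral. *)
Lemma siegel_char_lift N (T : 'M[rat]_N) (A : 'M[Zq]_N) (S : 'M[int]_N) :
  half_integral T -> A^T = A -> S^T = S -> map_mx intr S = A ->
  siegel_char R T A = expi (ratr (q%:R^-1 * \tr (T *m map_mx intr S))).
Proof.
move=> hT symA symS SA.
have symL : (Zq_lift A)^T = Zq_lift A by rewrite /Zq_lift map_trmx symA.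
pose D : 'M[int]_N := map_mx (fun z => (z %/ q)%Z) (S - Zq_lift A).
have SE : S - Zq_lift A = (q%:Z) *: D.
  apply/matrixP=> i j; rewrite [RHS]mxE [D i j]mxE mulrC; apply/esym/eqP.
  rewrite -dvdz_eq -Zq_intr_eq0 !mxE rmorphB /=.
  by rewrite -pmulrn natr_Zp -SA mxE subrr.
have symD : D^T = D by rewrite /D map_trmx linearB /= symS symL.
have E : map_mx intr S = map_mx intr (Zq_lift A) + q%:R *: map_mx intr D :> 'M[rat]_N.
  apply/matrixP=> i j; move/matrixP: SE => /(_ i j); rewrite !mxE.
  move=> E0; apply/eqP; by rewrite addrC -subr_eq -rmorphB /= {1}E0 rmorphM.
rewrite /siegel_char Zq_rat_lift E mulmxDr mxtraceD mulrDr -!scalemxAr.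
rewrite !linearZ /= mulKf // rmorphD expiD.
by rewrite (expi_ratr_int _ (trace_half_integral_int hT symD)) mulr1.
Qed.

Lemma sym_Zq_lift N (A : 'M[Zq]_N) : A^T = A -> (Zq_lift A)^T = Zq_lift A.
Proof. by move=> symA; rewrite /Zq_lift map_trmx symA. Qed.

Lemma siegel_char0 N (T : 'M[rat]_N) : siegel_char R T (0 : 'M[Zq]_N) = 1.
Proof.
rewrite /siegel_char Zq_rat_lift.
have -> : Zq_lift (0 : 'M[Zq]_N) = 0 by apply/matrixP=> i j; rewrite !mxE.
by rewrite map_mx0 scaler0 mulmx0 mxtrace0 rmorph0 expi0.
Qed.

Lemma siegel_char_scale N (T : 'M[rat]_N) (A : 'M[Zq]_N) c :
  half_integral T -> A^T = A ->
  siegel_char R (c%:R *: T) A = siegel_char R T (c%:R *: A).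
Proof.
move=> hT symA.
have symL := sym_Zq_lift symA.
rewrite (@siegel_char_lift _ T _ ((Posz c) *: Zq_lift A)) //; first last.
- by rewrite map_mxZ /= Zq_lift_K // -pmulrn.
- by rewrite linearZ /= symL.
- by rewrite linearZ /= symA.
rewrite /siegel_char Zq_rat_lift -scalemxAl -scalemxAr map_mxZ /= -scalemxAr.
by rewrite !linearZ /= -pmulrn mulrCA.
Qed.

Definition Zq_expi (x : Zq) : Cx R := expi (ratr (q%:R^-1 * (x : nat)%:R)).

Lemma Zq_expi_int (z : int) : Zq_expi z%:~R = expi (ratr (q%:R^-1 * z%:~R)).
Proof.
rewrite /Zq_expi; have -> : (((z%:~R : Zq) : nat)%:R : rat) = (z %% q)%Z%:~R.
  by rewrite -(val_Zq_int l_pr M_gt0).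
have -> : (z%:~R : rat) = (z %/ q)%Z%:~R * q%:R + (z %% q)%Z%:~R.
  by rewrite {1}(divz_eq z q) intrD intrM.
rewrite mulrDr [ratr (_ + _)]rmorphD /= expiD.
have -> : q%:R^-1 * ((z %/ q)%Z%:~R * q%:R) = (z %/ q)%Z%:~R :> rat.
  by rewrite mulrCA mulVf // mulr1.
by rewrite (expi_ratr_int _ (intr_int _ _)) mul1r.
Qed.

Lemma Zq_intrK (x : Zq) : (Posz x)%:~R = x. Proof. by rewrite -pmulrn natr_Zp. Qed.

Lemma Zq_expiD x y : Zq_expi (x + y) = Zq_expi x * Zq_expi y.
Proof.
rewrite -{1}(Zq_intrK x) -{1}(Zq_intrK y) -rmorphD Zq_expi_int rmorphD /= mulrDr.
by rewrite rmorphD expiD.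
Qed.

Lemma Zq_expi_eq1 x : Zq_expi x = 1 -> x = 0.
Proof.
move/expi_ratr_eq1 => /intrP[z zE]; apply/eqP.
rewrite -(natr_Zp x) (Zq_natr_eq0 l_pr M_gt0).
have : ((x : nat)%:Z = z * q)%R.
  apply: (@intr_inj rat); rewrite intrM -zE -[in RHS]pmulrn mulrAC mulVf // mul1r.
  by rewrite -pmulrn.
by move/eqP => E; have := dvdz_mull z (dvdzz q); rewrite -(eqP E).
Qed.

Lemma siegel_char_mxchar N (T : 'M[rat]_N) (G : 'M[int]_N) (h : Zq) (A : 'M[Zq]_N) :
  half_integral T -> map_mx intr G = 2 *: T -> 2 * h = 1 -> A^T = A ->
  siegel_char R T A = mxchar Zq_expi h (map_mx intr G) A.
Proof.
move=> hT GT h2 symA; have symL := sym_Zq_lift symA.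
rewrite (siegel_char_lift hT symA symL (Zq_lift_K A)) /mxchar.
have /intrP[t tE] := trace_half_integral_int hT symL.
rewrite tE -Zq_expi_int; congr Zq_expi.
have E : (2 * t = \tr (G *m Zq_lift A))%R.
  apply: (@intr_inj rat); rewrite rmorphM /= -tE -trace_map_mx map_mxM GT.
  by rewrite -scalemxAl linearZ.
have : ((2 * t)%:~R : Zq) = \tr (map_mx intr G *m A).
  by rewrite E -trace_map_mx map_mxM Zq_lift_K.
by rewrite rmorphM /= => <-; rewrite mulrA [h * _]mulrC h2 mul1r.
Qed.

End SiegelCharacters.

(** * Recurrence and triviality of the Siegel polynomials *)

Section SiegelPolynomials.
Variable R : realType.

(** The substitution of cA for A permutes the symmetric matrices modulo l^M and preserves v, as c is
    a unit. *)
Lemma siegel_series_unit_scale N l c (T : 'M[rat]_N) m : prime l -> coprime l c ->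
  half_integral T -> siegel_series R l (c%:R *: T) m = siegel_series R l T m.
Proof.
move=> l_pr lc hT; have [M [M1 mM]] : exists M, (1 < M)%N /\ (m <= M)%N by exists m.+2; lia.
have M0 : (0 < M)%N by apply: ltnW.
rewrite (siegel_series_coef R l_pr M1 (c%:R *: T) mM) (siegel_series_coef R l_pr M1 T mM).
have uc : (c%:R : 'Z_(l ^ M)) \is a GRing.unit by apply: Zq_unit_coprime.
have bij : bijective (fun A : 'M['Z_(l ^ M)]_N => c%:R *: A).
  by exists (fun A : 'M['Z_(l ^ M)]_N => (c%:R : 'Z_(l ^ M))^-1 *: A) => A;
    rewrite scalerA ?mulVr ?mulrV ?scale1r.
rewrite [RHS](reindex _ (onW_bij _ bij)) /=.
apply: eq_big => [A|A /andP[/eqP symA _]]; last exact: siegel_char_scale.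
have -> : vz (c%:R *: A) = vz A.
  by rewrite -mul_scalar_mx vzMl // unitmxE det_scalar unitrX.
by rewrite linearZ /= (inj_eq (bij_inj bij)).
Qed.

Lemma siegel_num_coef0 (K : fieldType) n (c : K) : (siegel_num n c)`_0 = 1.
Proof.
rewrite /siegel_num -horner_coef0 hornerM horner_prod !hornerE subr0.
rewrite big1 ?mul1r // => i _.
by rewrite horner_coef0 one_sub_scaleX_coef0.
Qed.

Lemma siegel_num_neq0 (K : fieldType) n (c : K) : siegel_num n c != 0.
Proof. by apply/eqP => E; have := siegel_num_coef0 n c; rewrite E coef0 => /esym/eqP; rewrite oner_eq0. Qed.

Lemma siegel_poly_uniq n l (T T' : 'M[rat]_(2 * n)) (P P' : {poly int}) :
  is_siegel_poly R l T P -> is_siegel_poly R l T' P' -> fundT T = fundT T' ->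
  (forall m, siegel_series R l T m = siegel_series R l T' m) ->
  map_poly intr P = map_poly intr P' :> {poly Cx R}.
Proof.
move=> HP HP' fE sE; apply: (mulfI (siegel_num_neq0 n (l%:R : Cx R))).
apply/polyP=> m; have := HP m; rewrite /siegel_num => <-.
have := HP' m => <-; rewrite fE; apply: eq_bigr => i _.
by rewrite sE.
Qed.

Lemma siegel_poly_wsum n l M (T : 'M[rat]_(2 * n)) (P : {poly int}) :
  prime l -> (1 < M)%N -> is_siegel_poly R l T P ->
  eqX M ((1 - ((kronecker (fundT T) l)%:~R * l%:R ^+ n) *: 'X)
      * wsum (siegel_char R T : 'M['Z_(l ^ M)]_(2 * n) -> Cx R) (fun=> 1))
    (siegel_num n l%:R * map_poly intr P).
Proof.
move=> l_pr M1 HP; apply: coef_eqX => m mM.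
rewrite /siegel_num -(HP m) coefM; apply: eq_bigr => i _.
rewrite (siegel_series_wsum R l_pr M1) //.
exact: leq_trans (leq_subr _ _) (ltnW mM).
Qed.

Lemma recactZu (A : comNzRingType) (P : {poly A}) c u :
  recact P (fun i => c * u i) = c * recact P u.
Proof. by rewrite /recact mulr_sumr; apply: eq_bigr => i _; rewrite mulrCA. Qed.

(** The recurrence for the Siegel series and the closed form of the trivial-character sum share the
    factor [siegel_num], which cancels. The congruence modulo X^(M-1) holds for every M > 1, hence
    the equality of polynomials. *)
Lemma siegel_poly_recurrence n p (T : 'M[rat]_(2 * n)) (P : nat -> {poly int}) :
  prime p -> half_integral T ->
  (forall i, is_siegel_poly R p ((p ^ i)%:R *: T) (P i)) ->
  (forall i, fundT ((p ^ i)%:R *: T) = fundT T) ->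
  siegel_den n (p%:R : Cx R) *
    recact (lift_poly p (Cx R) (2 * n) (2 * n)) (fun i => map_poly intr (P i))
  = (1 - ((kronecker (fundT T) p)%:~R * p%:R ^+ n) *: 'X)
     * (lift_poly p (Cx R) (2 * n) (2 * n)).[1].
Proof.
move=> p_pr hT HP fE.
set Q := lift_poly _ _ _ _; set L := 1 - _ *: 'X.
suff H M : (1 < M)%N -> eqX M.-1 (siegel_den n (p%:R : Cx R) *
    recact Q (fun i => map_poly intr (P i))) (L * Q.[1]).
  by apply/polyP=> m; apply: (eqX_coef (H m.+2 isT)).
move=> M1; set D := siegel_den _ _; set Nm := siegel_num n (p%:R : Cx R).
have leM (a b : {poly Cx R}) : eqX M a b -> eqX M.-1 a b.
  by apply: dvdp_trans; rewrite dvdp_exp2l // leq_pred.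
apply: (@eqX_cancel _ _ Nm); first by rewrite siegel_num_coef0 oner_neq0.
pose b i := wsum (siegel_char R ((p ^ i)%:R *: T) : 'M['Z_(p ^ M)]_(2 * n) -> Cx R) (fun=> 1).
have e1 : eqX M (recact Q (fun i => Nm * map_poly intr (P i))) (recact Q (fun i => L * b i)).
  apply: eqX_recact => i; apply: eqX_sym.
  by have := siegel_poly_wsum p_pr M1 (HP i); rewrite fE.
have e2 : eqX M (recact Q b) (Q.[1] * sym_zeta p M (Cx R) (2 * n)).
  have := sym_sum_recurrence p_pr M1 (@siegel_char0 R p M _ T).
  apply: eqX_trans; apply: eqX_eq; apply: eq_recact => i.
  by apply: eq_bigr => A /eqP symA; rewrite siegel_char_scale.
have e3 := sym_zeta_even (Cx R) p_pr M1 n.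
rewrite recactZu in e1; rewrite [X in eqX _ _ X]recactZu in e1.
have -> : Nm * (D * recact Q (fun i => map_poly intr (P i)))
   = D * (Nm * recact Q (fun i => map_poly intr (P i))) by rewrite mulrCA.
apply: (eqX_trans (eqXMl D (leM _ _ e1))).
apply: (eqX_trans (eqXMl D (eqXMl L (leM _ _ e2)))).
have -> : D * (L * (Q.[1] * sym_zeta p M (Cx R) (2 * n)))
  = (L * Q.[1]) * (sym_zeta p M (Cx R) (2 * n) * D) by ring.
by rewrite [Nm * _]mulrC; apply: eqXMl.
Qed.

Lemma size_siegel_num (K : fieldType) n (c : K) : c != 0 -> size (siegel_num n c) = (2 * n).+2.
Proof.
move=> c0; have s1 : size (1 - 'X : {poly K}) = 2.
  by rewrite -opprB size_polyN -[1]/(1%:P) size_XsubC.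
have s2 i : size (1 - c ^+ (2 * i) *: 'X^2 : {poly K}) = 3.
  rewrite addrC size_polyDl size_polyN size_scale ?expf_neq0 // size_polyXn //.
  by rewrite size_poly1.
elim: n => [|n IH]; first by rewrite /siegel_num big_nil mulr1 muln0 s1.
rewrite /siegel_num big_nat_recr //= mulrA -/(siegel_num n c).
rewrite size_mul ?siegel_num_neq0 -?size_poly_gt0 ?s2 // IH.
by rewrite mulnS addnC.
Qed.

(** A degree count: the Siegel series has degree at most 2n + w, the linear factor at most 1 - w,
    and [siegel_num] exactly 2n + 1, so P is constant. The constant is 1 because only A = 0 has v =
    0. *)
Lemma siegel_poly_eq1 n p w (T : 'M[rat]_(2 * n)) (P : {poly int}) (G : 'M[int]_(2 * n)) :
  prime p -> odd p -> (w <= 1)%N -> half_integral T -> map_mx intr G = 2 *: T ->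
  ~~ ((p ^ w.+1)%N %| \det G)%Z -> (w = 1%N -> kronecker (fundT T) p = 0) ->
  is_siegel_poly R p T P -> map_poly intr P = 1 :> {poly Cx R}.
Proof.
move=> p_pr podd w1 hT GT ndv kr0 HP.
have symT : T^T = T by case/and3P: hT => /eqP.
have symG : G^T = G.
  apply/matrixP=> i j; apply: (@intr_inj rat).
  by move/matrixP: GT => GT; have := GT i j; have := GT j i; rewrite !mxE => -> ->;
    rewrite -{1}symT mxE.
have s0 m : (2 * n + w < m)%N -> siegel_series R p T m = 0.
  move=> mN; pose M := m.+3; have M1 : (1 < M)%N by []. have M0 : (0 < M)%N by [].
  rewrite (siegel_series_coef R p_pr M1); last by rewrite /M; lia.
  pose h : 'Z_(p ^ M) := 2^-1.
  have h2 : 2 * h = 1 by rewrite mulrV // Zq_unit_coprime // coprimen2.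
  rewrite (eq_bigr (mxchar (@Zq_expi R p M) h (map_mx intr G))) => [|A /andP[/eqP symA _]].
    apply: (@mxchar_coef_eq0 p M p_pr M1 _ _ _ _ _ h2 _ w) => //.
    - exact: Zq_expiD.
    - exact: Zq_expi_eq1.
    - by rewrite map_trmx symG.
    - case=> y; rewrite det_map_mx /= => E; case/negP: ndv.
      have : (((\det G - (p ^ w.+1)%:Z * (y : nat)%:Z)%:~R : 'Z_(p ^ M)) == 0).
        by rewrite rmorphB rmorphM /= E Zq_intrK -pmulrn subrr.
      rewrite (Zq_intr_eq0 p_pr M1) => dv.
      have dv2 : ((p ^ w.+1)%N %| \det G - (p ^ w.+1)%:Z * (y : nat)%:Z)%Z.
        by apply: dvdz_trans dv; rewrite dvdzE /= dvdn_exp2l // /M; lia.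
      by rewrite -(subrK ((p ^ w.+1)%:Z * (y : nat)%:Z) (\det G)) rpredD // dvdz_mulr.
  exact: siegel_char_mxchar.
pose b : {poly Cx R} := \poly_(m < (2 * n + w).+1) siegel_series R p T m.
have bE m : b`_m = siegel_series R p T m.
  by rewrite coef_poly ltnS; case: leqP => // /s0 ->.
set L := 1 - ((kronecker (fundT T) p)%:~R * p%:R ^+ n) *: 'X : {poly Cx R}.
have LbE : L * b = siegel_num n (p%:R : Cx R) * map_poly intr P.
  apply/polyP=> m; rewrite -(HP m) coefM; apply: eq_bigr => i _.
  by rewrite bE.
have pn0 : (p%:R : Cx R) != 0 by rewrite pnatr_eq0 -lt0n prime_gt0.
have sL : (size L <= 2 - w)%N.
  case: (posnP w) => [->|w0].
    rewrite (leq_trans (size_polyD _ _)) // size_poly1 size_polyN geq_max /=.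
    by rewrite (leq_trans (size_scale_leq _ _)) // size_polyX.
  have wE : w = 1%N by lia.
  by rewrite /L kr0 // mul0r scale0r subr0 size_poly1 wE.
have sb : (size b <= (2 * n + w).+1)%N by apply: size_poly.
have P0 : map_poly intr P != 0 :> {poly Cx R} -> (size (map_poly intr P : {poly Cx R}) <= 1)%N.
  move=> Pn0; have := size_polyMleq L b; rewrite LbE size_mul ?siegel_num_neq0 //.
  rewrite size_siegel_num // => h; have h2 : (size L + size b <= 2 - w + (2 * n + w).+1)%N.
    exact: leq_add.
  move: h h2 w1; clear; move: (size L) (size b) (size (map_poly _ _)) => x y s.
  by lia.
have sP : (size (map_poly intr P : {poly Cx R}) <= 1)%N.
  by case: (eqVneq (map_poly intr P : {poly Cx R}) 0) => [->|/P0//]; rewrite size_poly0.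
rewrite (size1_polyC sP) -polyC1; congr (_%:P).
have /(congr1 (fun g : {poly Cx R} => g`_0)) := LbE.
rewrite (coef0M L) (coef0M (siegel_num _ _)) siegel_num_coef0 mul1r => <-.
rewrite bE coefB coef1 coefZ coefX /= mulr0 subr0 mul1r.
rewrite (siegel_series_coef R p_pr (isT : 1 < 2)%N) // (bigD1 0) /=; last first.
  by rewrite trmx0 vz0 !eqxx.
rewrite siegel_char0 big1 ?addr0 // => A /andP[/andP[/eqP symA /eqP vA] A0].
by rewrite (vz_eq0 p_pr (isT : 1 < 2)%N symA vA) eqxx in A0.
Qed.

End SiegelPolynomials.

(** * Fundamental discriminants and conductors *)

Section Conductor.

Lemma squarefree_dvd_sq m y : squarefree m -> (y ^ 2 %| m)%N -> y = 1%N.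
Proof.
case/andP=> m0 /allP sq dv.
have y0 : (0 < y)%N by case: (posnP y) dv => // ->; rewrite dvd0n; case: m m0 {sq}.
apply/eqP; rewrite eqn_leq y0 andbT leqNgt; apply/negP => y1.
pose r := pdiv y; have r_pr : prime r by apply: pdiv_prime.
have r2 : (r ^ 2 %| m)%N by apply: dvdn_trans dv; rewrite dvdn_exp2r // pdiv_dvd.
have rm : r \in primes m.
  by rewrite mem_primes r_pr m0 (dvdn_trans _ r2) // dvdn_exp.
by have := sq r rm; rewrite leqNgt -pfactor_dvdn // r2.
Qed.

Lemma fundamental_disc_neq0 d : fundamental_disc d -> d != 0.
Proof. by apply: contraTneq => ->. Qed.

Lemma fundamental_disc_mod4 d : fundamental_disc d -> (d %% 4)%Z \in [:: 0; 1].
Proof.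
case/orP=> [/andP[/eqP -> _] //|/and3P[d4 _ _]].
by rewrite (dvdz_mod0P d4).
Qed.

Lemma fundamental_disc_dvd_sq d y : fundamental_disc d -> ((y ^ 2)%N %| d)%Z ->
  y = 1%N \/ y = 2%N /\ exists2 m, d = 4 * m & (m %% 4)%Z \in [:: 2; 3].
Proof.
case/orP=> [/andP[_ sq] dv|/and3P[/dvdzP[m dE] m4 sq] dv].
  by left; apply: squarefree_dvd_sq sq _; rewrite dvdzE in dv.
have dm : (d %/ 4)%Z = m by rewrite dE mulzK.
rewrite dm in m4 sq.
have dv' : (y ^ 2 %| `|m| * 4)%N by move: dv; rewrite dvdzE dE abszM.
have [oy|ey] := boolP (odd y).
  left; apply: squarefree_dvd_sq sq _; move: dv'; rewrite Gauss_dvdl //.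
  change (coprime (y ^ 2) (2 ^ 2)).
  by rewrite coprimeXl // coprimeXr // coprimen2.
right; have yE : y = (y./2 * 2)%N by rewrite muln2 even_halfK.
have : (y./2 ^ 2 %| `|m|)%N.
  by move: dv'; rewrite {1}yE expnMn dvdn_pmul2r.
move/(squarefree_dvd_sq sq) => h; rewrite h in yE; split; first exact: yE.
by exists m => //; rewrite mulrC.
Qed.

(** After division by the gcd, x^2 divides d' and y^2 divides d, so x and y are 1 or 2. If y = 2 and
    x = 1, then d = 4m and d' = m with m = 2 or 3 modulo 4, which is no discriminant. *)
Lemma fundamental_disc_uniq d d' f f' : fundamental_disc d -> fundamental_disc d' ->
  (0 < f)%N -> (0 < f')%N -> d * (f ^ 2)%N%:Z = d' * (f' ^ 2)%N%:Z -> f = f'.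
Proof.
move=> Fd Fd' f0 f'0 E.
wlog suff W : d d' f f' Fd Fd' f0 f'0 E / forall x y, coprime x y ->
    d * (x ^ 2)%N%:Z = d' * (y ^ 2)%N%:Z -> ((x ^ 2)%N %| d')%Z -> ((y ^ 2)%N %| d)%Z -> y = 2%N -> False.
  pose g := gcdn f f'; have g0 : (0 < g)%N by rewrite gcdn_gt0 f0.
  pose x := (f %/ g)%N; pose y := (f' %/ g)%N.
  have fx : f = (x * g)%N by rewrite divnK // dvdn_gcdl.
  have fy : f' = (y * g)%N by rewrite divnK // dvdn_gcdr.
  have cxy : coprime x y.
    by rewrite /coprime -(eqn_pmul2r g0) muln_gcdl -fx -fy mul1n.
  have Exy : d * (x ^ 2)%N%:Z = d' * (y ^ 2)%N%:Z.
    have gz : ((g ^ 2)%N%:Z : int) != 0 by rewrite eqz_nat -lt0n expn_gt0 g0.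
    by apply: (mulIf gz); rewrite -!mulrA -!PoszM -!expnMn -fx -fy.
  have dx : ((x ^ 2)%N %| d')%Z.
    rewrite -(Gauss_dvdzl _ (_ : coprimez (x ^ 2)%N (y ^ 2)%N)) -?Exy ?dvdz_mull //.
    by rewrite coprimezE coprimeXl // coprimeXr.
  have dy : ((y ^ 2)%N %| d)%Z.
    rewrite -(Gauss_dvdzl _ (_ : coprimez (y ^ 2)%N (x ^ 2)%N)) ?Exy ?dvdz_mull //.
    by rewrite coprimezE coprimeXl // coprimeXr // coprime_sym.
  rewrite fx fy.
  have [->|[x2 _]] := fundamental_disc_dvd_sq Fd' dx; last first.
    by case: (W _ _ _ _ Fd' Fd f'0 f0 (esym E) y x _ (esym Exy) dy dx x2); rewrite coprime_sym.
  have [->|[y2 _]] := fundamental_disc_dvd_sq Fd dy; first by [].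
  by case: (W _ _ _ _ Fd Fd' f0 f'0 E x y cxy Exy dx dy y2).
move=> x y cxy Exy dx dy y2; subst y.
have [x1|[x2 _]] := fundamental_disc_dvd_sq Fd' dx; last by rewrite x2 in cxy.
have [//|[_ [m dE m4]]] := fundamental_disc_dvd_sq Fd dy.
have d'E : d' = m.
  by move: Exy; rewrite x1 exp1n mulr1 dE -[(2 ^ 2)%N]/4%N; lia.
have := fundamental_disc_mod4 Fd'; rewrite d'E; move: m4; rewrite !inE.
by case/orP=> /eqP ->.
Qed.

Lemma conductor_uniq (D d : int) f : fundamental_disc d -> (0 < f)%N ->
  D = d * (f ^ 2)%N%:Z -> conductor D = f /\ (D %/ (conductor D ^ 2)%N)%Z = d.
Proof.
move=> Fd f0 DE; have d0 := fundamental_disc_neq0 Fd.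
have f2 : ((f ^ 2)%N%:Z : int) != 0 by rewrite eqz_nat -lt0n expn_gt0 f0.
suff cE : conductor D = f by rewrite cE; split=> //; rewrite DE mulzK.
rewrite /conductor; set s := [seq _ <- _ | _].
have fs : f \in s.
  rewrite mem_filter DE dvdz_mull ?mulzK // Fd /= mem_iota f0 add1n ltnS abszM.
  by rewrite /= -{1}(mul1n f) leq_mul ?absz_gt0 //= -{1}(expn1 f) leq_pexp2l.
(* The list contains f, so its head is a genuine element and not the default 1. *)
have : head 1%N s \in s by case: (s) fs => // x t _; rewrite mem_head.
rewrite mem_filter mem_iota => /andP[/andP[dv F] /andP[h0 _]].
apply: (fundamental_disc_uniq F Fd h0 f0).
by rewrite divzK.
Qed.

Lemma half_integral_double n (T : 'M[rat]_n) : half_integral T ->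
  exists G : 'M[int]_n, map_mx intr G = 2 *: T.
Proof.
case/and3P=> _ _ /forallP off; exists (map_mx Num.floor (2 *: T)).
apply/matrixP=> i j; rewrite !mxE; apply/eqP; rewrite -intrEfloor.
exact: (forallP (off i)).
Qed.

Lemma discTE n (T : 'M[rat]_(2 * n)) (G : 'M[int]_(2 * n)) :
  map_mx intr G = 2 *: T -> discT T = (-1) ^+ n * \det G.
Proof.
move=> GT; rewrite /discT -GT det_map_mx /=.
have -> : (-1) ^+ n * (\det G)%:~R = ((-1) ^+ n * \det G)%:~R :> rat.
  by rewrite rmorphM rmorphXn rmorphN1.
by rewrite numq_int.
Qed.

Lemma discT_scale n (T : 'M[rat]_(2 * n)) c : half_integral T ->
  discT (c%:R *: T) = discT T * (c ^ (2 * n))%N%:Z.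
Proof.
move=> /half_integral_double[G GT].
have cG : map_mx intr ((c%:Z) *: G) = 2 *: (c%:R *: T).
  by rewrite map_mxZ /= GT scalerA mulrC -scalerA.
by rewrite (discTE cG) (discTE GT) detZ -mulrA [_ * \det G]mulrC -[Posz (_ ^ _)]natz natrX natz.
Qed.

Lemma half_integral_scale n (T : 'M[rat]_n) c : half_integral T -> half_integral (c%:R *: T).
Proof.
case/and3P=> /eqP symT /forallP dg /forallP off; apply/and3P; split.
- by rewrite linearZ /= symT.
- by apply/forallP => i; rewrite mxE rpredM ?rpred_nat.
- apply/forallP => i; apply/forallP => j; rewrite mxE mulrCA rpredM ?rpred_nat //.
  exact: (forallP (off i)).
Qed.

Lemma posdef_scale n (T : 'M[rat]_n) c : (0 < c)%N -> posdef T -> posdef (c%:R *: T).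
Proof.
move=> c0 [symT pos]; split; first by rewrite linearZ /= symT.
move=> x x0; rewrite -scalemxAr -scalemxAl mxE mulr_gt0 ?ltr0n //.
exact: pos.
Qed.

(** In size 2n the determinant scales by the square of p^(ni), which goes entirely into the
    conductor. *)
Lemma cond_fund_scale n (T : 'M[rat]_(2 * n)) d f p i : half_integral T -> prime p ->
  fundamental_disc d -> (0 < f)%N -> discT T = d * (f ^ 2)%N%:Z ->
  condT ((p ^ i)%:R *: T) = (p ^ (n * i) * f)%N /\ fundT ((p ^ i)%:R *: T) = d.
Proof.
move=> hT p_pr Fd f0 DE; rewrite /fundT /condT.
apply: conductor_uniq => //; first by rewrite muln_gt0 expn_gt0 prime_gt0.
rewrite discT_scale // DE -mulrA -PoszM; congr (_ * Posz _).
by rewrite expnMn -!expnM mulnC; congr (_ * _)%N; congr expn; ring.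
Qed.

(** The odd prime p divides det(2T) as often as it divides d, hence at most once; if it does divide
    d, the Kronecker symbol vanishes. *)
Lemma siegel_poly_eq1_conductor (R : realType) n p (T : 'M[rat]_(2 * n)) d f (P : {poly int}) :
  prime p -> (2 < p)%N -> half_integral T -> fundamental_disc d -> (0 < f)%N ->
  discT T = d * (f ^ 2)%N%:Z -> coprime p f ->
  is_siegel_poly R p T P -> map_poly intr P = 1 :> {poly Cx R}.
Proof.
move=> p_pr p2 hT Fd f0 DE cpf HP.
have [G GT] := half_integral_double hT.
have fE : fundT T = d by rewrite /fundT /condT; have [] := conductor_uniq Fd f0 DE.
have podd : odd p by case/even_prime: (p_pr) => // pE; rewrite pE in p2.
have dvdE e : ((p ^ e)%N %| \det G)%Z = ((p ^ e)%N %| d)%Z.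
  have := discTE GT; rewrite DE => E.
  have -> : ((p ^ e)%N %| \det G)%Z = ((p ^ e)%N %| d * (f ^ 2)%N%:Z)%Z.
    by rewrite E -signr_odd !dvdzE abszMsign.
  by rewrite Gauss_dvdzl // coprimezE coprimeXl // coprimeXr.
have [pd|npd] := boolP ((p %| d)%Z).
  apply: (@siegel_poly_eq1 R n p 1 T P G) => //.
    rewrite dvdE; apply/negP => /(fundamental_disc_dvd_sq Fd)[p1|[pE _]].
      by rewrite p1 in p2.
    by rewrite pE in p2.
  move=> _; rewrite fE /kronecker primes_prime // big_seq1 logn_prime // eqxx expr1.
  by rewrite /kronecker_prime gtn_eqF // pd.
apply: (@siegel_poly_eq1 R n p 0 T P G) => //.
by rewrite dvdE expn1.
Qed.

End Conductor.

Import numFieldNormedType.Exports.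

(** * Absolute values and remainders of q-expansions *)

Section ComplexModulus.
Variable R : realType.
Implicit Types z w : Cx R.

(** The norm on [Cx R] takes its values in [Cx R]; estimates need a real number. *)
Definition nm z : R := complex.Re `|z|.

Lemma nmE z : `|z| = (nm z)%:C%C.
Proof. by rewrite /nm; case: z => a b; rewrite normc_def. Qed.

Lemma nm_def z : nm z = Num.sqrt (complex.Re z ^+ 2 + complex.Im z ^+ 2).
Proof. by rewrite /nm normc_def. Qed.

Lemma nm_ge0 z : 0 <= nm z.
Proof. by rewrite nm_def sqrtr_ge0. Qed.

Lemma nmM z w : nm (z * w) = nm z * nm w.
Proof. by apply: (@complexI R); rewrite rmorphM /= -!nmE normrM. Qed.

Lemma nm_real (x : R) : nm x%:C%C = `|x|.
Proof. by rewrite nm_def /= expr0n addr0 sqrtr_sqr. Qed.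

Lemma nm1 : nm 1 = 1.
Proof. by rewrite -[1]/(1%:C%C) nm_real normr1. Qed.

Lemma nm0 : nm 0 = 0.
Proof. by rewrite -[0]/(0%:C%C) nm_real normr0. Qed.

Lemma nm_natr n : nm n%:R = n%:R.
Proof. by rewrite -(rmorph_nat (real_complex R)) nm_real normr_nat. Qed.

Lemma nmX z n : nm (z ^+ n) = nm z ^+ n.
Proof. by elim: n => [|n IH]; rewrite ?expr0 ?nm1 // !exprS nmM IH. Qed.

Lemma nmV z : nm z^-1 = (nm z)^-1.
Proof. by apply: (@complexI R); rewrite fmorphV /= -!nmE normfV. Qed.

Lemma nm_eq0 z : (nm z == 0) = (z == 0).
Proof. by rewrite -(inj_eq (@complexI R)) -nmE normr_eq0. Qed.

Lemma nmN z : nm (- z) = nm z.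
Proof. by rewrite /nm normrN. Qed.

Lemma nm_triangle z w : nm (z + w) <= nm z + nm w.
Proof. by rewrite -lecR rmorphD /= -!nmE ler_normD. Qed.

Lemma nm_sum (I : Type) (r : seq I) (P : pred I) (F : I -> Cx R) :
  nm (\sum_(i <- r | P i) F i) <= \sum_(i <- r | P i) nm (F i).
Proof.
apply: (big_ind2 (fun x y => nm x <= y)) => // [|x1 x2 y1 y2 h1 h2]; first by rewrite nm0.
exact: le_trans (nm_triangle _ _) (lerD h1 h2).
Qed.

Lemma nm_expi z : nm (expi z) = expR (- (2 * pi * complex.Im z)).
Proof.
rewrite /expi nmM nm_real ger0_norm ?expR_ge0 // nm_def /=.
by rewrite cos2Dsin2 sqrtr1 mulr1.
Qed.

Lemma cvg_nm (u : nat -> Cx R) S : (u @ \oo --> S)%classic -> forall e : R, 0 < e ->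
  exists N, forall n, (N <= n)%N -> nm (S - u n) < e.
Proof.
move=> /cvgrPdist_lt h e e0.
have e0' : 0 < e%:C%C by rewrite ltcR.
have [N _ HN] := h _ e0'.
by exists N => n Nn; have := HN n Nn; rewrite /= nmE ltcR.
Qed.

Lemma series_tail_le (c : nat -> Cx R) S K (b : nat -> R) D :
  (series c @ \oo --> S)%classic -> (forall m, (K <= m)%N -> nm (c m) <= b m) ->
  (forall n, \sum_(K <= m < n) b m <= D) ->
  nm (S - \sum_(0 <= m < K) c m) <= D.
Proof.
move=> cS cb bD; apply/ler_addgt0Pr => e e0.
have [N HN] := cvg_nm cS e0.
have := HN (maxn N K) (leq_maxl _ _); rewrite seriesEnat /=.
rewrite (big_cat_nat (leq0n K) (leq_maxr N K)) /= => h.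
set x := \sum_(0 <= m < K) c m in h *; set y := \sum_(K <= m < _) c m in h.
have -> : S - x = (S - (x + y)) + y by rewrite opprD addrA subrK.
apply: (le_trans (nm_triangle _ _)); rewrite addrC lerD ?(ltW h) //.
rewrite (le_trans (nm_sum _ _ _)) // (le_trans _ (bD (maxn N K))) //.
by rewrite big_nat_cond [leRHS]big_nat_cond ler_sum // => i /andP[/andP[h1 _] _]; apply: cb.
Qed.

Lemma sum_geometric_le (r : R) K n : 0 <= r -> r <= 2^-1 ->
  \sum_(K <= m < n) r ^+ m <= 2 * r ^+ K.
Proof.
move=> r0 r2; have [nK|Kn] := leqP n K.
  by rewrite big_geq // mulr_ge0 ?exprn_ge0.
rewrite -(subnK (ltnW Kn)) -{1}(add0n K) big_addn addnK.
have -> : \sum_(0 <= i < n - K) r ^+ (i + K) = (\sum_(0 <= i < n - K) r ^+ i) * r ^+ K.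
  by rewrite mulr_suml; apply: eq_bigr => i _; rewrite exprD.
rewrite ler_wpM2r ?exprn_ge0 //.
have r1 : 0 < 1 - r by lra.
rewrite -(ler_pM2l r1) big_mkord.
have -> : (1 - r) * (\sum_(i < n - K) r ^+ i) = 1 - r ^+ (n - K).
  by rewrite -opprB mulNr -subrX1 opprB.
have : 0 <= r ^+ (n - K) by rewrite exprn_ge0.
lra.
Qed.

(** |q| at height y. *)
Definition q_upper (y : R) : R := expR (- (2 * pi * y)).

Lemma q_upper_gt0 y : 0 < q_upper y. Proof. exact: expR_gt0. Qed.

Lemma q_upperD x y : q_upper (x + y) = q_upper x * q_upper y.
Proof. by rewrite /q_upper mulrDr opprD expRD. Qed.

Lemma q_upper_nat n y : q_upper (n%:R * y) = q_upper y ^+ n.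
Proof. by rewrite /q_upper mulrCA -mulrN mulr_natl expRM_natl. Qed.

Lemma q_upper_le x y : x <= y -> q_upper y <= q_upper x.
Proof. by move=> xy; rewrite ler_expR lerN2 ler_wpM2l // mulr_ge0 ?pi_ge0. Qed.

Lemma q_upper_quarter : q_upper 4^-1 <= 2^-1.
Proof.
rewrite /q_upper expRN lef_pV2 ?posrE ?expR_gt0 //.
apply: (le_trans _ (expR_ge1Dx _)); have := pi_ge2 R; lra.
Qed.

Lemma nm_expi_nat m z : nm (expi (m%:R * z)) = q_upper (complex.Im z) ^+ m.
Proof. by rewrite expi_natmul nmX nm_expi. Qed.

Variables (f : Cx R -> Cx R) (a : nat -> Cx R).
Hypothesis fa : qexpansion f a.

(** The terms of the convergent series at the point iy tend to 0, so they are bounded. *)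
Lemma coef_bound y : 0 < y -> exists2 B, 0 <= B & forall m, nm (a m) * q_upper y ^+ m <= B.
Proof.
move=> y0; pose z : Cx R := (0 +i* y)%C.
pose c m := a m * expi (m%:R * z).
have cS : (series c @ \oo --> f z)%classic by apply: fa.
have c0 : (c @ \oo --> (0 : Cx R))%classic.
  exact: (@cvg_series_cvg_0 (Cx R) (Cx R) c (cvgP _ cS)).
have [N HN] := cvg_nm c0 ltr01.
exists (1 + \sum_(i < N) nm (c i)).
  by rewrite addr_ge0 // sumr_ge0 // => i _; apply: nm_ge0.
move=> m; have -> : nm (a m) * q_upper y ^+ m = nm (c m) by rewrite nmM nm_expi_nat.
have [mN|Nm] := ltnP m N.
  rewrite (bigD1 (Ordinal mN)) //= addrCA lerDl addr_ge0 ?sumr_ge0 // => i _.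
  exact: nm_ge0.
rewrite -[leLHS]addr0 lerD ?sumr_ge0 // => [|i _]; last exact: nm_ge0.
by rewrite ltW // -[c m]opprK -[- c m]add0r nmN HN.
Qed.

(** The coefficients are bounded through height 1/2. For Im z >= 3/4 the tail is then geometric with
    ratio |q| at a height of at least 1/4, which is at most 1/2. *)
Lemma qexp_remainder : exists2 B, 0 <= B & forall K z, 3 / 4 <= complex.Im z ->
  nm (f z - \sum_(0 <= m < K) a m * expi (m%:R * z)) <= B * q_upper (complex.Im z - 2^-1) ^+ K.
Proof.
have h2 : (0 : R) < 2^-1 by rewrite invr_gt0.
have [B B0 HB] := coef_bound h2.
exists (B * 2); first by rewrite mulr_ge0.
move=> K z hz; set y := complex.Im z in hz *.
have up : upper z by rewrite /upper -/y; lra.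
have r2 : q_upper (y - 2^-1) <= 2^-1.
  apply: le_trans q_upper_quarter; apply: q_upper_le; lra.
apply: (series_tail_le (b := fun m => B * q_upper (y - 2^-1) ^+ m)); first exact: fa.
  move=> m _; rewrite nmM nm_expi_nat -/y.
  have -> : q_upper y = q_upper 2^-1 * q_upper (y - 2^-1) by rewrite -q_upperD; congr q_upper; lra.
  rewrite exprMn mulrA; apply: ler_wpM2r; last exact: HB.
  by rewrite exprn_ge0 // ltW // q_upper_gt0.
move=> n; rewrite -mulr_sumr -mulrA ler_wpM2l // sum_geometric_le // ltW //.
exact: q_upper_gt0.
Qed.

End ComplexModulus.

(** * Boundedness of |f| y^w for a form of weight 2w *)

Section ModularHeight.
Variables (R : realType) (f : Cx R -> Cx R) (w : nat).
Implicit Types z : Cx R.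
Hypothesis fmod : forall g z, SL2Z g -> upper z -> f (mobius g z) = autfac g z ^+ (2 * w) * f z.

Definition mx2 (a b c d : int) : 'M[int]_2 :=
  \matrix_(i, j) if i == 0 then (if j == 0 then a else b) else (if j == 0 then c else d).

Lemma det_mx2 a b c d : \det (mx2 a b c d) = a * d - b * c.
Proof. by rewrite (expand_det_row _ ord0) !big_ord_recl big_ord0 /cofactor !det_mx11 !mxE /=; ring. Qed.

Lemma form_translate z (n : int) : upper z -> f (z + n%:~R) = f z.
Proof.
move=> uz; have S : SL2Z (mx2 1 n 0 1) by rewrite /SL2Z det_mx2 mul1r mulr0 subr0.
have := fmod S uz; rewrite /mobius /autfac !mxE /=.
by rewrite !rmorph1 rmorph0 mul0r add0r mul1r divr1 expr1n mul1r.
Qed.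

Lemma form_inversion z : upper z -> f (- z^-1) = z ^+ (2 * w) * f z.
Proof.
move=> uz; have S : SL2Z (mx2 0 (-1) 1 0) by rewrite /SL2Z det_mx2 mul0r sub0r mulN1r opprK.
have := fmod S uz; rewrite /mobius /autfac !mxE /=.
by rewrite rmorphN !rmorph1 rmorph0 mul0r add0r mul1r addr0 mulN1r.
Qed.

Definition height z : R := nm (f z) * complex.Im z ^+ w.

Lemma Im_inv z : complex.Im (- z^-1) = complex.Im z / nm z ^+ 2.
Proof.
case: z => x y; rewrite nm_def sqr_sqrtr ?addr_ge0 ?sqr_ge0 //=.
by rewrite opprK.
Qed.

Lemma height_inversion z : upper z -> height (- z^-1) = height z.
Proof.
move=> uz; rewrite /height form_inversion // Im_inv nmM nmX.
have z0 : nm z != 0.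
  by rewrite nm_eq0; apply: contraTneq uz => ->; rewrite /upper ltxx.
rewrite expr_div_n -exprM [nm z ^+ (2 * w) * _]mulrC -mulrA; congr (_ * _).
by rewrite mulrCA mulfV ?mulr1 // expf_neq0.
Qed.

Lemma height_translate z (n : int) : upper z -> height (z + n%:~R) = height z.
Proof.
move=> uz; rewrite /height form_translate //; congr (_ * _ ^+ _).
have -> : (n%:~R : Cx R) = (n%:~R : R)%:C%C by rewrite rmorph_int.
by case: z {uz} => x y /=; rewrite addr0.
Qed.

(** After translation to |Re z| <= 1/2, a point with Im z < 3/4 has |z|^2 <= 1/4 + 9/16 = 13/16, so
    inversion multiplies Im z by at least 16/13. Finitely many steps reach height 3/4. *)
Lemma height_contraction (C : R) :
  (forall z, 3 / 4 <= complex.Im z -> height z <= C) ->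
  forall z, upper z -> height z <= C.
Proof.
move=> HC z uz.
suff H N : forall z, upper z -> 3 / 4 * (13 / 16) ^+ N <= complex.Im z -> height z <= C.
  have := @cvg_expr R (13 / 16).
  have r1 : `|13 / 16 : R| < 1 by rewrite ger0_norm; lra.
  move=> /(_ r1) /cvgrPdist_lt /(_ (complex.Im z) uz) [N _ HN].
  apply: (H N z uz); have := HN N (leqnn N); rewrite /= sub0r normrN.
  have p0 : 0 <= (13 / 16 : R) ^+ N by rewrite exprn_ge0 //; lra.
  by rewrite ger0_norm // => h; lra.
elim: N => [|N IH] {}z {}uz; first by rewrite expr0 mulr1; apply: HC.
move=> hN.
pose n := Num.floor (complex.Re z + 2^-1).
pose z1 := z + (- n)%:~R.
have Im1 : complex.Im z1 = complex.Im z.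
  rewrite /z1; have -> : ((- n)%:~R : Cx R) = ((- n)%:~R : R)%:C%C by rewrite rmorph_int.
  by case: (z) => x y /=; rewrite addr0.
have Re1 : complex.Re z1 = complex.Re z - n%:~R.
  rewrite /z1; have -> : ((- n)%:~R : Cx R) = ((- n)%:~R : R)%:C%C by rewrite rmorph_int.
  by case: (z) => x y /=; rewrite rmorphN.
have uz1 : upper z1 by rewrite /upper Im1.
rewrite -(height_translate (- n) uz) -/z1.
have [big|small] := leP (3 / 4) (complex.Im z1); first exact: HC.
rewrite -(height_inversion uz1).
have := floor_itv (complex.Re z + 2^-1); rewrite -/n intrD => /andP[n1 n2].
have nz : nm z1 ^+ 2 <= 13 / 16.
  rewrite nm_def sqr_sqrtr ?addr_ge0 ?sqr_ge0 //.
  have : complex.Re z1 ^+ 2 <= 4^-1.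
    have -> : (4^-1 : R) = 2^-1 ^+ 2 by rewrite exprVn -natrX.
    rewrite -ler_sqrt ?sqr_ge0 // !sqrtr_sqr [leRHS]ger0_norm ?invr_ge0 //.
    by rewrite ler_norml Re1; apply/andP; split; lra.
  have : complex.Im z1 ^+ 2 <= 9 / 16.
    by rewrite expr2; have := uz1; rewrite /upper => u; nra.
  lra.
have nz0 : 0 < nm z1 ^+ 2.
  rewrite exprn_gt0 // lt0r nm_ge0 andbT nm_eq0.
  by apply: contraTneq uz1 => ->; rewrite /upper ltxx.
have Imi : 3 / 4 * (13 / 16) ^+ N <= complex.Im (- z1^-1).
  rewrite Im_inv ler_pdivlMr // Im1; apply: le_trans hN.
  by rewrite [(13 / 16) ^+ N.+1]exprSr [leRHS]mulrA; apply: ler_wpM2l => //;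
    rewrite mulr_ge0 ?exprn_ge0 //; lra.
apply: IH => //; rewrite /upper Im_inv divr_gt0 //.
Qed.

Variable a : nat -> Cx R.
Hypothesis fa : qexpansion f a.
Hypothesis a0 : a 0%N = 0.

(** As a_0 = 0, |f| is at most a constant times exp(-2 pi (y - 1/2)), which beats y^w <= w!
    exp(y). *)
Lemma height_bounded : exists2 C, 0 <= C & forall z, upper z -> height z <= C.
Proof.
have [B B0 HB] := qexp_remainder fa.
exists (B * (expR (2 * pi) * w`!%:R)); first by rewrite !mulr_ge0 ?expR_ge0.
apply: height_contraction => z hz; rewrite /height.
have := HB 1%N z hz; rewrite big_nat1 a0 mul0r subr0 expr1 => h.
set y := complex.Im z in hz h *; have y0 : 0 <= y by lra.
apply: (le_trans (ler_wpM2r (exprn_ge0 _ y0) h)).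
rewrite -mulrA ler_wpM2l //.
have yw : y ^+ w <= w`!%:R * expR y.
  case: w => [|v]; first by rewrite expr0 fact0 mul1r -expR0 ler_expR.
  rewrite mulrC -ler_pdivrMr ?ltr0n ?fact_gt0 //.
  by apply: le_trans (expR_ge1Dxn v y0); rewrite lerDr.
apply: (le_trans (ler_wpM2l (ltW (q_upper_gt0 _)) yw)).
rewrite mulrCA [leRHS]mulrC ler_wpM2l // /q_upper -expRD ler_expR.
by have := pi_ge2 R; move: (pi : R) => P hP; nra.
Qed.

End ModularHeight.

(** * First coefficients and size of Hecke eigenvalues *)

Section HeckeEigenvalues.
Variable R : realType.
Implicit Types (z : Cx R) (g : Cx R -> Cx R).

(** g = O(q^2) at i oo. Working modulo such functions isolates the first coefficient. *)
Definition second_order g := exists C Y : R, forall z, Y <= complex.Im z ->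
  nm (g z) <= C * q_upper (complex.Im z) ^+ 2.

Lemma second_orderD g1 g2 : second_order g1 -> second_order g2 ->
  second_order (fun z => g1 z + g2 z).
Proof.
move=> [C1 [Y1 h1]] [C2 [Y2 h2]]; exists (C1 + C2), (Num.max Y1 Y2) => z.
rewrite ge_max => /andP[y1 y2]; apply: (le_trans (nm_triangle _ _)).
by rewrite mulrDl lerD ?h1 ?h2.
Qed.

Lemma second_orderZ c g : second_order g -> second_order (fun z => c * g z).
Proof.
move=> [C [Y h]]; exists (nm c * C), Y => z yz.
by rewrite nmM -mulrA ler_wpM2l ?nm_ge0 ?h.
Qed.

Lemma second_order0 : second_order (fun _ => 0).
Proof. by exists 0, 0 => z _; rewrite nm0 mul0r. Qed.

Lemma second_order_sum (I : Type) (r : seq I) (G : I -> Cx R -> Cx R) :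
  (forall i, second_order (G i)) -> second_order (fun z => \sum_(i <- r) G i z).
Proof.
move=> h; elim: r => [|i r IH].
  by have [C [Y H]] := second_order0; exists C, Y => z /H; rewrite big_nil.
have [C [Y H]] := second_orderD (h i) IH.
by exists C, Y => z /H; rewrite big_cons.
Qed.

Lemma eq_second_order (Y0 : R) g1 g2 : (forall z, Y0 <= complex.Im z -> g1 z = g2 z) ->
  second_order g1 -> second_order g2.
Proof.
move=> E [C [Y h]]; exists C, (Num.max Y Y0) => z; rewrite ge_max => /andP[y1 y2].
by rewrite -E ?h.
Qed.

Lemma second_order_expi m : (2 <= m)%N -> second_order (fun z => expi (m%:R * z)).
Proof.
move=> m2; exists 1, 0 => z z0; rewrite nm_expi_nat mul1r.
rewrite ler_wiXn2l ?(ltW (q_upper_gt0 _)) //.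
by rewrite /q_upper -expR0 ler_expR oppr_le0 !mulr_ge0 ?pi_ge0.
Qed.

Lemma second_order_expi_eq0 c : second_order (fun z => c * expi z) -> c = 0.
Proof.
move=> [C [Y h]]; apply/eqP; rewrite -nm_eq0; apply/negPn/negP => c0.
have cp : 0 < nm c by rewrite lt0r c0 nm_ge0.
(* At this height |c| (1 + 2 pi y) exceeds |C|, which contradicts |c| exp(2 pi y) <= C. *)
pose y := Num.max (Num.max Y 0) (`|C| / nm c).
have yY : Y <= y by rewrite /y !le_max lexx.
have y0 : 0 <= y by rewrite /y !le_max lexx orbT.
have yC : `|C| / nm c <= y by rewrite /y !le_max lexx !orbT.
have := h (0 +i* y)%C yY; rewrite nmM nm_expi /= -/(q_upper y).
rewrite expr2 mulrA ler_pM2r ?q_upper_gt0 // => h2.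
have h3 : nm c * expR (2 * pi * y) <= C.
  have := ler_wpM2r (expR_ge0 (2 * pi * y)) h2.
  by rewrite -[X in _ <= X]mulrA /q_upper -expRD addNr expR0 mulr1.
have h4 : nm c * (1 + 2 * pi * y) <= C.
  apply: le_trans h3; rewrite ler_wpM2l ?nm_ge0 // addrC.
  by apply: le_trans (expR_ge1Dx _); rewrite addrC.
have h5 : `|C| <= nm c * y by rewrite -ler_pdivrMl // mulrC.
have h6 : C <= `|C| by apply: ler_norm.
have := pi_ge2 R; move: (pi : R) h4 => P h4 P2.
have : nm c * y <= nm c * (2 * P * y) by rewrite ler_wpM2l ?nm_ge0 //; nra.
by rewrite mulrDr mulr1 in h4; lra.
Qed.

Lemma sum_root_of_unity (d n : nat) : (0 < d)%N ->
  \sum_(b < d) expi (ratr (n%:R / d%:R) : Cx R) ^+ b = if (d %| n)%N then d%:R else 0.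
Proof.
move=> d0; have dr : (d%:R : rat) != 0 by rewrite pnatr_eq0 -lt0n.
case: ifP => dn.
  have -> : expi (ratr (n%:R / d%:R) : Cx R) = 1.
    apply: expi_ratr_int; case/dvdnP: dn => t ->.
    by rewrite natrM mulfK // rpred_nat.
  by under eq_bigr do rewrite expr1n; rewrite sumr_const card_ord.
set x := expi _.
have xd : x ^+ d = 1.
  rewrite /x -expi_natmul -(ratr_nat (Cx R)) -rmorphM /= mulrCA mulfV // mulr1.
  by rewrite expi_ratr_int // rpred_nat.
have x1 : x - 1 != 0.
  rewrite subr_eq0; apply/negP => /eqP/expi_ratr_eq1 /intrP[t tE].
  case/negP: (negbT dn).
  have E : (n%:Z = t * d%:Z)%R.
    by apply: (@intr_inj rat); rewrite intrM -tE mulfVK.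
  by rewrite -[(d %| n)%N]/((d%:Z %| n%:Z)%Z) E dvdz_mull.
by apply: (mulfI x1); rewrite -subrX1 xd subrr mulr0.
Qed.

Variables (f : Cx R -> Cx R) (a : nat -> Cx R).
Hypothesis fa : qexpansion f a.
Hypothesis a0 : a 0%N = 0.
Hypothesis a1 : a 1%N = 1.

Lemma q_upper_shift y K : q_upper (y - 2^-1) ^+ K = q_upper (- 2^-1 : R) ^+ K * q_upper y ^+ K.
Proof. by rewrite q_upperD mulrC exprMn. Qed.

Lemma form_first_order : second_order (fun z => f z - expi z).
Proof.
have [B B0 HB] := qexp_remainder fa.
exists (B * q_upper (- 2^-1) ^+ 2), (3 / 4) => z /(HB 2%N).
by rewrite unlock /= a0 a1 mul0r add0r !mul1r addr0 q_upper_shift mulrA.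
Qed.

(** Summing over b keeps the exponents divisible by d. Below 2d these are 0, where a_0 = 0, and d;
    the remainder from 2d on is O(q^(2e)). *)
Lemma sum_translates_second_order (d e : nat) : (0 < d)%N -> (0 < e)%N ->
  second_order (fun z => \sum_(b < d) f ((e%:R * z + b%:R) / d%:R)
     - d%:R * a d * expi (e%:R * z)).
Proof.
move=> d0 e0; have [B B0 HB] := qexp_remainder fa.
have dn : (d%:R : Cx R) != 0 by rewrite pnatr_eq0 -lt0n.
have dR : 0 < (d%:R : R) by rewrite ltr0n.
have eR : 1 <= (e%:R : R) by rewrite ler1n.
pose w z (b : 'I_d) : Cx R := (e%:R * z + b%:R) / d%:R.
have Imw z b : complex.Im (w z b) = e%:R * complex.Im z / d%:R.
  have -> : w z b = ((e%:R / d%:R)%:C)%C * z + ((b%:R / d%:R)%:C)%C.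
    by rewrite /w mulrDl !fmorph_div !rmorph_nat mulrAC.
  by case: z => x y /=; rewrite mul0r !addr0 mulrAC.
have main z : \sum_(b < d) \sum_(0 <= n < 2 * d) a n * expi (n%:R * w z b)
    = d%:R * a d * expi (e%:R * z).
  rewrite exchange_big /=.
  transitivity (\sum_(0 <= n < 2 * d) a n * expi (n%:R * (e%:R * z / d%:R))
      * (if (d %| n)%N then d%:R else 0)).
    apply: eq_bigr => n _; rewrite -sum_root_of_unity // mulr_sumr.
    apply: eq_bigr => b _; rewrite -mulrA -expi_natmul -expiD; congr (_ * expi _).
    have -> : (ratr (n%:R / d%:R) : Cx R) = n%:R / d%:R by rewrite fmorph_div /= !ratr_nat.
    by rewrite /w; field.
  have d2 : (d < 2 * d)%N by lia.
  rewrite big_mkord (bigD1 (Ordinal d2)) //=.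
  rewrite dvdnn big1 ?addr0 => [|[n nd] /= nE].
    rewrite mulrAC [a d * _]mulrC; congr (_ * expi _).
    by rewrite mulrC mulfVK.
  case: ifP => [/dvdnP[t tE]|]; last by rewrite mulr0.
  have t0 : t = 0%N.
    have t2 : (t < 2)%N by rewrite -(ltn_pmul2r d0) -tE.
    case: t t2 tE => [|[|t]] // _ tE.
    by case/negP: nE; rewrite -val_eqE /= tE mul1n.
  by rewrite tE t0 mul0n a0 !mul0r.
exists (d%:R * (B * q_upper (- 2^-1) ^+ (2 * d))), d%:R => z yz.
have y0 : 0 <= complex.Im z by apply: le_trans yz; rewrite ler0n.
rewrite -main -sumrB; apply: (le_trans (nm_sum _ _ _)).
have -> : d%:R * (B * q_upper (- 2^-1) ^+ (2 * d)) * q_upper (complex.Im z) ^+ 2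
  = \sum_(b < d) B * q_upper (- 2^-1) ^+ (2 * d) * q_upper (complex.Im z) ^+ 2.
  by rewrite sumr_const card_ord -mulrA mulr_natl.
apply: ler_sum => b _.
have yw : 3 / 4 <= complex.Im (w z b).
  rewrite Imw ler_pdivlMr //; move: (complex.Im z) yz y0 => y yz y0.
  by nra.
apply: (le_trans (HB _ _ yw)); rewrite q_upper_shift mulrA.
rewrite ler_wpM2l ?mulr_ge0 ?exprn_ge0 ?(ltW (q_upper_gt0 _)) //.
rewrite -!q_upper_nat q_upper_le // Imw natrM.
have -> : 2 * d%:R * (e%:R * complex.Im z / d%:R) = 2 * (e%:R * complex.Im z).
  by field; rewrite gt_eqF.
by rewrite ler_wpM2l // ler_peMl.
Qed.

(** Each d contributes d^(1-w) a_d q^(m/d) up to O(q^2), so only d = m reaches q, with m^(w-1)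
    m^(-w) m a_m = a_m. *)
Lemma hecke_first_order w m : (0 < m)%N -> (0 < w)%N ->
  second_order (fun z => hecke_op w m f z - a m * expi z).
Proof.
move=> m0 w0.
pose F d z := \sum_(b < d) f (((m %/ d)%:R * z + b%:R) / d%:R).
have sF d : second_order (fun z => if (d %| m)%N then
     d%:R ^- w * (F d z - (if d == m then m%:R * a m * expi z else 0)) else 0).
  have [dm|_] := boolP (d %| m)%N; last exact: second_order0.
  have d0 : (0 < d)%N by apply: dvdn_gt0 dm.
  have e0 : (0 < m %/ d)%N by rewrite divn_gt0 // dvdn_leq.
  apply: second_orderZ.
  have S := sum_translates_second_order d0 e0.
  have [dE|dE] := eqVneq d m.
    apply: eq_second_order 0 _ _ _ S => z _.
    by rewrite /F dE divnn m0 mul1r.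
  have e2 : (2 <= m %/ d)%N.
    rewrite ltn_neqAle e0 andbT eq_sym; apply/negP => /eqP E.
    by case/negP: dE; rewrite -{1}(mul1n d) -E divnK.
  have S2 := second_orderD S (second_orderZ (d%:R * a d) (second_order_expi e2)).
  by apply: eq_second_order 0 _ _ _ S2 => z _; rewrite subrK subr0.
have S := second_orderZ (m%:R ^+ w.-1) (second_order_sum (divisors m) sF).
apply: eq_second_order 0 _ _ _ S => z _.
have mn : (m%:R : Cx R) != 0 by rewrite pnatr_eq0 -lt0n.
rewrite /hecke_op big_seq_cond.
rewrite (eq_bigr (fun d => d%:R ^- w * F d z
   - (if d == m then d%:R ^- w * (m%:R * a m * expi z) else 0))) => [|d]; last first.
  rewrite andbT -dvdn_divisors // => ->; rewrite mulrBr; case: eqP => // _.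
  by rewrite mulr0.
rewrite -big_seq_cond sumrB mulrBr; congr (_ - _).
rewrite -big_mkcond /= -big_filter filter_pred1_uniq ?divisors_uniq ?divisors_id //.
rewrite big_seq1.
have -> : (m%:R ^- w : Cx R) = (m%:R * m%:R ^+ w.-1)^-1 by rewrite -exprS prednK.
by field; rewrite mn expf_neq0.
Qed.

Lemma hecke_eigenvalue w m lam : (0 < m)%N -> (0 < w)%N ->
  (forall z, upper z -> hecke_op w m f z = lam * f z) -> lam = a m.
Proof.
move=> m0 w0 h; apply/eqP; rewrite -subr_eq0; apply/eqP/second_order_expi_eq0.
have S1 := hecke_first_order m0 w0.
have S2 := second_orderD S1 (second_orderZ (- lam) form_first_order).
apply: eq_second_order 1 _ _ _ S2 => z z1.
by rewrite h; [ring|rewrite /upper (lt_le_trans ltr01)].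
Qed.

Variable k : nat.
Hypothesis k0 : (0 < k)%N.
Hypothesis fmod : forall (g : 'M[int]_2) z, SL2Z g -> upper z -> f (mobius g z) = autfac g z ^+ (2 * k) * f z.

(* Otherwise the Hecke operator contracts the supremum of the height, and f = 0. *)
Lemma hecke_height_le m lam : (0 < m)%N ->
  (forall z, upper z -> hecke_op (2 * k) m f z = lam * f z) ->
  nm lam <= m%:R ^+ k.-1 * (\sum_(d <- divisors m) d)%N%:R.
Proof.
move=> m0 h; set S := _ * _.
rewrite leNgt; apply/negP => SL.
have S0 : 0 <= S by rewrite mulr_ge0 ?exprn_ge0 ?ler0n.
have L0 : 0 < nm lam by apply: le_lt_trans SL.
have mR : (m%:R : R) != 0 by rewrite pnatr_eq0 -lt0n.
(* With e = m/d, the points (ez + b)/d have imaginary part ey/d, and (d/e)^k = d^(2k) m^(-k). After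
   the factor d^(-2k), the d summands together contribute at most C d m^(-k). *)
have step C : 0 <= C -> (forall z, upper z -> height f k z <= C) ->
    forall z, upper z -> height f k z <= S / nm lam * C.
  move=> C0 HC z uz; have yz : 0 < complex.Im z := uz.
  rewrite mulrAC ler_pdivlMr // /height mulrAC -nmM [f z * _]mulrC -h //.
  rewrite /hecke_op nmM nmX nm_natr -mulrA.
  have -> : S * C = m%:R ^+ (2 * k).-1 * (m%:R ^- k * (C * (\sum_(d <- divisors m) d)%N%:R)).
    have -> : (2 * k).-1 = (k + k.-1)%N by lia.
    by rewrite exprD /S; field; rewrite expf_neq0.
  rewrite ler_wpM2l ?exprn_ge0 ?ler0n // natr_sum !mulr_sumr.
  apply: (le_trans (ler_wpM2r _ (nm_sum _ _ _))); first by rewrite exprn_ge0 ?ltW.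
  rewrite mulr_suml big_seq_cond [leRHS]big_seq_cond.
  apply: ler_sum => d; rewrite andbT -dvdn_divisors // => dm.
  have d0 : (0 < d)%N by apply: dvdn_gt0 dm.
  have dR : 0 < (d%:R : R) by rewrite ltr0n.
  have e0 : (0 < m %/ d)%N by rewrite divn_gt0 // dvdn_leq.
  have mE : (m%:R : R) = (m %/ d)%:R * d%:R by rewrite -natrM divnK.
  have eR : 0 < ((m %/ d)%:R : R) by rewrite ltr0n.
  have fb (b : 'I_d) : nm (f (((m %/ d)%:R * z + b%:R) / d%:R)) * complex.Im z ^+ k
      <= C * (d%:R ^+ k / (m %/ d)%:R ^+ k).
    set w := (X in f X).
    have Imw : complex.Im w = (m %/ d)%:R * complex.Im z / d%:R.
      have -> : w = (((m %/ d)%:R / d%:R)%:C)%C * z + ((b%:R / d%:R)%:C)%C.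
        by rewrite /w mulrDl !fmorph_div !rmorph_nat mulrAC.
      by case: (z) => x y /=; rewrite mul0r !addr0 mulrAC.
    have uw : upper w by rewrite /upper Imw divr_gt0 // mulr_gt0.
    have := HC w uw; rewrite /height Imw expr_div_n exprMn => hw.
    rewrite mulrA ler_pdivlMr ?exprn_gt0 // -ler_pdivrMr ?exprn_gt0 //.
    apply: le_trans hw; rewrite le_eqVlt; apply/orP; left; apply/eqP.
    by field; rewrite expf_neq0 // gt_eqF.
  rewrite nmM nmV nmX nm_natr -mulrA.
  have -> : m%:R ^- k * (C * d%:R)
     = d%:R ^- (2 * k) * (d%:R * (C * (d%:R ^+ k / (m %/ d)%:R ^+ k))).
    rewrite mE exprMn mul2n -addnn exprD.
    by field; rewrite !expf_neq0 ?gt_eqF.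
  rewrite ler_wpM2l ?invr_ge0 ?exprn_ge0 ?ler0n //.
  apply: (le_trans (ler_wpM2r _ (nm_sum _ _ _))); first by rewrite exprn_ge0 ?ltW.
  rewrite mulr_suml; set D := C * _.
  have -> : d%:R * D = \sum_(b < d) D by rewrite sumr_const card_ord mulr_natl.
  by apply: ler_sum => b _; apply: fb.
have [C C0 HC] := height_bounded fmod fa a0.
have rho1 : `|S / nm lam| < 1.
  by rewrite ger0_norm ?divr_ge0 ?(ltW L0) // ltr_pdivrMr // mul1r.
have iter j : forall z, upper z -> height f k z <= (S / nm lam) ^+ j * C.
  elim: j => [|j IH]; first by rewrite expr0 mul1r.
  rewrite exprS -mulrA; apply: step => //.
  by rewrite mulr_ge0 ?exprn_ge0 ?divr_ge0 ?(ltW L0).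
have fz z : upper z -> f z = 0.
  move=> uz; apply/eqP; rewrite -nm_eq0.
  have yk : 0 < complex.Im z ^+ k by rewrite exprn_gt0.
  rewrite -(mulIr_eq0 _ (mulIf (lt0r_neq0 yk))) eq_le mulr_ge0 ?nm_ge0 ?(ltW yk) // andbT.
  apply/ler_addgt0Pr => e e0; rewrite add0r.
  have e1 : 0 < e / (C + 1) by rewrite divr_gt0 // ltr_wpDl.
  have := cvg_expr rho1; move/cvgrPdist_lt => /(_ _ e1) [N _ HN].
  have := HN N (leqnn N); rewrite /= sub0r normrN => hN.
  apply: (le_trans (iter N z uz)).
  have : (S / nm lam) ^+ N <= e / (C + 1) by apply: le_trans (ler_norm _) (ltW hN).
  rewrite ler_pdivlMr ?ltr_wpDl // => hh; apply: le_trans hh.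
  by rewrite ler_wpM2l ?exprn_ge0 ?divr_ge0 ?(ltW L0) // lerDl.
have S1 : second_order (fun z => (-1) * expi z).
  apply: eq_second_order 1 _ _ _ form_first_order => z z1.
  by rewrite fz ?sub0r ?mulN1r // /upper (lt_le_trans ltr01).
by have /eqP := second_order_expi_eq0 S1; rewrite oppr_eq0 oner_eq0.
Qed.

End HeckeEigenvalues.

(** * The modulus of the ordinary root *)

Section OrdinaryRoot.
Variables (R : realType) (k : nat) (f : Cx R -> Cx R) (a : nat -> Cx R).
Hypothesis k0 : (0 < k)%N.
Hypothesis hf : normalized_eigenform (2 * k) f a.

Lemma eigenform_coef_le m : (0 < m)%N ->
  nm (a m) <= m%:R ^+ k.-1 * (\sum_(d <- divisors m) d)%N%:R.
Proof.
move=> m0; have [[_ fmod fa a0] a1 eig] := hf.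
have [lam hlam] := eig m m0.
have w0 : (0 < 2 * k)%N by rewrite muln_gt0.
rewrite -(hecke_eigenvalue fa a0 a1 m0 w0 hlam).
exact: (hecke_height_le fa a0 a1 k0 fmod m0 hlam).
Qed.

(** Turns the bound of a_m in weight 2 by the divisor sum, itself at most m^2, into a geometric
    majorant. *)
Lemma sqr_le_expn4 m : (m.+1 ^ 2 <= 4 ^ m)%N.
Proof.
elim: m => // m; rewrite (expnS 4) => IH.
apply: (@leq_trans (4 * m.+1 ^ 2)); last by rewrite leq_mul2l.
by rewrite -[4%N]/(2 ^ 2)%N -expnMn leq_exp2r; lia.
Qed.

Lemma sum_divisors_le m : (\sum_(d <- divisors m.+1) d <= m.+1 ^ 2)%N.
Proof.
have E : perm_eq (divisors m.+1) [seq d <- index_iota 1 m.+2 | (d %| m.+1)%N].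
  apply: uniq_perm; rewrite ?divisors_uniq ?filter_uniq ?iota_uniq // => d.
  rewrite -dvdn_divisors // mem_filter mem_index_iota.
  case: (boolP (d %| m.+1)%N) => //= dm.
  by rewrite (dvdn_gt0 _ dm) // ltnS (dvdn_leq _ dm).
rewrite (perm_big _ E) big_filter /= expnS expn1.
apply: (@leq_trans (\sum_(1 <= d < m.+2) m.+1)); last first.
  by rewrite sum_nat_const_nat subn1.
rewrite big_mkcond big_nat_cond [X in (_ <= X)%N]big_nat_cond.
by apply: leq_sum => d /andP[/andP[_ dm] _]; case: ifP.
Qed.

Lemma sum_divisors_prime p : prime p -> (\sum_(d <- divisors p) d)%N = p.+1.
Proof.
move=> pp; have E : perm_eq (divisors p) [:: 1; p]%N.
  apply: uniq_perm; rewrite ?divisors_uniq //= ?inE ?andbT.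
    by rewrite eq_sym gtn_eqF ?prime_gt1.
  move=> d; rewrite -dvdn_divisors ?prime_gt0 // !inE.
  apply/idP/idP; first by have [_] := primeP pp; apply.
  by case/orP => /eqP ->; rewrite ?dvd1n.
by rewrite (perm_big _ E) /= big_cons big_seq1 add1n.
Qed.

(* In weight 2 the form vanishes at i, although its first term dominates there. *)
Lemma eigenform_weight_gt2 : (1 < k)%N.
Proof.
rewrite ltn_neqAle k0 andbT; apply/negP => /eqP k1.
have [[_ fmod fa a0] a1 _] := hf; rewrite -k1 in fmod.
pose i : Cx R := (0 +i* 1)%C.
have ui : upper i by rewrite /upper ltr01.
have i2 : i ^+ 2 = -1 by rewrite expr2; apply/eqP; rewrite eq_complex /=; apply/andP; split; apply/eqP; ring.
have fi : f i = 0.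
  have i0 : i != 0 by apply: contraTneq ui => ->; rewrite /upper ltxx.
  have := form_inversion fmod ui.
  have -> : - i^-1 = i by apply: (mulIf i0); rewrite mulNr mulVf // -expr2 i2.
  rewrite muln1 i2 mulN1r => /eqP.
  by rewrite -addr_eq0 -mulr2n mulrn_eq0 => /eqP.
pose r := q_upper (1 : R).
have r0 : 0 < r by apply: q_upper_gt0.
(* r is |q| at the point i; with r <= 1/16 the majorant has ratio 4r <= 1/4. *)
have r16 : r <= 1 / 16.
  rewrite /r; have -> : q_upper (1 : R) = q_upper 4^-1 ^+ 4 by rewrite -q_upper_nat mulfV.
  have := q_upper_quarter R; have := q_upper_gt0 (4^-1 : R); move: (q_upper _) => s s0 s2.
  have : s ^+ 2 <= 4^-1 by rewrite expr2; nra.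
  have : 0 <= s ^+ 2 by rewrite sqr_ge0.
  rewrite (exprD s 2 2); move: (s ^+ 2) => t t0 t4; nra.
have tail : nm (f i - \sum_(0 <= m < 2) a m * expi (m%:R * i)) <= 4^-1 * (2 * (4 * r) ^+ 2).
  apply: (series_tail_le (b := fun m => 4^-1 * (4 * r) ^+ m)) => [|[//|m] _|n].
  - exact: fa.
  - rewrite nmM nm_expi_nat -/r exprMn [4^-1 * _]mulrA [4 ^+ _]exprS mulKf //.
    apply: ler_wpM2r; first by rewrite exprn_ge0 // ltW.
    apply: (le_trans (eigenform_coef_le (ltn0Sn m))); rewrite -k1 expr0 mul1r -natrX ler_nat.
    apply: leq_trans (sqr_le_expn4 m).
    exact: sum_divisors_le.
  - by rewrite -mulr_sumr ler_wpM2l ?invr_ge0 // sum_geometric_le //; lra.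
(* Since f(i) = 0, the estimate reads r <= 8 r^2, which is impossible for 0 < r <= 1/16. *)
move: tail; rewrite big_nat_recl // big_nat1 a0 a1 fi mul0r !add0r !mul1r nmN nm_expi -/(q_upper _) -/r.
rewrite expr2; nra.
Qed.

(** |alpha| = 1 would give |beta| = p^(2k-1), but |beta| <= |a_p| + 1 <= p^(k-1)(p+1) + 1, which is
    smaller for k >= 2 and p >= 3. *)
Lemma ordinary_root_norm p al be : prime p -> (2 < p)%N -> al + be = a p ->
  al * be = p%:R ^+ (2 * k).-1 -> nm al != 1.
Proof.
move=> pp p2 sum_ab prod_ab; apply/negP => /eqP al1.
have k2 := eigenform_weight_gt2.
have p0 : (0 < p)%N by lia.
have nbe : nm be = p%:R ^+ (2 * k).-1 by rewrite -nm_natr -nmX -prod_ab nmM al1 mul1r.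
have le1 : nm be <= nm (a p) + 1.
  by have := nm_triangle (a p) (- al); rewrite -sum_ab addrAC subrr add0r nmN al1.
have := le_trans le1 (lerD (eigenform_coef_le p0) (lexx 1)).
rewrite nbe sum_divisors_prime // -!natrX -natrM natr1 ler_nat.
have [j ->] : exists j, k = j.+2 by exists k.-2; lia.
have -> : ((2 * j.+2).-1 = j + j.+2.+1)%N by lia.
rewrite expnD !expnS /=; have : (0 < p ^ j)%N by rewrite expn_gt0 p0.
by move: (p ^ j)%N => q; nia.
Qed.

End OrdinaryRoot.

(** * Recurrences with rescaled roots *)

Section RecurrenceRescaling.
Variable A : comNzRingType.

Lemma recact_scale_roots m (l : 'I_m -> A) c (g : nat -> A) :
  recact (\prod_(i < m) ('X - (c * l i)%:P)) (fun j => c ^+ j * g j)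
  = c ^+ m * recact (\prod_(i < m) ('X - (l i)%:P)) g.
Proof.
elim: m l g => [|m IH] l g.
  by rewrite !big_ord0 -polyC1 !recactC expr0 !mul1r.
rewrite !big_ord_recr /= !recactM exprSr -mulrA.
have step x (u : nat -> A) i : recact ('X - x%:P) (fun j => u (i + j)%N) = u i.+1 - x * u i.
  rewrite recactD -polyCN recactC -[X in recact X _]mul1r recact_mulX -polyC1 recactC.
  by rewrite mul1r addn1 addn0 mulNr.
rewrite -[c * recact _ _]recactZu -(IH (fun i => l (widen_ord (leqnSn m) i))).
apply: eq_recact => i; rewrite (step _ (fun j => c ^+ j * g j)) (step _ g) exprS.
by ring.
Qed.

(** The hypothesis makes Q(E) g a constant sequence up to den. After rescaling it becomes geometric
    with ratio c, on which the remaining factor P acts as P(c). *)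
Lemma recact_constant_factor (P : {poly A}) (den kap c : A) m (l : 'I_m -> A) (g : nat -> A) :
  let Q := \prod_(i < m) ('X - (l i)%:P) in
  (forall i, den * recact Q (fun j => g (i + j)%N) = kap * Q.[1]) ->
  den * recact (P * \prod_(i < m) ('X - (c * l i)%:P)) (fun j => c ^+ j * g j)
  = kap * (P * \prod_(i < m) ('X - (c * l i)%:P)).[c].
Proof.
move=> Q H; rewrite recactM.
have Qc : (\prod_(i < m) ('X - (c * l i)%:P)).[c] = c ^+ m * Q.[1].
  have -> : c ^+ m = \prod_(i < m) c by rewrite prodr_const card_ord.
  rewrite /Q !horner_prod -big_split.
  by apply: eq_bigr => i _; rewrite /= !hornerXsubC mulrBr mulr1.
rewrite (eq_recact _ (u' := fun i => c ^+ i * (c ^+ m * recact Q (fun j => g (i + j)%N)))); last first.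
  move=> i; rewrite /= -recact_scale_roots -recactZu; apply: eq_recact => j.
  by rewrite exprD mulrA.
rewrite -recactZu (eq_recact _ (u' := fun i => (kap * (c ^+ m * Q.[1])) * c ^+ i)); last first.
  by move=> i; rewrite mulrCA [den * (_ * _)]mulrCA H; ring.
by rewrite recactZu recact_geom hornerM Qc; ring.
Qed.

End RecurrenceRescaling.

(** * The roots of Phi and the value of Psi *)

Section PhiFactorization.
Variables (R : realType) (n k p : nat) (al be : Cx R).
Hypothesis p_pr : prime p.
Hypothesis n0 : (0 < n)%N.
Hypothesis k0 : (0 < k)%N.
Hypothesis prod_ab : al * be = p%:R ^+ (2 * k).-1.
Hypothesis al_indep : forall d i j : nat, al ^+ d * p%:R ^+ i = p%:R ^+ j -> d = 0%N.

Local Notation P := (p%:R : Cx R).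
Local Notation X0 := (be * P ^- (k + n)).
Implicit Types I : {set 'I_(2 * n)}.

Lemma satake_P_neq0 : P != 0.
Proof. by rewrite pnatr_eq0 -lt0n prime_gt0. Qed.

Lemma satake_neq0 : al != 0 /\ be != 0.
Proof.
have : al * be != 0 by rewrite prod_ab expf_neq0 // satake_P_neq0.
by rewrite mulf_eq0 negb_or => /andP[].
Qed.

Definition satake I : Cx R := psi0 R n k p * \prod_(i in I) psi n k p al be i.+1.

(* I_j = {1..n} U {2n-j+1..2n} for j <= n and {j-n+1..2n} for j >= n, with the
   elements 1..2n numbered from 0; the product of psi0 and of the psi_i over
   I_j is the j-th root of the recurrence times alpha^n. *)
Definition satake_index j : {set 'I_(2 * n)} :=
  [set i : 'I_(2 * n) | ((i < n) || (2 * n <= i + j))%N && (j <= i + n)%N].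

Lemma satake_index_neq j j' : (j < j' <= 2 * n)%N -> satake_index j != satake_index j'.
Proof.
move=> /andP[jj jn]; apply/eqP => /setP E.
have [h|h] := leqP j' n.
  have i_lt : (2 * n - j' < 2 * n)%N by lia.
  by have := E (Ordinal i_lt); rewrite !inE /=; lia.
have i_lt : (j' - n.+1 < 2 * n)%N by lia.
by have := E (Ordinal i_lt); rewrite !inE /=; lia.
Qed.

Lemma satake_index_neq0 j : (j <= 2 * n)%N -> satake_index j != finset.set0.
Proof.
move=> jn; apply/set0Pn; have [h|h] := ltnP j (2 * n).
  have i_lt : (j - n < 2 * n)%N by lia.
  by exists (Ordinal i_lt); rewrite !inE /=; lia.
have i_lt : (n < 2 * n)%N by lia.
by exists (Ordinal i_lt); rewrite !inE /=; lia.
Qed.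

Lemma card_satake_index0 : #|satake_index 0| = n.
Proof.
rewrite -sum1_card -[RHS]card_ord -sum1_card (big_ord_widen (2 * n) (fun=> 1%N)) ?leq_pmull //.
by apply: eq_bigl => i; rewrite inE; have := ltn_ord i; lia.
Qed.

Lemma prod_pexp m : \prod_(i < m) P ^ (- k%:Z + i.+1%:Z) = P ^ ('C(m.+1, 2)%:Z - (m * k)%:Z).
Proof.
elim: m => [|m IH]; first by rewrite big_ord0 mul0n subr0.
rewrite big_ord_recr /= IH -expfzDr ?satake_P_neq0 //; congr (_ ^ _).
by rewrite ['C(m.+2, 2)]binS bin1; lia.
Qed.

Lemma satake_index0_val : satake (satake_index 0) = al ^+ n.
Proof.
rewrite /satake.
have -> : \prod_(i in satake_index 0) psi n k p al be i.+1
    = \prod_(i < n) (al * P ^ (- k%:Z + i.+1%:Z)).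
  rewrite (big_ord_widen (2 * n) (fun i => al * P ^ (- k%:Z + i.+1%:Z))) ?leq_pmull //.
  apply: eq_big => i; first by rewrite inE; have := ltn_ord i; lia.
  by rewrite inE => h; rewrite /psi ifT //; have := ltn_ord i; lia.
rewrite big_split prodr_const card_ord /= mulrCA prod_pexp /psi0 -expfzDr ?satake_P_neq0 //.
have -> : 'C(n.+1, 2) = ((n * (n + 1)) %/ 2)%N by rewrite bin2 addn1 /= mulnC divn2.
by rewrite addrA subrK subrr expr0z mulr1.
Qed.

(** For j < n the step multiplies by a psi containing beta, afterwards it divides by one containing
    alpha; alpha beta = p^(2k-1) gives both ratios the same form. *)
Lemma satake_indexS j : (j < 2 * n)%N ->
  satake (satake_index j.+1) = satake (satake_index j) * (X0 * P ^+ (2 * n - j)).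
Proof.
move=> jn; have [al0 be0] := satake_neq0; have P0 := satake_P_neq0.
have [h|h] := ltnP j n.
  have i_lt : (2 * n - j.+1 < 2 * n)%N by lia.
  have -> : satake_index j.+1 = Ordinal i_lt |: satake_index j.
    by apply/setP => i; rewrite !inE -val_eqE /=; lia.
  rewrite /satake big_setU1 /=; last by rewrite !inE /=; lia.
  rewrite mulrCA mulrC; congr (_ * _).
  rewrite /psi ifF -?mulrA; last by lia.
  congr (_ * _); rewrite exprnN exprnP -expfzDr //; congr (_ ^ _); lia.
have i_lt : (j - n < 2 * n)%N by lia.
have -> : satake_index j = Ordinal i_lt |: satake_index j.+1.
  by apply/setP => i; rewrite !inE -val_eqE /=; lia.
rewrite /satake big_setU1 /=; last by rewrite !inE /=; lia.
rewrite -mulrA; congr (_ * _); set Z := \prod_(i in _) _.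
rewrite mulrAC -[LHS]mul1r; congr (_ * _).
rewrite /psi ifT; last by lia.
have -> x y z : al * x * (be / y * z) = al * be * (x * y^-1 * z) by ring.
rewrite prod_ab exprnN !exprnP.
rewrite -!expfzDr //.
rewrite -[1](expr0z P); congr (_ ^ _); lia.
Qed.

Lemma satake_index_val j : (j <= 2 * n)%N ->
  satake (satake_index j) = al ^+ n * ((p ^ ('C(j.+1, 2) + j * (2 * n - j)))%:R * X0 ^+ j).
Proof.
elim: j => [|j IH] jn.
  by rewrite satake_index0_val bin_small // mul0n addn0 expr0 !mulr1.
rewrite satake_indexS // IH; last exact: ltnW.
set X := be / _; clearbody X.
have -> : ('C(j.+2, 2) + j.+1 * (2 * n - j.+1) = 'C(j.+1, 2) + j * (2 * n - j) + (2 * n - j))%N.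
  by rewrite binS bin1; nia.
set e := ('C(j.+1, 2) + _)%N.
have -> : (p ^ (e + (2 * n - j)))%:R = (p ^ e)%:R * P ^+ (2 * n - j).
  by rewrite expnD natrM -natrX.
by rewrite exprS; ring.
Qed.

(** The powers of p may have negative exponents, which x and y clear. *)
Lemma satake_shape I : exists x y : nat, satake I * P ^+ x = P ^+ y
   * al ^+ #|[set i in I | (i < n)%N]| * be ^+ #|[set i in I | (n <= i)%N]|.
Proof.
have P0 := satake_P_neq0.
have zprod (A : {set 'I_(2 * n)}) (e : 'I_(2 * n) -> int) : exists z : int, \prod_(i in A) P ^ e i = P ^ z.
  apply: (big_ind (fun x => exists z : int, x = P ^ z)) => [|x y [z1 ->] [z2 ->]|i _].
  - by exists 0; rewrite expr0z.
  - by exists (z1 + z2); rewrite expfzDr.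
  - by exists (e i).
have [z1 E1] := zprod [set i in I | (i < n)%N] (fun i => - k%:Z + i.+1%:Z).
have [z2 E2] := zprod [set i in I | (n <= i)%N] (fun i => - k%:Z - n%:Z + i.+1%:Z).
pose z := (n * k)%:Z - ((n * (n + 1)) %/ 2)%:Z + z1 + z2.
have E : satake I = P ^ z * (al ^+ #|[set i in I | (i < n)%N]| * be ^+ #|[set i in I | (n <= i)%N]|).
  rewrite /satake (bigID (fun i : 'I_(2 * n) => (i < n)%N)) /=.
  have -> : \prod_(i in I | (i < n)%N) psi n k p al be i.+1 = al ^+ #|[set i in I | (i < n)%N]| * P ^ z1.
    rewrite -E1 -prodr_const -big_split; apply: eq_big => i; first by rewrite inE.
    by move=> /andP[_ h]; rewrite /psi ifT.
  have -> : \prod_(i in I | ~~ (i < n)%N) psi n k p al be i.+1 = be ^+ #|[set i in I | (n <= i)%N]| * P ^ z2.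
    rewrite -E2 -prodr_const -big_split; apply: eq_big => i; first by rewrite inE -leqNgt.
    by move=> /andP[_ h]; rewrite /psi ifF //; lia.
  by rewrite /z -addrA expfzDr // [P ^ (z1 + z2)]expfzDr // -/(psi0 R n k p); ring.
rewrite E; case: z {E} => m.
  by exists 0%N, m; rewrite expr0 mulr1 mulrA.
by exists m.+1, 0%N; rewrite expr0 mul1r mulrAC NegzE -exprnN mulVf ?expf_neq0 // mul1r.
Qed.

(** Let I have m1 <= n elements in the alpha half and m2 in the beta half. Eliminating beta turns an
    equality into alpha^(n-m1+m2) p^x = p^y', so m1 = n and m2 = 0, which is [satake_index 0]. *)
Lemma satake_neq I : I != satake_index 0 -> satake I != al ^+ n.
Proof.
move=> IE; apply/negP => /eqP SE; have [al0 be0] := satake_neq0; have P0 := satake_P_neq0.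
have [x [y]] := satake_shape I; rewrite SE.
set m1 := #|_|; set m2 := #|_| => E.
have sub1 : [set i in I | (i < n)%N] \subset satake_index 0.
  by apply/fintype.subsetP => i; rewrite !inE => /andP[_ h]; lia.
have m1n : (m1 <= n)%N by rewrite -card_satake_index0 subset_leq_card.
have h : al ^+ (n - m1 + m2) * P ^+ x = P ^+ (y + (2 * k).-1 * m2).
  apply: (mulfI (expf_neq0 m1 al0)); rewrite mulrA -exprD.
  have -> : (m1 + (n - m1 + m2) = n + m2)%N by lia.
  rewrite exprD mulrAC E -[_ * al ^+ m2]mulrA -exprMn [be * al]mulrC prod_ab -exprM exprD.
  ring.
have := al_indep h => m0.
have m1E : m1 = n by lia.
have /eqP/cards0_eq m2E : m2 == 0%N by lia.
have S1 : [set i in I | (i < n)%N] = satake_index 0.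
  by apply/eqP; rewrite eqEcard sub1 card_satake_index0 -[X in (_ <= X)%N]/m1 m1E /=.
case/eqP: IE; rewrite -S1; apply/setP => i; rewrite !inE.
case: ltnP; rewrite ?andbT // andbF => ni.
by have /setP/(_ i) := m2E; rewrite !inE ni andbT.
Qed.

Lemma Phi_factor :
  Phi n k p al be = \prod_(I | (I != finset.set0) && (I != satake_index 0)) ('X - (satake I)%:P).
Proof.
rewrite /Phi.
have -> : \prod_(1 <= r < (2 * n).+1) \prod_(I : {set 'I_(2 * n)} | #|I| == r)
      ('X - (psi0 R n k p * \prod_(i in I) psi n k p al be i.+1)%:P)
   = \prod_(I | I != finset.set0) ('X - (satake I)%:P).
  under eq_bigr do rewrite big_mkcond.
  rewrite exchange_big [RHS]big_mkcond /=; apply: eq_bigr => I _.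
  under eq_bigr do rewrite eq_sym.
  rewrite -big_mkcond big_nat1_eq ltnS card_gt0.
  by rewrite -[X in (_ <= X)%N]card_ord max_card andbT.
rewrite (bigD1 (satake_index 0)) ?satake_index_neq0 //= satake_index0_val.
by rewrite mulKp ?polyXsubC_eq0.
Qed.

Lemma Phi_neq0 : (Phi n k p al be).[al ^+ n] != 0.
Proof.
rewrite Phi_factor horner_prod; apply/prodf_neq0 => I /andP[_ IE].
by rewrite hornerXsubC subr_eq0 eq_sym satake_neq.
Qed.

(** The sets [satake_index j] with 1 <= j <= 2n are distinct, nonempty and different from
    [satake_index 0], so their factors all occur in Phi; Q collects the others. *)
Lemma Phi_lift_factor : exists Q : {poly Cx R}, Phi n k p al be =
  Q * \prod_(i < 2 * n) ('X - (al ^+ n * (lift_eigen p (Cx R) (2 * n) (2 * n - i)).[X0])%:P).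
Proof.
pose G I := 'X - (satake I)%:P.
pose S := [set satake_index (2 * n - i) | i : 'I_(2 * n)].
have inj : injective (fun i : 'I_(2 * n) => satake_index (2 * n - i)).
  move=> i i' E; apply/val_inj => /=; case: (ltngtP i i') => // h.
    have /satake_index_neq : (2 * n - i' < 2 * n - i <= 2 * n)%N.
      by have := ltn_ord i; have := ltn_ord i'; lia.
    by rewrite E eqxx.
  have /satake_index_neq : (2 * n - i < 2 * n - i' <= 2 * n)%N.
      by have := ltn_ord i; have := ltn_ord i'; lia.
    by rewrite E eqxx.
exists (\prod_(I | ((I != finset.set0) && (I != satake_index 0)) && (I \notin S)) G I).
rewrite Phi_factor (bigID (mem S)) /= mulrC; congr (_ * _).
transitivity (\prod_(I in S) G I).
  apply: eq_bigl => I; case: (boolP (I \in S)) => [/imsetP[i _ ->]|]; last by rewrite andbF.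
  rewrite andbT satake_index_neq0 ?leq_subr //=; apply/negP => /eqP E.
  have /satake_index_neq : (0 < 2 * n - i <= 2 * n)%N by have := ltn_ord i; lia.
  by rewrite E eqxx.
rewrite big_imset /=; last by move=> i i' _ _; apply: inj.
apply: eq_bigr => i _; rewrite /G satake_index_val ?leq_subr //.
by rewrite /lift_eigen hornerZ hornerXn.
Qed.

(** The factors match one by one by alpha beta = p^(2k-1). Each of the n + 1 factors releases
    alpha^n, the source of the exponent n(n+1) in the formula. *)
Lemma Psi_siegel_den :
  (Psi n k p al be).[al ^+ n] = al ^+ (n * (n + 1)) * (siegel_den n P).[X0].
Proof.
have [al0 be0] := satake_neq0; have P0 := satake_P_neq0.
rewrite /Psi /siegel_den !hornerM !horner_prod hornerXsubC.
have -> : al ^+ (n * (n + 1)) = al ^+ n * \prod_(1 <= i < n.+1) al ^+ n.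
  rewrite prodr_const_nat subn1 -exprM -exprD; congr (_ ^+ _); lia.
rewrite mulrACA -big_split; congr (_ * _).
  rewrite hornerD hornerN hornerC hornerZ hornerX mulrBr mulr1; congr (_ - _).
  have alE : al ^+ n = al ^+ (n - 1) * al by rewrite -exprSr subn1 prednK.
  rewrite alE -mulrA; congr (_ * _).
  have -> : al * (P ^+ (2 * n) * X0) = al * be * (P ^+ (2 * n) / P ^+ (k + n)) by ring.
  rewrite prod_ab mulrA -exprD; apply: (mulIf (expf_neq0 (k + n) P0)).
  rewrite mulfVK ?expf_neq0 // -exprD; congr (_ ^+ _); lia.
rewrite big_nat_cond [RHS]big_nat_cond; apply: eq_bigr => i /andP[/andP[i0 _] _] /=.
rewrite hornerXsubC hornerD hornerN hornerC hornerZ hornerXn mulrBr mulr1; congr (_ - _).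
have alE : al ^+ n = al ^+ (n - 1) * al by rewrite -exprSr subn1 prednK.
rewrite alE -!mulrA; congr (_ * _).
have -> : al * (P ^+ (2 * n + 2 * i - 1) * X0 ^+ 2)
    = be * (al * be * P ^+ (2 * n + 2 * i - 1) / P ^+ (k + n) ^+ 2).
  by rewrite expr_div_n; ring.
congr (_ * _); rewrite prod_ab -exprD -exprM.
apply: (mulIf (expf_neq0 ((k + n) * 2) P0)).
rewrite mulfVK ?expf_neq0 // -exprD; congr (_ ^+ _); lia.
Qed.

End PhiFactorization.

(** * Multiplicative independence of alpha and p *)

Section OrdinaryIndependence.
Variables (R : realType) (p : nat) (v : Cx R -> rat) (al : Cx R).
Hypothesis p_pr : prime p.
Hypothesis hv : ladic_valuation p v.
Hypothesis al_alg : algebraic al.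
Hypothesis al0 : al != 0.
Hypothesis val : v al = 0.
Hypothesis nm_al : nm al != 1.

Lemma algebraic_natr m : algebraic (m%:R : Cx R).
Proof. by rewrite -(ratr_nat (Cx R)); apply: algebraic_id. Qed.

Lemma algebraic_expr x d : algebraic x -> algebraic (x ^+ d : Cx R).
Proof.
move=> xA; elim: d => [|d IH]; first exact: (algebraic_natr 1).
by rewrite exprS; apply: algebraic_mul.
Qed.

(** v(alpha) = 0 forces i = j, so alpha^d = 1; for d > 0 this contradicts |alpha| <> 1. *)
Lemma ordinary_independent d i j : al ^+ d * p%:R ^+ i = p%:R ^+ j -> d = 0%N.
Proof.
have [vn vM _] := hv.
have P0 : (p%:R : Cx R) != 0 by rewrite pnatr_eq0 -lt0n prime_gt0.
have vP m : v (p%:R ^+ m) = m%:R.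
  by rewrite -natrX vn ?expn_gt0 ?prime_gt0 // pfactorK.
have vX m : v (al ^+ m) = 0.
  elim: m => [|m IH]; first exact: (vP 0%N).
  by rewrite exprS vM ?expf_neq0 // ?val ?IH ?addr0 //; apply: algebraic_expr.
move=> E; have : v (al ^+ d * p%:R ^+ i) = v (p%:R ^+ j) by rewrite E.
rewrite vM ?expf_neq0 //; try by apply: algebraic_expr => //; apply: algebraic_natr.
rewrite vX !vP add0r => /eqP; rewrite eqr_nat => /eqP ij.
have al1 : al ^+ d = 1.
  by apply: (mulIf (expf_neq0 i P0)); rewrite E ij mul1r.
apply/eqP; case: d {E} al1 => // d al1; case/negP: nm_al.
by rewrite -(@pexpr_eq1 R (nm al) d.+1) ?nm_ge0 // -nmX al1 nm1.
Qed.

End OrdinaryIndependence.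

(** * The recurrence for values of the Siegel polynomials *)

Section HornerRecurrence.
Variable R : realType.

Lemma recact_horner (A : comNzRingType) (P : {poly {poly A}}) u (x : A) :
  (recact P u).[x] = recact (map_poly (horner_eval x) P) (fun i => (u i).[x]).
Proof.
rewrite [RHS](@recactE _ (size P)) ?size_poly // /recact horner_sum.
by apply: eq_bigr => i _; rewrite hornerM coef_map.
Qed.

(** The polynomial recurrence, applied to p^m T, yields every shift m, as [recact_constant_factor]
    requires. *)
Lemma siegel_value_recurrence n p (T : 'M[rat]_(2 * n)) (P : nat -> {poly int}) (x : Cx R) :
  let Q := \prod_(i < 2 * n) ('X - (lift_eigen p (Cx R) (2 * n) (2 * n - i)).[x]%:P) in
  prime p -> half_integral T ->
  (forall i, is_siegel_poly R p ((p ^ i)%:R *: T) (P i)) ->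
  (forall i, fundT ((p ^ i)%:R *: T) = fundT T) ->
  forall m, (siegel_den n p%:R).[x] * recact Q (fun j => (map_poly intr (P (m + j)%N)).[x])
  = (1 - (kronecker (fundT T) p)%:~R * p%:R ^+ n * x) * Q.[1].
Proof.
move=> Q p_pr hT HP fE m.
have QE : map_poly (horner_eval x) (lift_poly p (Cx R) (2 * n) (2 * n)) = Q.
  rewrite /lift_poly rmorph_prod; apply: eq_bigr => i _.
  by rewrite rmorphB /= map_polyX map_polyC.
have Tm j : (p ^ j)%:R *: ((p ^ m)%:R *: T) = (p ^ (m + j))%:R *: T :> 'M[rat]_(2 * n).
  by rewrite scalerA -natrM -expnD addnC.
have HPm j : is_siegel_poly R p ((p ^ j)%:R *: ((p ^ m)%:R *: T)) (P (m + j)%N) by rewrite Tm.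
have fEm j : fundT ((p ^ j)%:R *: ((p ^ m)%:R *: T)) = fundT ((p ^ m)%:R *: T) by rewrite Tm !fE.
have := congr1 (horner_eval x) (siegel_poly_recurrence p_pr (half_integral_scale _ hT) HPm fEm).
rewrite fE /horner_eval !hornerM recact_horner QE => ->.
rewrite hornerD hornerN hornerC hornerZ hornerX -horner_evalE; congr (_ * _).
rewrite /lift_poly /Q !horner_prod rmorph_prod.
by apply: eq_bigr => i _; rewrite !hornerXsubC rmorphB /= rmorph1 /horner_eval.
Qed.

End HornerRecurrence.

(** * Coefficients of the lift at p^i T *)

Section LiftCoefficients.
Variables (R : realType) (n k p : nat) (c alpha beta : nat -> Cx R).
Variable F : nat -> 'M[rat]_(2 * n) -> {poly int}.
Hypothesis p_pr : prime p.

Lemma iter_Up i (A : fourier_exp R n) T : half_integral T ->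
  iter i (Up p) A T = A ((p ^ i)%:R *: T).
Proof.
elim: i T => [|i IH] T hT; first by rewrite scale1r.
by rewrite iterS /Up hT IH ?half_integral_scale // scalerA -natrM -expnSr.
Qed.

Variables (T : 'M[rat]_(2 * n)) (d : int) (f : nat).
Hypothesis p2 : (2 < p)%N.
Hypothesis hF : forall l T, prime l -> half_integral T -> posdef T -> is_siegel_poly R l T (F l T).
Hypothesis hT : half_integral T.
Hypothesis posT : posdef T.
Hypothesis Fd : fundamental_disc d.
Hypothesis f0 : (0 < f)%N.
Hypothesis DE : discT T = d * (f ^ 2)%N%:Z.

Local Notation G i := ((map_poly intr (F p ((p ^ i)%:R *: T)) : {poly Cx R}).[beta p * p%:R ^- (k + n)]).

Lemma di_lift_scale i :
  di_lift k c alpha beta F ((p ^ i)%:R *: T) = c `|d|%N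
    * (\prod_(l <- primes f | l != p)
         (alpha l ^+ logn l f * (map_poly intr (F l T) : {poly Cx R}).[l%:R ^- (k + n) * beta l]))
    * alpha p ^+ logn p f * ((alpha p ^+ n) ^+ i * G i).
Proof.
have pi0 : (0 < p ^ i)%N by rewrite expn_gt0 prime_gt0.
have pn0 : (0 < p ^ (n * i))%N by rewrite expn_gt0 prime_gt0.
have hTi : half_integral ((p ^ i)%:R *: T) by apply: half_integral_scale.
have posTi : posdef ((p ^ i)%:R *: T) by apply: posdef_scale.
have [cE fE] := cond_fund_scale i hT p_pr Fd f0 DE.
have [_ fE0] := cond_fund_scale 0 hT p_pr Fd f0 DE.
rewrite scale1r in fE0.
set f' := (p ^ (n * i) * f)%N in cE.
have f'0 : (0 < f')%N by rewrite muln_gt0 pn0.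
have DE' : discT ((p ^ i)%:R *: T) = d * (f' ^ 2)%N%:Z.
  rewrite discT_scale // DE -mulrA -PoszM; congr (_ * Posz _).
  by rewrite /f' expnMn -!expnM mulnC; congr (_ * _)%N; congr expn; ring.
rewrite /di_lift hTi asboolT // fE cE /= -!mulrA; congr (_ * _).
set LF := local_factor _ _ _ _ _ _.
rewrite (bigID (pred1 p)) /= mulrC; congr (_ * _).
  rewrite -big_filter -[RHS]big_filter.
  have E : perm_eq [seq l <- primes f' | l != p] [seq l <- primes f | l != p].
    apply: uniq_perm; rewrite ?filter_uniq ?primes_uniq // => l.
    rewrite !mem_filter !mem_primes f0 f'0; case: eqP => //= lp.
    case: (boolP (prime l)) => //= l_pr; rewrite Gauss_dvdr // coprimeXr //.
    by rewrite prime_coprime // dvdn_prime2 //; apply/eqP.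
  rewrite (perm_big _ E) big_seq_cond [RHS]big_seq_cond; apply: eq_bigr => l.
  rewrite andbT mem_filter mem_primes => /andP[lp /and3P[l_pr _ _]].
  have lpc : coprime l p by rewrite prime_coprime // dvdn_prime2.
  rewrite /LF /local_factor [beta l * _]mulrC; congr (_ ^+ _ * horner _ _).
    by rewrite lognM // lognX logn_coprime // muln0.
  apply: (siegel_poly_uniq (hF l_pr hTi posTi) (hF l_pr hT posT)); first by rewrite fE fE0.
  by move=> m; apply: siegel_series_unit_scale; rewrite ?coprimeXr.
rewrite mulrA -exprM -exprD.
have vE : logn p f' = (logn p f + n * i)%N by rewrite lognM // pfactorK // addnC.
have [pf|pf] := boolP (p \in primes f').
  rewrite -big_filter filter_pred1_uniq ?primes_uniq // big_seq1.
  by rewrite /LF /local_factor vE.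
(* If p does not divide the conductor of p^i T, the product has no factor at p; the missing factor
   is 1 because F_p = 1 there. *)
rewrite -vE -big_filter (_ : [seq _ <- _ | _] = [::]); last first.
  by apply/eqP; rewrite -[_ == _]negbK -has_filter; apply/hasPn => l lf /=; apply: contraNneq pf => <-.
have cp : coprime p f'.
  by rewrite prime_coprime //; move: pf; rewrite mem_primes p_pr f'0.
rewrite big_nil logn_coprime // mul1r.
rewrite (siegel_poly_eq1_conductor p_pr p2 hTi Fd f'0 DE' cp (hF p_pr hTi posTi)).
by rewrite hornerC.
Qed.

End LiftCoefficients.

Theorem theorem4p1 (R : realType) (v : nat -> Cx R -> rat)
    (hv : forall l, prime l -> ladic_valuation l (v l))
    (p n k : nat) (hp : prime p) (hp5 : (5 < p)%N)
    (hn : (1 <= n)%N) (hk : (1 <= k)%N) (hnk : n = k %[mod 2])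
    (f : Cx R -> Cx R) (a : nat -> Cx R)
    (hf : normalized_eigenform (2 * k) f a)
    (alpha beta : nat -> Cx R)
    (hroots : hecke_roots v (2 * k) a alpha beta)
    (hord : v p (alpha p) = 0)
    (h : Cx R -> Cx R) (c : nat -> Cx R)
    (hh : kohnen_eigenform k h c)
    (hfh : shimura_corr k a c)
    (F : nat -> 'M[rat]_(2 * n) -> {poly int})
    (hF : forall l T, prime l -> half_integral T -> posdef T ->
      is_siegel_poly R l T (F l T))
    (T : 'M[rat]_(2 * n)) (hT : half_integral T) (hTpos : posdef T)
    (dT : int) (fT : nat) (hdT : fundamental_disc dT) (hfT : (1 <= fT)%N)
    (hDT : discT T = dT * (fT ^ 2)%N%:Z) :
  stabilized_lift k p c alpha beta F T =
    (1 - (kronecker dT p)%:~R * beta p * p%:R ^- k)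
    * c `|dT|%N
    * alpha p ^+ (logn p fT + n * (n + 1))
    * \prod_(l <- primes fT | l != p)
        (alpha l ^+ logn l fT
         * (map_poly intr (F l T) : {poly Cx R}).[l%:R ^- (k + n) * beta l]).
Proof.
have [E al_alg _ _] := hroots p hp.
have prod_ab : alpha p * beta p = p%:R ^+ (2 * k).-1.
  have := congr1 (fun P : {poly Cx R} => P.[0]) E.
  rewrite /= !hornerE; move: (p%:R ^+ _) => q e.
  by apply/eqP; rewrite -subr_eq0; apply/eqP; ring: e.
have sum_ab : alpha p + beta p = a p.
  have := congr1 (fun P : {poly Cx R} => P.[1]) E.
  rewrite /= !hornerE expr1n -prod_ab => e.
  have -> : a p = 1 + alpha p * beta p - (1 - a p + alpha p * beta p) by ring.
  by rewrite e; ring.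
have P0 : (p%:R : Cx R) != 0 by rewrite pnatr_eq0 -lt0n prime_gt0.
have al0 : alpha p != 0.
  have : alpha p * beta p != 0 by rewrite prod_ab expf_neq0.
  by rewrite mulf_eq0 negb_or => /andP[].
have p2 : (2 < p)%N by lia.
have nm_al := ordinary_root_norm hk hf hp p2 sum_ab prod_ab.
have indep := ordinary_independent hp (hv p hp) al_alg al0 hord nm_al.
have Phi0 := Phi_neq0 hp hn hk prod_ab indep.
have [Q QE] := Phi_lift_factor hp hn hk prod_ab.
have fE i := (cond_fund_scale i hT hp hdT hfT hDT).2.
have fE0 : fundT T = dT by have := fE 0%N; rewrite expn0 scale1r.
have pi0 i : (0 < p ^ i)%N by rewrite expn_gt0 prime_gt0.
rewrite /stabilized_lift /poly_action.
set x := beta p * p%:R ^- (k + n).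
set C := c `|dT|%N.
set L := \prod_(l <- _ | _) _.
pose g i := (map_poly intr (F p ((p ^ i)%:R *: T)) : {poly Cx R}).[x].
have -> : \sum_(i < size (Phi n k p (alpha p) (beta p))) (Phi n k p (alpha p) (beta p))`_i
      * iter i (Up p) (di_lift k c alpha beta F) T
    = C * L * alpha p ^+ logn p fT
      * recact (Phi n k p (alpha p) (beta p)) (fun i => (alpha p ^+ n) ^+ i * g i).
  rewrite /recact mulr_sumr; apply: eq_bigr => i _; rewrite iter_Up //.
  by rewrite (di_lift_scale k c alpha beta hp p2 hF hT hTpos hdT hfT hDT) mulrCA.
have rec := siegel_value_recurrence x hp hT
  (fun i => hF p _ hp (half_integral_scale (p ^ i) hT) (posdef_scale (pi0 i) hTpos))
  (fun i => etrans (fE i) (esym fE0)).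
(* Phi(U) thus yields Phi(alpha^n) times the Euler factor divided by [siegel_den] at x; the
   normalizing quotient cancels both up to alpha^(n(n+1)). *)
have := recact_constant_factor (g := g) Q (alpha p ^+ n) rec.
rewrite -QE fE0 => main.
(* At x = beta p^(-k-n) one has p^n x = beta p^(-k). *)
have kapE : 1 - (kronecker dT p)%:~R * p%:R ^+ n * x = 1 - (kronecker dT p)%:~R * beta p * p%:R ^- k.
  by rewrite /x exprD; field; rewrite !expf_neq0.
rewrite kapE in main.
rewrite (Psi_siegel_den hp hn hk prod_ab).
rewrite [alpha p ^+ (logn p fT + _)]exprD -/x.
transitivity (alpha p ^+ (n * (n + 1)) * (C * L * alpha p ^+ logn p fT)
   * ((siegel_den n p%:R).[x] * recact (Phi n k p (alpha p) (beta p)) (fun i => (alpha p ^+ n) ^+ i * g i))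
   / (Phi n k p (alpha p) (beta p)).[alpha p ^+ n]).
  by ring.
by rewrite main [X in X / _]mulrA mulfK //; ring.
Qed.
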